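(* For all $K\ge1$, $1<\alpha\le2\le\beta<\infty$ and $D>0$ there exists a constant $C(K,D,\alpha,\beta)$, depending only on $K,D,\alpha,\beta$, such that the following holds. Let $\Phi\colon\mathbb{R}_+\to\mathbb{R}_+\cup\{\infty\}$ be a convex non-decreasing function with $\Phi(0)=0$ and $\Phi(1)=1$, and let $\tilde\Phi(x)=x^2$ for $0\le x\le1$ and $\tilde\Phi(x)=\Phi(x)$ for $x\ge1$. Assume that $$K^{-1}t^{\beta^\ast}\le\frac{\tilde\Phi(tu)}{\tilde\Phi(u)}\le Kt^{\alpha^\ast}\qquad\text{for all }t\ge1,\ u>0,$$ where $\alpha^\ast=\alpha/(\alpha-1)$ and $\beta^\ast=\beta/(\beta-1)$. Let $\Psi(x)=\sum_{i=1}^n\tilde\Phi^\ast(x_i)$ for $x\in\mathbb{R}^n$, where $\tilde\Phi^\ast$ is the Legendre transform of $\tilde\Phi$. Assume that a measure $\mu$ on $\mathbb{R}^n$, absolutely continuous with respect to Lebesgue measure, satisfies the modified logarithmic Sobolev inequality $mLSI(\Psi,D)$. Let $X$ be a random vector with law $\mu$ and let $Z=(Z_1,\ldots,Z_n)$ be a sequence of i.i.d. symmetric random variables, independent of $X$, with $\mathbb{P}(|Z_i|\ge t)=e^{-\Phi(t)}$ for $t\ge0$. Then for every locally Lipschitz function $f\colon\mathbb{R}^n\to\mathbb{R}$ and every $p\ge2$, $$\|f(X)-\mathbb{E}f(X)\|_p\le C(K,D,\alpha,\beta)\,\|\langle\nabla f(X),Z\rangle\|_p .$$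
   Context: $\mathbb{R}_+=[0,\infty)$. $mLSI(\Psi,D)$: $\mu$ is a probability measure and for every bounded locally Lipschitz $f\colon\mathbb{R}^n\to(0,\infty)$, $$\mathrm{Ent}_\mu f^2\le D\,\mathbb{E}_\mu\Psi\Big(\frac{\nabla f}{f}\Big)f^2,$$ where $\mathbb{E}_\mu$ is integration with respect to $\mu$ and $\mathrm{Ent}_\mu g=\mathbb{E}_\mu g\log g-\mathbb{E}_\mu g\log\mathbb{E}_\mu g$ for $g\ge 0$. Gradients of locally Lipschitz functions exist Lebesgue-a.e., hence $\mu$-a.e. Legendre transform: with $\tilde\Phi$ extended to $\mathbb{R}$ as an even function, $\tilde\Phi^\ast(y)=\sup_{x\in\mathbb{R}}(xy-\tilde\Phi(x))=\sup_{x\ge0}(x|y|-\tilde\Phi(x))$. Moments: $\|Y\|_p=(\mathbb{E}|Y|^p)^{1/p}$. The inequality is understood to be trivially satisfied when its right-hand side is infinite. *)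

(* Defs.v *)
From HB Require Import structures.
From mathcomp Require Import all_boot all_order all_algebra.
From mathcomp Require Import all_classical all_reals all_analysis.

Set Implicit Arguments.
Unset Strict Implicit.
Unset Printing Implicit Defensive.

Import Order.TTheory GRing.Theory Num.Theory.
Import numFieldNormedType.Exports.

Local Open Scope classical_set_scope.
Local Open Scope ring_scope.

(* R^n is 'rV[R]_n, equipped with its Borel sigma-algebra. *)
HB.instance Definition _ (R : realType) (n : nat) :=
  @isMeasurable.Build (sigma_display (@open 'rV[R]_n)) 'rV[R]_n
    <<s @open 'rV[R]_n >> (@sigma_algebra0 _ setT _) (@sigma_algebraC _ _)
    (@sigma_algebra_bigcup _ setT _).

(* n-dimensional Lebesgue measure as an iterated integral of sections;
   R^0 carries the unit mass. *)
Fixpoint lebesgue_rV (R : realType) (n : nat) : set 'rV[R]_n -> \bar R :=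
  match n return set 'rV[R]_n -> \bar R with
  | 0 => fun A => \d_(0 : 'rV[R]_0) A
  | m.+1 => fun A =>
      (\int[lebesgue_measure]_x
        @lebesgue_rV R m [set v | A (row_mx (x%:M : 'rV_1) v)])%E
  end.

(* Normalisation: boxes have their usual volume. *)
Lemma lebesgue_rV_box (R : realType) n (a b : 'rV[R]_n) :
  (forall i, a 0 i <= b 0 i) ->
  lebesgue_rV [set v : 'rV[R]_n | forall i, a 0 i <= v 0 i <= b 0 i] =
  (\prod_i (b 0 i - a 0 i))%:E.
Proof.
elim: n a b => [|n IH] a b ab /=.
  by rewrite big_ord0 diracE mem_set// => -[].
set a1 : 'rV_n := \row_i a 0 (lift ord0 i).
set b1 : 'rV_n := \row_i b 0 (lift ord0 i).
have E x : [set v : 'rV[R]_n | [set v : 'rV[R]_n.+1 |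
      forall i, a 0 i <= v 0 i <= b 0 i] (row_mx (x%:M : 'rV_1) v)] =
    if (a 0 ord0 <= x <= b 0 ord0) then
      [set v : 'rV[R]_n | forall i, a1 0 i <= v 0 i <= b1 0 i] else set0.
  have e0 v : (row_mx (x%:M : 'rV_1) v : 'rV_n.+1) 0 ord0 = x.
    have -> : ord0 = lshift n (ord0 : 'I_1) by apply/val_inj.
    by rewrite (row_mxEl (x%:M : 'rV_1)) mxE.
  have eS v i : (row_mx (x%:M : 'rV_1) v : 'rV_n.+1) 0 (lift ord0 i) = v 0 i.
    have -> : lift ord0 i = rshift 1 i by apply/val_inj.
    by rewrite (row_mxEr (x%:M : 'rV_1)).
  case: ifPn => h; apply/seteqP; split => v //=.
  - by move=> + i => /(_ (lift ord0 i)); rewrite eS !mxE.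
  - move=> + i; case: (unliftP ord0 i) => [j ->|->]; last by rewrite e0.
    by move=> /(_ j); rewrite eS !mxE.
  - by move=> /(_ ord0); rewrite e0 (negPf h).
have L0 : @lebesgue_rV R n set0 = 0%E.
  elim: n {IH a b ab a1 b1 E} => [|m IHm] /=; first by rewrite measure0.
  by apply: integral0_eq => x _.
transitivity (\int[lebesgue_measure]_(x in `[(a 0%R ord0), (b 0%R ord0)])
   (\prod_i (b1 0 i - a1 0 i))%R%:E)%E.
  rewrite [RHS]integral_mkcond; apply: eq_integral => x _.
  rewrite E patchE mem_setE in_itv /=; case: ifP => // _.
  by rewrite IH// => i; rewrite !mxE.
rewrite integral_cst//= lebesgue_measure_itv/= lte_fin big_ord_recl EFinM.
under eq_bigr do rewrite !mxE.
rewrite muleC; case: ltP => [_|ba]; first by rewrite -EFinB.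
have /eqP -> : b 0 ord0 == a 0 ord0 by rewrite eq_le ba ab.
by rewrite subrr !mul0e.
Qed.

Section analysis_defs.
Context {R : realType} {n : nat}.
Implicit Types f : 'rV[R]_n -> R.

Definition locally_lipschitz f :=
  forall a : 'rV[R]_n, exists2 U, nbhs a U & [lipschitz f x | x in U].

(* Partial derivatives; where one does not exist, its value is an irrelevant
   default: for locally Lipschitz f this happens on a Lebesgue-null set. *)
Definition gradient f (x : 'rV[R]_n) : 'rV[R]_n :=
  \row_i 'D_(delta_mx 0 i) f x.

Definition dotrV (u v : 'rV[R]_n) : R := \sum_i u 0 i * v 0 i.

End analysis_defs.

Section young_functions.
Context {R : realType}.
Local Open Scope ereal_scope.

(* Functions on [0, +oo[ are total functions on R of which only the values at
   nonnegative arguments matter.  In the convexity inequality, 0 * +oo = 0. *)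
Definition convex_on_nneg (Phi : R -> \bar R) :=
  forall x y t : R, (0 <= x)%R -> (0 <= y)%R -> (0 <= t <= 1)%R ->
    Phi (t * x + (1 - t) * y)%R <= t%:E * Phi x + (1 - t)%:E * Phi y.

Definition nondecreasing_on_nneg (Phi : R -> \bar R) :=
  forall x y : R, (0 <= x)%R -> (x <= y)%R -> Phi x <= Phi y.

(* The modification of Phi, extended to R as an even function. *)
Definition tilde (Phi : R -> \bar R) (x : R) : \bar R :=
  if (`|x| <= 1)%R then (`|x| ^+ 2)%:E else Phi `|x|%R.

Definition legendre (F : R -> \bar R) (y : R) : \bar R :=
  ereal_sup [set (x * y)%:E - F x | x in [set: R]].

Definition conj_exponent (a : R) : R := (a / (a - 1))%R.

Definition growth_condition (K alpha beta : R) (F : R -> \bar R) :=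
  forall t u : R, (1 <= t)%R -> (0 < u)%R ->
    (K^-1 * t `^ conj_exponent beta)%:E <= F (t * u)%R / F u
      <= (K * t `^ conj_exponent alpha)%:E.

Definition sum_conjugate (n : nat) (F : R -> \bar R) (x : 'rV[R]_n) : \bar R :=
  \sum_(i < n) legendre F (x 0%R i).

End young_functions.

Section mLSI.
Context {R : realType}.
Local Open Scope ereal_scope.

Definition entropy d (T : measurableType d) (mu : probability T R)
    (g : T -> R) : \bar R :=
  \int[mu]_x (g x * ln (g x))%:E
    - (\int[mu]_x (g x)%:E) * lne (\int[mu]_x (g x)%:E).

Definition mLSI (n : nat) (Psi : 'rV[R]_n -> \bar R) (D : R)
    (mu : probability 'rV[R]_n R) :=
  forall f : 'rV[R]_n -> R,
    (forall x, (0 < f x)%R) -> [bounded f x | x in [set: 'rV[R]_n]] ->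
    locally_lipschitz f ->
    entropy mu (fun x => (f x ^+ 2)%R) <=
    D%:E * \int[mu]_x (Psi ((f x)^-1 *: gradient f x)%R * (f x ^+ 2)%:E).

End mLSI.

Section random_vectors.
Context d {Omega : measurableType d} {R : realType} (P : probability Omega R).
Local Open Scope ereal_scope.

Definition independent_pair d1 d2 (T1 : measurableType d1)
    (T2 : measurableType d2) (X : Omega -> T1) (Y : Omega -> T2) :=
  forall A B, measurable A -> measurable B ->
    P (X @^-1` A `&` Y @^-1` B) = P (X @^-1` A) * P (Y @^-1` B).

Definition independent_family (n : nat) (Y : 'I_n -> Omega -> R) :=
  forall (J : {set 'I_n}) (B : 'I_n -> set R), (forall i, measurable (B i)) ->
    P (\bigcap_(i in [set` J]) (Y i @^-1` B i)) =
    \prod_(i in J) P (Y i @^-1` B i).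

Definition identically_distributed (n : nat) (Y : 'I_n -> Omega -> R) :=
  forall (i j : 'I_n) (B : set R), measurable B ->
    P (Y i @^-1` B) = P (Y j @^-1` B).

Definition symmetric_rv (Y : Omega -> R) :=
  forall B : set R, measurable B ->
    P (Y @^-1` B) = P ((fun w => - Y w)%R @^-1` B).

End random_vectors.

(* Main.v *)
(* Let F be the modified Young function, L its Legendre transform, and
   rho(y) = E |<y, Z>|^p, so that E |<grad f(X), Z>|^p is the mu-integral of
   rho(grad f).

   The tails of Z enter through a lower bound on rho in dual form: if rho(y) <= 1,
   t_i >= 0 and sum F(t_i) <= p, then sum |y_i| t_i <= e^7. It follows by
   integrating <y, Z> against a density prod G_i(Z_i) which shifts the mean of each
   Z_i by t_i at the price E G_i^2 <= exp(7 F(t_i)). By duality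
   sum L(p y_i / (e^7 K)) <= p, and the Euclidean norm of y is at most e^7.

   The inequality mLSI bounds the entropy of u^2, which is at least
   E u^2 ln (E u^2 / (E u)^2), and near constant functions it yields a Poincare
   inequality, as L(y) <= y^2 / 4 for |y| <= 1. For bounded f put
   w = (f - E f)^2 + A^2 with A^p >= E rho(grad f). For 2 <= q <= p the function
   u = w^(q/4), inserted in mLSI if p >= beta and in the Poincare inequality
   otherwise, satisfies E u^2 <= (E u)^2 exp(k q (q/p)^(alpha - 1)). Along
   q = p, p/2, p/4, ... these exponents form a convergent geometric series because
   alpha > 1, and the Poincare inequality bounds E w at the bottom. Unbounded f are
   reached by smooth truncation and Fatou's lemma. *)

Require Import Defs.
From HB Require Import structures.
From mathcomp Require Import all_boot all_order all_algebra.
From mathcomp Require Import all_classical all_reals all_analysis.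
From mathcomp Require Import ring lra measurable_realfun.

Set Implicit Arguments.
Unset Strict Implicit.
Unset Printing Implicit Defensive.

Import Order.TTheory GRing.Theory Num.Theory.
Import numFieldNormedType.Exports.

Local Open Scope classical_set_scope.
Local Open Scope ring_scope.

(** Only the mean of rho(grad f) is controlled, whereas mLSI asks for a pointwise bound on Psi at
    the logarithmic gradient of u. Let g = w^(1/2) and let r >= A satisfy rho(grad f) <= r^p. The
    logarithmic gradient of u is at most q / (2 g) times grad f, and the sum of L over the
    coordinates of p grad f / (e^7 K r) is at most p. Passing from the latter vector to the former
    is a dilation of order (q/p)(r/g); as q <= p it costs (q/p)^alpha ((r/g)^alpha + (r/g)^beta) up
    to constants, and p (q/p)^alpha = q (q/p)^(alpha - 1) is the announced exponent. The powers of
    r/g disappear through (r/g)^d g^q <= g^q + A^(q - p) r^p, valid for d <= p. After integration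
    the last term is of order A^q, which g >= A absorbs: this is the purpose of the summand A^2 in
    w. For d = beta the inequality requires beta <= p. When p < beta the Poincare inequality
    involves only d = 2, and a small multiple of E g^q is absorbed on the left; the resulting
    constant has the required exponential form because q (q/p)^(alpha - 1) >= 1 / beta there. *)

(** The suprema run over independent choices, so near-maximisers losing at most e / (#|I| + 1) each
    can be picked simultaneously. Finiteness comes first: freezing the other coordinates at [t0]
    bounds each supremum. *)
Lemma sum_ereal_sup_le (R : realType) (I : finType) (T : Type) (t0 : T)
    (G : I -> T -> R) (M : R) :
  (forall u : I -> T, \sum_i G i (u i) <= M) ->
  (\sum_i ereal_sup [set (G i x)%:E | x in [set: T]] <= M%:E)%E.
Proof.
move=> GM.
have fins i : ereal_sup [set (G i x)%:E | x in [set: T]] \is a fin_num.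
  rewrite fin_real//; apply/andP; split.
    by apply: lt_le_trans (ereal_sup_ubound _); [exact: (ltNyr (G i t0))|exists t0].
  apply: (@le_lt_trans _ _ (M - \sum_(j | j != i) G j t0)%:E); last exact: ltry.
  apply: ge_ereal_sup => _ [x _ <-]; rewrite lee_fin lerBrDr.
  apply: le_trans (GM (fun j => if j == i then x else t0)).
  rewrite [leRHS](bigD1 i)//= eqxx lerD2l.
  by apply: ler_sum => j /negPf ->.
apply/lee_addgt0Pr => e e0.
pose d := e / (#|I|%:R + 1).
have d0 : 0 < d by rewrite divr_gt0// ltr_wpDl.
have /choice[u uP] i : exists x : T,
    (ereal_sup [set (G i x)%:E | x in [set: T]] <= (G i x)%:E + d%:E)%E.
  have [_ [x _ <-] /ltW] := ub_ereal_sup_adherent d0 (fins i).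
  by rewrite leeBlDr// => h; exists x.
apply: le_trans (lee_sum _ (fun i _ => uP i)) _.
under eq_bigr do rewrite -EFinD.
rewrite sumEFin -EFinD lee_fin big_split/= lerD// sumr_const -mulr_natr /d.
by rewrite mulrAC ler_pdivrMr ?ltr_wpDl// ler_pM2l// lerDl.
Qed.

(** * Legendre transform of a Young function *)

Section young_function.
Context {R : realType} (F : R -> R) (K a b : R).
Context (K1 : 1 <= K) (a1 : 1 < a) (b1 : 1 < b) (evenF : forall x, F `|x| = F x)
  (smallF : forall x, `|x| <= 1 -> F x = x ^+ 2)
  (largeF : forall x, 1 <= `|x| -> `|x| <= F x)
  (growF : forall t u, 1 <= t ->
    K^-1 * t `^ conj_exponent b * F u <= F (t * u)
      <= K * t `^ conj_exponent a * F u).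

Local Notation L := (legendre (fun x => (F x)%:E)).

Let K0 : 0 < K. Proof. exact: lt_le_trans K1. Qed.

Lemma legendre_ubound (x y : R) : ((x * y - F x)%:E <= L y)%E.
Proof. by apply: ereal_sup_ubound; exists x. Qed.

Lemma legendre_ge0 (y : R) : (0 <= L y)%E.
Proof.
apply: le_trans (legendre_ubound 0 y).
by rewrite mul0r sub0r smallF ?normr0// expr0n/= oppr0.
Qed.

Lemma legendreN (y : R) : L (- y) = L y.
Proof.
rewrite /legendre; congr ereal_sup; apply/seteqP; split => _ [x _ <-];
  exists (- x) => //; rewrite -!EFinB; congr EFin; rewrite -(evenF (- x)) normrN evenF; ring.
Qed.

(** For |x| <= 1 the bound is a completed square; for |x| >= 1 the term is nonpositive, since F x >=
    |x| >= x y. *)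
Lemma legendre_small (y : R) : `|y| <= 1 -> (L y <= (y ^+ 2 / 4)%:E)%E.
Proof.
move=> y1; apply: ge_ereal_sup => _ [x _ <-]; rewrite -EFinB lee_fin.
have [x1|/ltW x1] := lerP `|x| 1.
  rewrite smallF//; have := sqr_ge0 (x - y / 2); lra.
apply: (@le_trans _ _ 0); last by rewrite divr_ge0 ?sqr_ge0.
rewrite subr_le0; apply: le_trans (largeF x1); apply: le_trans (ler_norm _) _.
by rewrite normrM ler_piMr.
Qed.

(** Evaluating the supremum [L y] at s x turns a growth inequality of F into a dilation inequality
    for L. *)
Lemma legendre_dilate (s c t y : R) : 0 <= c ->
  (forall x, t * x * y - F x <= c * (s * x * y - F (s * x))) ->
  (L (t * y) <= c%:E * L y)%E.
Proof.
move=> c0 h; apply: ge_ereal_sup => _ [x _ <-].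
apply: (@le_trans _ _ (c%:E * (s * x * y - F (s * x))%:E)%E).
  by rewrite -EFinB -EFinM lee_fin; apply: le_trans (h x); lra.
by rewrite lee_wpmul2l ?lee_fin//; exact: legendre_ubound.
Qed.

Let powR_conj (x c : R) : 1 < c -> (x `^ (c - 1)) `^ conj_exponent c = x `^ c.
Proof.
move=> c1; rewrite -powRrM; congr powR; rewrite /conj_exponent; field.
by rewrite subr_eq0 gt_eqF.
Qed.

Let powR_pred (x c : R) : 0 < x -> x * x `^ (c - 1) = x `^ c.
Proof.
move=> x0; have -> : x `^ c = x `^ (1 + (c - 1)) by congr powR; ring.
by rewrite [RHS]powRD ?(gt_eqF x0) ?implybT// powRr1// ltW.
Qed.

(** Duality exchanges the exponents: the lower growth of F, with the conjugate exponent of b, yields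
    the power b for large dilations, and the upper growth, with that of a, yields the power a for
    small ones. Splitting at K t = 1 keeps the rescaling s at least 1, as [growF] demands. *)
Lemma legendre_dilate_pos (t y : R) : 0 < t ->
  (L (t * y) <= ((K * t) `^ a + (K * t) `^ b)%:E * L y)%E.
Proof.
move=> t0; have Kt0 : 0 < K * t by rewrite mulr_gt0.
have Ki : K^-1 <= 1 by rewrite invf_le1.
have [Kt1|/ltW Kt1] := lerP 1 (K * t).
  apply: (@le_trans _ _ ((K^-1 * (K * t) `^ b)%:E * L y)%E); last first.
    rewrite lee_wpmul2r ?legendre_ge0// lee_fin.
    rewrite (@le_trans _ _ ((K * t) `^ b))// ?lerDr ?powR_ge0//.
    by rewrite ler_piMl ?powR_ge0.
  (* With this exponent the growth factor of F along s is K^-1 (K t)^b, and dividing it by s leaves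
     exactly t, so the linear terms on both sides agree. The other case is the mirror image with
     a. *)
  set s := (K * t) `^ (b - 1).
  have s1 : 1 <= s.
    by rewrite -[leLHS](powRr0 (K * t)) ler_powR// subr_ge0 ltW.
  apply: (@legendre_dilate s^-1); first by rewrite mulr_ge0 ?powR_ge0 ?invr_ge0 1?ltW.
  move=> x; have /andP[h _] := growF (s^-1 * x) s1.
  have s0 : s != 0 by rewrite gt_eqF// (lt_le_trans _ s1).
  move: h; rewrite mulrA divff// mul1r powR_conj// => h.
  have e : K^-1 * (K * t) `^ b * s^-1 = t.
    by rewrite -powR_pred// -/s; field; rewrite s0 gt_eqF.
  have -> : t * x * y = K^-1 * (K * t) `^ b * (s^-1 * x * y).
    by rewrite -{1}e; ring.
  lra.
apply: (@le_trans _ _ ((K^-1 * (K * t) `^ a)%:E * L y)%E); last first.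
  rewrite lee_wpmul2r ?legendre_ge0// lee_fin.
  rewrite (@le_trans _ _ ((K * t) `^ a))// ?lerDl ?powR_ge0//.
  by rewrite ler_piMl ?powR_ge0.
set s := (K * t)^-1 `^ (a - 1).
have iKt1 : 1 <= (K * t)^-1 by rewrite invf_ge1.
have s1 : 1 <= s.
  by rewrite -[leLHS](powRr0 (K * t)^-1) ler_powR// subr_ge0 ltW.
apply: (@legendre_dilate s); first by rewrite mulr_ge0 ?powR_ge0 ?invr_ge0 1?ltW.
move=> x; have /andP[_] := growF x s1.
have s0 : 0 < s by rewrite (lt_le_trans _ s1).
have pV : (K * t)^-1 `^ a = ((K * t) `^ a)^-1.
  by rewrite -powR_inv1 1?ltW// -powRrM mulN1r powRN.
rewrite powR_conj// pV => h.
have e : K^-1 * (K * t) `^ a * s = t.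
  have := powR_pred a (_ : 0 < (K * t)^-1); rewrite invr_gt0 => /(_ Kt0).
  rewrite -/s pV => /(congr1 (fun z => z * (K * t))) ; rewrite mulrAC mulVf ?gt_eqF// mul1r => ->.
  by field; rewrite gt_eqF ?powR_gt0//= gt_eqF.
have -> : t * x * y = K^-1 * (K * t) `^ a * (s * x * y).
  by rewrite -{1}e; ring.
rewrite mulrBr lerD2l lerN2.
have p0 : 0 < K^-1 * (K * t) `^ a by rewrite mulr_gt0 ?powR_gt0 ?invr_gt0.
have := ler_wpM2l (ltW p0) h; rewrite mulrA; congr (_ <= _).
by field; rewrite gt_eqF ?powR_gt0//= gt_eqF.
Qed.

Lemma legendre_scale (t t0 y : R) : `|t| <= t0 ->
  (L (t * y) <= ((K * t0) `^ a + (K * t0) `^ b)%:E * L y)%E.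
Proof.
move=> tt0; have tn : L (t * y) = L (`|t| * y).
  by have [|] := ger0P t => // _; rewrite mulNr legendreN.
rewrite tn; have [t00|] := eqVneq `|t| 0.
  rewrite t00 mul0r; apply: (@le_trans _ _ 0%E).
    by apply: le_trans (legendre_small _) _; rewrite ?normr0// expr0n/= mul0r.
  by rewrite mule_ge0 ?legendre_ge0// lee_fin addr_ge0 ?powR_ge0.
move=> tn0; have t'0 : 0 < `|t| by rewrite lt_neqAle eq_sym tn0 normr_ge0.
apply: le_trans (legendre_dilate_pos y t'0) _.
have mono c : 1 < c -> (K * `|t|) `^ c <= (K * t0) `^ c.
  move=> c1; apply: ge0_ler_powR; rewrite ?nnegrE ?mulr_ge0 ?ler_pM2l ?(ltW K0)//.
  - by apply: le_trans (ltW c1).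
  - exact: le_trans tt0.
by rewrite lee_wpmul2r ?legendre_ge0// lee_fin lerD ?mono.
Qed.

Let F_ge0 (x : R) : 0 <= F x.
Proof.
have [x1|/ltW x1] := lerP `|x| 1; first by rewrite smallF// sqr_ge0.
exact: le_trans (largeF x1).
Qed.

(** A substitute for convexity, which F may lack at 1, where its slope can drop. The conjugate
    exponent of b is at least 1, so the lower growth bound gives linear shrinking up to K. *)
Lemma shrink_le (l u : R) : 0 < l <= 1 -> F (l * u) <= K * l * F u.
Proof.
move=> /andP[l0 l1]; have li : 1 <= l^-1 by rewrite invf_ge1.
have /andP[h _] := growF (l * u) li.
rewrite mulrA mulVf ?gt_eqF// mul1r in h.
have : l^-1 <= l^-1 `^ conj_exponent b.
  by apply: le1r_powR => //; rewrite ler_pdivlMr ?subr_gt0// mul1r gerBl.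
move=> /(ler_wpM2r (F_ge0 (l * u))) => h2.
have h3 : K^-1 * (l^-1 * F (l * u)) <= F u.
  by apply: le_trans h; rewrite -mulrA ler_wpM2l// invr_ge0 ltW.
rewrite -ler_pdivrMl; last by rewrite mulr_gt0.
by rewrite invfM -mulrA.
Qed.

(** By [sum_ereal_sup_le] it suffices to bound the sum at each point u. If sum F(u_i) <= p the dual
    bound applies directly; otherwise u is shrunk first, and the K in p / (C K) pays for the loss in
    [shrink_le]. *)
Lemma sum_legendre_le (n : nat) (y : 'rV[R]_n) (p C : R) : 0 < p -> 0 < C ->
  (forall t : 'I_n -> R, (forall i, 0 <= t i) -> \sum_i F (t i) <= p ->
    \sum_i `|y 0 i| * t i <= C) ->
  (\sum_i L (p / (C * K) * y 0 i)%R <= p%:E)%E.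
Proof.
move=> p0 C0 dual; set c := p / (C * K); have c0 : 0 < c by rewrite divr_gt0// mulr_gt0.
apply: (sum_ereal_sup_le 0) => u.
apply: (@le_trans _ _ (c * (\sum_i `|y 0 i| * `|u i|) - \sum_i F `|u i|)).
  rewrite mulr_sumr -sumrB; apply: ler_sum => i _; rewrite evenF lerD2r.
  apply: le_trans (ler_norm _) _.
  by rewrite normrM normrM (gtr0_norm c0) [leLHS]mulrC -mulrA.
set T := \sum_i F `|u i|.
have [Tp|pT] := lerP T p.
  have h := dual _ (fun i => normr_ge0 (u i)) Tp.
  have := ler_wpM2l (ltW c0) h.
  have -> : c * C = p / K by rewrite /c; field; rewrite !gt_eqF.
  have : p / K <= p by rewrite ler_pdivrMr// ler_peMr// ltW.
  have : 0 <= T by apply: sumr_ge0.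
  lra.
have T0 : 0 < T by exact: lt_trans pT.
(* Chosen so that sum F(l |u_i|) <= K l T = p. The dual bound for l |u| then gives c sum |y_i| |u_i|
   <= c C / l = T, and the value at u is nonpositive. *)
pose l := p / (K * T).
have l0 : 0 < l by rewrite divr_gt0// mulr_gt0.
have l1 : l <= 1.
  by rewrite ler_pdivrMr ?mulr_gt0// mul1r (le_trans (ltW pT))// ler_peMl// ltW.
have := dual (fun i => l * `|u i|) (fun i => mulr_ge0 (ltW l0) (normr_ge0 _)).
have -> : \sum_i `|y 0 i| * (l * `|u i|) = l * \sum_i `|y 0 i| * `|u i|.
  by rewrite mulr_sumr; apply: eq_bigr => i _; ring.
move=> h; apply: (@le_trans _ _ 0); last exact: ltW.
rewrite subr_le0; rewrite mulrC -ler_pdivlMr//.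
have -> : T / c = C / l by rewrite /c /l; field; rewrite !gt_eqF.
rewrite ler_pdivlMr// mulrC; apply: h.
apply: (@le_trans _ _ (K * l * T)).
  rewrite mulr_sumr; apply: ler_sum => i _; apply: shrink_le; exact/andP.
by rewrite /l le_eqVlt; apply/orP; left; apply/eqP; field; rewrite !gt_eqF.
Qed.

End young_function.

(** * Directional derivatives of locally Lipschitz functions *)

(** [lim] is 0 on a divergent family, which makes the bound trivial when u diverges; if u converges
    and c is nonzero, then w converges too. So it can be applied to difference quotients of unknown
    behaviour. *)
Lemma cvg_subM_norm_lim {T : Type} {R : realType} (F : set_system T)
    {FF : ProperFilter F} (u w : T -> R) (c b : R) :
  u t - c * w t @[t --> F] --> b ->
  `|lim (u @ F) : R| <= `|c| * `|lim (w @ F) : R| + `|b|.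
Proof.
move=> h; have [cu|du] := pselect (cvg (u @ F)); last first.
  by rewrite (dvgP du) normr0 addr_ge0 ?mulr_ge0.
have [c0|c0] := eqVneq c 0.
  rewrite c0 in h *; rewrite normr0 mul0r add0r.
  suff -> : lim (u @ F) = b by [].
  have e : (fun t => u t - 0 * w t) = u.
    by apply/funext => t; rewrite mul0r subr0.
  by apply: cvg_lim => //; rewrite e in h.
have ew : w = (fun t => c^-1 * (u t - (u t - c * w t))).
  by apply/funext => t; field.
have lw : w @ F --> c^-1 * (lim (u @ F) - b).
  by rewrite [X in X @ _]ew; apply: cvgMr; apply: cvgB.
have := cvg_lim (@norm_hausdorff _ _) lw => ->.
rewrite -normrM mulVKf//; apply: le_trans (ler_normD _ _).
by rewrite subrK.
Qed.

(** If w converges, so does u. If w diverges, its [lim] is 0 and the previous bound forces that of u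
    to be 0 as well. *)
Lemma cvg_subM_lim {T : Type} {R : realType} (F : set_system T)
    {FF : ProperFilter F} (u w : T -> R) (c : R) :
  u t - c * w t @[t --> F] --> (0 : R) -> (lim (u @ F) : R) = c * (lim (w @ F) : R).
Proof.
move=> h; have [cw|dw] := pselect (cvg (w @ F)).
  apply: cvg_lim => //.
  have -> : u = (fun t => (u t - c * w t) + c * w t) by apply/funext => t; ring.
  by rewrite -[X in _ --> X]add0r; apply: cvgD => //; apply: cvgMr.
have := @cvg_subM_norm_lim _ _ _ FF _ _ _ _ h.
have w0 : lim (w @ F) = 0 :> R by exact: (dvgP dw).
rewrite w0 mulr0 => hh.
have : `|lim (u @ F) : R| <= `|c| * `|0 : R| + `|0 : R| := hh.
by rewrite normr0 mulr0 addr0 normr_le0 => /eqP.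
Qed.

Lemma near_dist_lt (R : realType) (V : normedModType R) (a : V) (d : R) :
  0 < d -> \forall y \near a, `|a - y| < d.
Proof.
move=> d0; have := nbhsx_ballx a d d0.
by apply: filterS => y; rewrite -ball_normE.
Qed.

Lemma nbhs_dist (R : realType) (V : normedModType R) (a : V) (P : set V) :
  nbhs a P -> exists2 e : R, 0 < e & forall x, `|a - x| < e -> P x.
Proof.
by move=> /nbhs_ballP[e/= e0 eP]; exists e => // x ax; apply: eP; rewrite -ball_normE.
Qed.

Lemma cvg_dist_lt (R : realType) (V : normedModType R) (T : Type)
    (F : set_system T) (f : T -> V) (l : V) (e : R) :
  f @ F --> l -> 0 < e -> F [set t | `|l - f t| < e].
Proof. by move=> h e0; exact: h (near_dist_lt l e0). Qed.

(** Lets derivatives of quadratic polynomials and of the squared positive part in the cutoff be read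
    off from an algebraic estimate of the remainder. *)
Lemma is_derive_quadratic {R : realType} {V : normedModType R} (f : V -> R)
    (x v : V) (d C : R) :
  (forall h : R, `|h| <= 1 -> `|f (h *: v + x) - f x - h * d| <= C * h ^+ 2) ->
  is_derive x v f d.
Proof.
move=> H.
have C0 : 0 <= C.
  by apply: le_trans (_ : C * 1 ^+ 2 <= C); [apply: le_trans (H 1 _)|]; rewrite ?normr1// expr1n mulr1.
suff l : h^-1 *: ((f \o shift x) (h *: v) - f x) @[h --> (0 : R)^'] --> d.
  split; first by apply/cvg_ex; exists d.
  exact: cvg_lim.
apply/cvgrPdist_lt => e e0.
have d0 : 0 < Num.min 1 (e / (C + 1)).
  by rewrite lt_min ltr01/= divr_gt0// ltr_wpDl.
near=> h; have h0 : h != 0 by near: h; exact: nbhs_dnbhs_neq.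
have : `|h| < Num.min 1 (e / (C + 1)) by near: h; exact: dnbhs0_lt.
rewrite lt_min => /andP[/ltW h1 he].
rewrite /GRing.scale/= distrC.
have -> : h^-1 * (f (h *: v + x) - f x) - d = h^-1 * (f (h *: v + x) - f x - h * d).
  by field.
rewrite normrM normfV ltr_pdivrMl ?normr_gt0//.
apply: (le_lt_trans (H _ h1)).
rewrite -[h ^+ 2]real_normK ?num_real// expr2 mulrCA ltr_pM2l ?normr_gt0//.
apply: (@le_lt_trans _ _ ((C + 1) * `|h|)).
  by rewrite ler_wpM2r// lerDl.
by rewrite mulrC -ltr_pdivlMr// ltr_wpDl.
Unshelve. all: by end_near. Qed.

Section locally_lipschitz.
Context {R : realType} {n : nat}.
Implicit Types (f g : 'rV[R]_n -> R) (x v : 'rV[R]_n).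


Lemma locally_lipschitzP f : locally_lipschitz f <->
  forall a : 'rV[R]_n, exists2 d : R, 0 < d & exists2 k : R, 0 <= k &
    forall x y : 'rV[R]_n, `|a - x| < d -> `|a - y| < d -> `|f x - f y| <= k * `|x - y|.
Proof.
split => h a; have := h a.
  move=> [U /nbhs_ballP[d/= d0 dU] [M [Mr hM]]]; exists d => //.
  exists (`|M| + 1); first by rewrite addr_ge0.
  move=> x y ax ay; apply: (hM _ _ (x, y)) => //=.
    by rewrite (le_lt_trans (ler_norm _))// ltrDl.
  by split; apply: dU; rewrite -ball_normE.
move=> [d d0 [k k0 hk]]; exists [set x | `|a - x| < d].
  by apply/nbhs_ballP; exists d => // x; rewrite -ball_normE.
exists k; split; first exact: num_real.
move=> M kM [x y] [/= Ux Uy].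
apply: le_trans (hk _ _ Ux Uy) _.
by rewrite ler_wpM2r// ltW.
Qed.

Lemma locally_lipschitz_continuous f : locally_lipschitz f -> continuous f.
Proof.
move=> /locally_lipschitzP lf a; have [d d0 [k k0 hk]] := lf a.
apply/(@cvgrPdist_lt _ _ _ (nbhs (a : 'rV[R]_n))) => e e0.
have d'0 : 0 < e / (k + 1) by rewrite divr_gt0// ltr_wpDl.
apply: filterS2 (near_dist_lt a d0) (near_dist_lt a d'0) => y ay ay'.
apply: (le_lt_trans (hk _ _ _ ay)); first by rewrite subrr normr0.
apply: (@le_lt_trans _ _ ((k + 1) * `|a - y|)).
  by rewrite ler_wpM2r// lerDl.
by rewrite mulrC -ltr_pdivlMr ?ltr_wpDl.
Qed.

Lemma cvg_line x v : h *: v + x @[h --> (0 : R)^'] --> x.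
Proof.
rewrite -[X in _ --> X]add0r; apply: cvgD; last exact: cvg_cst.
rewrite -(scale0r v); apply: cvgZ; last exact: cvg_cst.
exact: nbhs_dnbhs.
Qed.

Lemma locally_lipschitz_quotient f x v : locally_lipschitz f ->
  exists2 k : R, 0 <= k & \forall h \near (0 : R)^', `|f (h *: v + x) - f x| <= k * `|h|.
Proof.
move=> /locally_lipschitzP lf; have [d d0 [k k0 hk]] := lf x.
exists (k * `|v|); first by rewrite mulr_ge0.
have hd : \forall h \near (0 : R)^', `|x - (h *: v + x)| < d.
  exact: (@cvg_line x v _ (near_dist_lt x d0)).
near=> h; have hx : `|x - (h *: v + x)| < d by near: h.
apply: le_trans (hk _ _ hx _) _; first by rewrite subrr normr0.
by rewrite addrK normrZ mulrAC mulrA.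
Unshelve. all: by end_near. Qed.

Lemma locally_lipschitz_comp (phi dphi : R -> R) f :
  (forall y : R, is_derive y 1 phi (dphi y)) -> continuous dphi ->
  locally_lipschitz f -> locally_lipschitz (phi \o f).
Proof.
move=> hphi cphi lf; have cf := locally_lipschitz_continuous lf.
move/locally_lipschitzP : lf => lf; apply/locally_lipschitzP => a.
have [d d0 [k k0 hk]] := lf a.
have : \forall y \near f a, `|dphi (f a) - dphi y| < 1.
  exact: (cvg_dist_lt (cphi (f a)) ltr01).
move=> /nbhs_dist[e e0 he].
have : \forall x \near a, `|f a - f x| < e by exact: (cvg_dist_lt (cf a) e0).
move=> /nbhs_dist[d' d'0 hd'].
exists (Num.min d d'); first by rewrite lt_min d0.
exists ((`|dphi (f a)| + 1) * k); first by rewrite mulr_ge0// addr_ge0.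
move=> x y; rewrite !lt_min => /andP[xd /hd' xd'] /andP[yd /hd' yd'] /=.
rewrite -mulrA; apply: (@le_trans _ _ ((`|dphi (f a)| + 1) * `|f x - f y|)); last first.
  by apply: ler_wpM2l; [rewrite addr_ge0|exact: hk].
wlog : x y xd xd' yd yd' / f x <= f y.
  move=> H; have [h|/ltW h] := leP (f x) (f y); first exact: H.
  by rewrite distrC [X in _ <= _ * X]distrC; exact: H.
move=> fxy; rewrite (distrC (phi (f x))) (distrC (f x)).
have cp : continuous phi.
  by move=> z; apply/differentiable_continuous/derivable1_diffP; exact: ex_derive.
have [c] := MVT_segment fxy (fun z _ => hphi z) (continuous_subspaceT cp).
rewrite in_itv/= => /andP[c1 c2] ->.
rewrite normrM ler_wpM2r//.
have : `|f a - c| < e.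
  rewrite ltr_distlC; move: xd' yd'; rewrite /= !ltr_distlC => /andP[? ?] /andP[? ?].
  by apply/andP; split; lra.
move=> /he /=; rewrite distrC => h.
rewrite -[X in `|X| <= _](subrK (dphi (f a))) addrC.
by rewrite (le_trans (ler_normD _ _))// lerD2l ltW.
Qed.

Lemma locally_lipschitzM f g : locally_lipschitz f -> locally_lipschitz g ->
  locally_lipschitz (fun x : 'rV[R]_n => f x * g x).
Proof.
move=> lf lg; have cf := locally_lipschitz_continuous lf.
have cg := locally_lipschitz_continuous lg.
move/locally_lipschitzP : lf => lf; move/locally_lipschitzP : lg => lg.
apply/locally_lipschitzP => a.
have [d d0 [k k0 hk]] := lf a; have [d' d'0 [k' k'0 hk']] := lg a.
have : \forall x \near a, `|f a - f x| < 1 by exact: (cvg_dist_lt (cf a) ltr01).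
move=> /nbhs_dist[e e0 he].
have : \forall x \near a, `|g a - g x| < 1 by exact: (cvg_dist_lt (cg a) ltr01).
move=> /nbhs_dist[e' e'0 he'].
exists (Num.min (Num.min d d') (Num.min e e')); first by rewrite !lt_min d0 d'0 e0.
exists ((`|f a| + 1) * k' + (`|g a| + 1) * k).
  by rewrite addr_ge0// mulr_ge0// addr_ge0.
move=> x y; rewrite !lt_min => /andP[/andP[x1 x2] /andP[x3 x4]] /andP[/andP[y1 y2] /andP[y3 y4]].
have bnd (u v : R) : `|u - v| < 1 -> `|v| <= `|u| + 1.
  rewrite distrC => /ltW h; rewrite -[X in `|X| <= _](subrK u) addrC.
  by rewrite (le_trans (ler_normD _ _))// lerD2l.
have -> : f x * g x - f y * g y = f x * (g x - g y) + (f x - f y) * g y by ring.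
rewrite (le_trans (ler_normD _ _))// !normrM mulrDl lerD//.
  by rewrite -mulrA ler_pM// ?hk'// bnd//; exact: he.
by rewrite mulrC -mulrA ler_pM// ?hk// bnd//; exact: he'.
Qed.

Lemma locally_lipschitzD f g : locally_lipschitz f -> locally_lipschitz g ->
  locally_lipschitz (fun x : 'rV[R]_n => f x + g x).
Proof.
move=> /locally_lipschitzP lf /locally_lipschitzP lg.
apply/locally_lipschitzP => a.
have [d d0 [k k0 hk]] := lf a; have [d' d'0 [k' k'0 hk']] := lg a.
exists (Num.min d d'); first by rewrite lt_min d0 d'0.
exists (k + k'); first by rewrite addr_ge0.
move=> x y; rewrite !lt_min => /andP[x1 x2] /andP[y1 y2].
have -> : f x + g x - (f y + g y) = (f x - f y) + (g x - g y) by ring.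
by rewrite (le_trans (ler_normD _ _))// mulrDl lerD ?hk ?hk'.
Qed.

Lemma locally_lipschitz_cst (c : R) : locally_lipschitz (fun _ : 'rV[R]_n => c).
Proof.
apply/locally_lipschitzP => a; exists 1 => //; exists 0 => // x y _ _.
by rewrite subrr normr0 mul0r.
Qed.

Lemma locally_lipschitz_coord i : locally_lipschitz (fun x : 'rV[R]_n => x 0 i).
Proof.
apply/locally_lipschitzP => a; exists 1 => //; exists 1 => // x y _ _.
rewrite mul1r; have -> : x 0 i - y 0 i = (x - y) 0 i by rewrite !mxE.
rewrite [leRHS]/Num.norm/= mx_normrE.
exact: (le_bigmax _ (fun ij : 'I_1 * 'I_n => `|(x - y) ij.1 ij.2|) (0, i)).
Qed.

Lemma locally_lipschitz_sum (I : Type) (s : seq I) (F : I -> 'rV[R]_n -> R) :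
  (forall i, locally_lipschitz (F i)) ->
  locally_lipschitz (fun x : 'rV[R]_n => \sum_(i <- s) F i x).
Proof.
move=> lF; elim: s => [|i s IH].
  by under [X in locally_lipschitz X]funext do rewrite big_nil; exact: locally_lipschitz_cst.
under [X in locally_lipschitz X]funext do rewrite big_cons.
exact: locally_lipschitzD.
Qed.

(* No differentiability of f is assumed: 'D_v f x is the limit of the
   difference quotients, 0 when they diverge, and the quotients of phi \o f
   minus d times those of f tend to 0. So gradients of truncations of f are
   exact everywhere, and Rademacher's theorem is not needed. *)
Lemma derive_comp_locally_lipschitz (phi : R -> R) (d : R) f x v :
  is_derive (f x) 1 phi d -> locally_lipschitz f ->
  'D_v (phi \o f) x = d * 'D_v f x.
Proof.
move=> [dphi vphi] lf; apply: cvg_subM_lim.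
have [k k0 hk] := locally_lipschitz_quotient x v lf.
have cf : f (h *: v + x) @[h --> (0 : R)^'] --> f x.
  apply: continuous_cvg; last exact: cvg_line.
  exact: locally_lipschitz_continuous.
apply/cvgr0Pnorm_le => e e0.
have e'0 : 0 < e / (k + 1) by rewrite divr_gt0// ltr_wpDl.
have : \forall h \near (0 : R)^', `|d - h^-1 *: (phi (h *: 1 + f x) - phi (f x))| < e / (k + 1).
  by move: dphi; rewrite /derivable => /cvgr_dist_lt; rewrite -/(derive _ _ _) vphi; exact.
rewrite near_withinE => /nbhs_dist[r r0 hr].
near=> h; have h0 : h != 0 by near: h; exact: nbhs_dnbhs_neq.
have uk : `|f (h *: v + x) - f x| <= k * `|h| by near: h; exact: hk.
have ur : `|f (h *: v + x) - f x| < r.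
  by rewrite distrC; near: h; exact: (cvg_dist_lt cf r0).
rewrite /GRing.scale/=; set u := f (h *: v + x) - f x in uk ur *.
(* A zero increment of f contributes nothing. Otherwise differentiability of phi is applied with
   increment u, and |u| <= k |h| compensates the division by h. *)
have [u0|u0] := eqVneq u 0.
  by move: (u0) => /subr0_eq ->; rewrite u0 subrr !mulr0 subrr normr0 ltW.
have /= := hr u; rewrite sub0r normrN => /(_ ur u0).
rewrite /GRing.scale/= mulr1 subrK => /ltW hu.
rewrite mulrCA -mulrBr normrM normfV ler_pdivrMl ?normr_gt0//.
have -> : phi (f (h *: v + x)) - phi (f x) - d * u =
   - (u * (d - u^-1 * (phi (f (h *: v + x)) - phi (f x)))) by field.
rewrite normrN normrM; apply: (le_trans (ler_pM _ _ uk hu)) => //.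
rewrite mulrAC [leLHS]mulrC ler_wpM2l// mulrA ler_pdivrMr ?ltr_wpDl//.
by rewrite mulrC ler_wpM2l ?lerDl// ltW.
Unshelve. all: by end_near. Qed.

(** Only an inequality: where the quotients of f diverge, both derivatives may take the default
    value 0 although f x * d does not vanish. *)
Lemma derive_mul_le (d : R) f g x v :
  is_derive x v g d -> continuous f ->
  `|'D_v (fun y => f y * g y) x : R| <= `|g x| * `|'D_v f x : R| + `|f x * d|.
Proof.
move=> [dg vg] cf; apply: cvg_subM_norm_lim.
have cfx : f (h *: v + x) @[h --> (0 : R)^'] --> f x.
  by apply: continuous_cvg; [exact: cf|exact: cvg_line].
have dgl : h^-1 *: (g (h *: v + x) - g x) @[h --> (0 : R)^'] --> d.
  by move: dg; rewrite /derivable -/(derive _ _ _) -vg.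
have -> : (fun h : R => h^-1 *: (((fun y => f y * g y) \o shift x) (h *: v) - f x * g x) -
    g x * (h^-1 *: ((f \o shift x) (h *: v) - f x))) =
  (fun h : R => f (h *: v + x) * (h^-1 *: (g (h *: v + x) - g x))).
  by apply/funext => h /=; rewrite /GRing.scale/=; ring.
exact: cvgM.
Qed.


Lemma derive_lipschitz_le f x v (d k : R) : 0 < d -> 0 <= k ->
  (forall y : 'rV[R]_n, `|x - y| < d -> `|f y - f x| <= k * `|y - x|) ->
  `|'D_v f x : R| <= k * `|v|.
Proof.
move=> d0 k0 H; have [df|ndf] := pselect (derivable f x v); last first.
  by rewrite /derive (dvgP ndf) normr0 mulr_ge0.
have hd : \forall h \near (0 : R)^', `|x - (h *: v + x)| < d.
  exact: (@cvg_line x v _ (near_dist_lt x d0)).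
have nd : `|h^-1 *: ((f \o shift x) (h *: v) - f x)| @[h --> (0 : R)^'] -->
    `|'D_v f x : R|.
  exact: cvg_norm.
rewrite -(cvg_lim (@norm_hausdorff _ R^o) nd).
apply: limr_le; first by apply/cvg_ex; exists `|'D_v f x : R|.
near=> h.
have h0 : h != 0 by near: h; exact: nbhs_dnbhs_neq.
have hx : `|x - (h *: v + x)| < d by near: h.
rewrite /GRing.scale/= normrM normfV ler_pdivrMl ?normr_gt0//.
by apply: le_trans (H _ hx) _; rewrite addrK normrZ mulrCA.
Unshelve. all: by end_near. Qed.

Lemma derive_bounded_on_compact f v (A : set 'rV[R]_n) : locally_lipschitz f ->
  compact A -> exists k : R, forall x, A x -> `|'D_v f x : R| <= k.
Proof.
move=> /locally_lipschitzP lf /compact_near_coveringP cA.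
have := cA R (pinfty_nbhs R) (fun k x => `|'D_v f x : R| <= k) _.
have H : forall x, A x -> \forall x' \near x & k \near +oo, `|'D_v f x' : R| <= k.
  move=> x _; have [d d0 [k k0 hk]] := lf x.
  exists ([set y | `|x - y| < d], [set z | k * `|v| <= z]) => /=.
    by split; [exact: (near_dist_lt x d0)|apply: nbhs_pinfty_ge; exact: num_real].
  move=> [y z]/= [yd]; apply: le_trans.
  apply: (@derive_lipschitz_le f y v (d - `|x - y|)) => //; first by rewrite subr_gt0.
  move=> w hw; apply: hk => //.
  rewrite -(subrK y x) -addrA (le_lt_trans (ler_normD _ _))//.
  by rewrite -ltrBrDl.
move=> /(_ _ H)[k [kr hk]]; exists (k + 1).
by apply: hk; rewrite ltrDl.
Qed.

Lemma continuous_measurable f : continuous f -> measurable_fun setT f.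
Proof.
move=> cf; apply: (measurability _ (RGenOInfty.measurableE R)).
move=> _ [_ [a ->] <-]; rewrite setTI; apply: sub_sigma_algebra.
by move/continuousP : cf; apply; exact: interval_open.
Qed.

End locally_lipschitz.

Section derive_measurable.
Context {R : realType} {n : nat}.
Implicit Types (f g : 'rV[R]_n -> R) (x v : 'rV[R]_n).

(** The set D of points where the quotients converge is described by the Cauchy criterion. Each
    [E m k] is an uncountable intersection, but of sets closed by continuity of f, so D is a
    countable combination of closed sets. On D the derivative is the limit along the increments 1 /
    (m + 1); off D it is the default 0, which the indicator in [F] reproduces. *)
Lemma derive_measurable f v : continuous f -> measurable_fun setT (fun x => 'D_v f x : R).
Proof.
move=> cf; pose q (h : R) x : R := h^-1 * (f (h *: v + x) - f x).
have cq h : continuous (q h).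
  move=> x; apply: (@cvgM _ _ (nbhs (x : 'rV[R]_n)) _ (fun=> h^-1) (fun y => f (h *: v + y) - f y)).
    exact: cvg_cst.
  apply: (@cvgB _ R^o _ (nbhs (x : 'rV[R]_n)) _ (fun y => f (h *: v + y)) f); last exact: cf.
  apply: (@continuous_comp _ _ _ (fun y : 'rV[R]_n => h *: v + y) f); last exact: cf.
  by apply: (@cvgD _ _ _ (nbhs (x : 'rV[R]_n))); [exact: cvg_cst|exact: cvg_id].
pose S k := [set p : R * R | [/\ p.1 != 0, p.2 != 0, `|p.1| < k.+1%:R^-1 & `|p.2| < k.+1%:R^-1]].
pose E (m k : nat) := \bigcap_(p in S k) [set x | `|q p.1 x - q p.2 x| <= m.+1%:R^-1].
have mE m k : measurable (E m k).
  rewrite -(setCK (E m k)); apply: measurableC; apply: sub_sigma_algebra.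
  apply: closed_openC; apply: closed_bigI => p _.
  apply: (@closed_comp _ _ (fun x => `|q p.1 x - q p.2 x|) [set y | y <= _]) => [x _|].
    apply: (@cvg_norm _ R^o _ (nbhs (x : 'rV[R]_n))).
    by apply: (@cvgB _ R^o _ (nbhs (x : 'rV[R]_n))); exact: cq.
  exact: closed_le.
pose D := \bigcap_m \bigcup_k E m k.
have mD : measurable D.
  by apply: bigcapT_measurable => m; apply: bigcupT_measurable.
have DP x : D x <-> derivable f x v.
  split=> [Dx|/cvg_ex[/= l fl] m _].
    apply/cauchy_cvgP/cauchy_ballP => e e0.
    have [m _ me] := @near_infty_natSinv_lt R (PosNum e0).
    have [k _ Ek] := Dx m I.
    exists (q ^~ x @` [set h | h != 0 /\ `|h| < k.+1%:R^-1],
            q ^~ x @` [set h | h != 0 /\ `|h| < k.+1%:R^-1]).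
      have hk : \forall h \near (0 : R)^', h != 0 /\ `|h| < k.+1%:R^-1.
        near=> h; split; first by near: h; exact: nbhs_dnbhs_neq.
        by near: h; exact: dnbhs0_lt.
      by split; apply: filterS hk => h hk; exists h.
    move=> [_ _] /= [[h [h0 hk] <-] [h' [h'0 h'k] <-]].
    rewrite -ball_normE /ball_/=; apply: le_lt_trans (me m (leqnn _)).
    exact: (Ek (h, h')).
  have e0 : 0 < (m.+1%:R^-1 / 2 : R) by rewrite divr_gt0.
  have : \forall h \near (0 : R)^', `|l - q h x| < m.+1%:R^-1 / 2.
    exact: (cvg_dist_lt fl e0).
  rewrite near_withinE => /nbhs_dist[r r0 hr].
  have [k _ kr] := @near_infty_natSinv_lt R (PosNum r0).
  exists k => // -[h h'] [/= h0 h'0 hk h'k].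
  have H (z : R) : z != 0 -> `|z| < k.+1%:R^-1 -> `|l - q z x| < m.+1%:R^-1 / 2.
    move=> z0 zk; apply: hr => //.
    by rewrite sub0r normrN; apply: (lt_trans zk); exact: (kr k (leqnn k)).
  have := H _ h0 hk; have := H _ h'0 h'k.
  move: (m.+1%:R^-1 : R) (q h x) (q h' x) => c y y'.
  rewrite !ltr_distl ler_distl => /andP[? ?] /andP[? ?]; apply/andP; split; lra.
pose F m x : R := \1_D x * q m.+1%:R^-1 x.
apply: (@measurable_fun_cvg _ _ _ _ F).
  move=> m; apply: measurable_funM; first exact: measurable_indic.
  exact: continuous_measurable.
move=> x _; have [/DP dx|Dx] := pselect (D x).
  have /cvgr_dnbhsP/(_ (fun m => m.+1%:R^-1)) : q h x @[h --> (0 : R)^'] --> ('D_v f x : R).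
    exact: dx.
  have -> : (fun m => F m x) = (fun m => q m.+1%:R^-1 x).
    by apply/funext => m; rewrite /F indicE mem_set ?mul1r//; exact/DP.
  apply; split; last exact: cvg_harmonic.
  by move=> m; rewrite invr_neq0.
have -> : (fun m => F m x) = (fun=> 0).
  by apply/funext => m; rewrite /F indicE memNset// mul0r.
have -> : 'D_v f x = 0 :> R.
  by apply: (@dvgP R) => /DP.
exact: cvg_cst.
Unshelve. all: by end_near. Qed.

End derive_measurable.

(** * Lower bound for moments of linear forms *)

Section product_expectation.
Import HBNNSimple.
Context d {Omega : measurableType d} {R : realType} (P : probability Omega R).
Local Open Scope ereal_scope.

(** Extension from indicators by simple approximation and monotone convergence. V will be the
    product of the remaining factors, and c its mean. *)
Lemma ge0_integral_mul_indic (Y V : Omega -> R) (c : R) :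
  measurable_fun setT Y -> measurable_fun setT V -> (forall w, 0 <= V w)%R ->
  (forall B, measurable B ->
    \int[P]_w (\1_B (Y w) * V w)%:E = P (Y @^-1` B) * c%:E) ->
  forall G : R -> R, measurable_fun setT G -> (forall y, 0 <= G y)%R ->
    \int[P]_w (G (Y w) * V w)%:E = \int[P]_w (G (Y w))%:E * c%:E.
Proof.
move=> mY mV V0 hB G mG G0.
have mpre B : measurable B -> measurable (Y @^-1` B).
  by move=> mB; rewrite -[X in measurable X]setTI; exact: mY.
have mEG : measurable_fun setT (EFin \o G) by exact/measurable_EFinP.
pose g := nnsfun_approx measurableT mEG.
have simple m : \int[P]_w (g m (Y w) * V w)%:E = \int[P]_w (g m (Y w))%:E * c%:E.
  have y0 y : y \in finmap.enum_fset (fset_set (range (g m))) -> (0 <= y)%R.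
    by rewrite in_fset_set// inE => -[x _ <-].
  (* The values of [g m] are nonnegative, but the integral of a sum is split under nonnegativity for
     every index y; the maximum with 0 provides it and changes nothing on the range. *)
  pose pos (y : R) := Num.max y 0%R.
  have posE y : y \in finmap.enum_fset (fset_set (range (g m))) -> pos y = y.
    by move=> /y0 yy; rewrite /pos max_l.
  have pos0 y : (0 <= pos y)%R by rewrite /pos le_max lexx orbT.
  have gE w : g m (Y w) = (\sum_(y <- finmap.enum_fset (fset_set (range (g m))))
      pos y * \1_(Y @^-1` (g m @^-1` [set y])) w)%R.
    rewrite [LHS]fimfunE fsbig_finite//=.
    by apply: eq_big_seq => y yin; rewrite posE.
  have mA y : measurable (Y @^-1` (g m @^-1` [set y])) by exact/mpre.
  have -> : \int[P]_w (g m (Y w))%:E = \sum_(y <- finmap.enum_fset (fset_set (range (g m))))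
      (pos y)%:E * P (Y @^-1` (g m @^-1` [set y])).
    under eq_integral => w _.
      rewrite gE -sumEFin; over.
    rewrite ge0_integral_sum//; last 2 first.
    - by move=> y; apply/measurable_EFinP; exact: measurable_funM.
    - by move=> y w _; rewrite lee_fin mulr_ge0.
    apply: eq_bigr => y _; under eq_integral do rewrite EFinM.
    rewrite ge0_integralZl_EFin//; last exact/measurable_EFinP.
    by rewrite integral_indic// setIT.
  have -> : \int[P]_w (g m (Y w) * V w)%:E = \sum_(y <- finmap.enum_fset (fset_set (range (g m))))
      (pos y)%:E * (P (Y @^-1` (g m @^-1` [set y])) * c%:E).
    under eq_integral => w _.
      rewrite gE mulr_suml -sumEFin; over.
    rewrite ge0_integral_sum//; last 2 first.
    - move=> y; apply/measurable_EFinP; apply: measurable_funM => //.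
      exact: measurable_funM.
    - by move=> y w _; rewrite lee_fin !mulr_ge0.
    apply: eq_bigr => y _; under eq_integral do rewrite -mulrA EFinM.
    rewrite ge0_integralZl_EFin//.
    - by rewrite -hB//; congr (_ * _); apply: eq_integral => w _; rewrite !indicE.
    - by move=> w _; rewrite lee_fin mulr_ge0.
    - by apply/measurable_EFinP; exact: measurable_funM.
  rewrite ge0_sume_distrl; last by move=> y _; rewrite mule_ge0 ?lee_fin.
  by apply: eq_bigr => y _; rewrite muleA.
have ndg x : {homo (g ^~ x) : k l / (k <= l)%N >-> (k <= l)%R}.
  by move=> k l kl; have /lefP := nd_nnsfun_approx measurableT mEG kl; exact.
have cvgg x : (g m x)%:E @[m --> \oo] --> (G x)%:E.
  by apply: (cvg_nnsfun_approx measurableT mEG) => // y _; rewrite lee_fin.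
have c1 : \int[P]_w (g m (Y w))%:E @[m --> \oo] --> \int[P]_w (G (Y w))%:E.
  have -> : \int[P]_w (G (Y w))%:E = \int[P]_w (limn (fun m => (g m (Y w))%:E)).
    by apply: eq_integral => w _; apply/esym/cvg_lim => //; exact: cvgg.
  apply: cvg_monotone_convergence => //.
  - by move=> m; apply/measurable_EFinP; exact: measurableT_comp.
  - by move=> m w _; rewrite lee_fin.
  - by move=> w _ k l kl; rewrite lee_fin; exact: ndg.
have c2 : \int[P]_w (g m (Y w) * V w)%:E @[m --> \oo] --> \int[P]_w (G (Y w) * V w)%:E.
  have -> : \int[P]_w (G (Y w) * V w)%:E =
      \int[P]_w (limn (fun m => (g m (Y w) * V w)%:E)).
    apply: eq_integral => w _; apply/esym/cvg_lim => //.
    have Vfin : (V w)%:E \is a fin_num by [].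
    exact: (cvgeZr Vfin (cvgg (Y w))).
  apply: cvg_monotone_convergence => //.
  - move=> m; apply/measurable_EFinP; apply: measurable_funM => //.
    exact: measurableT_comp.
  - by move=> m w _; rewrite lee_fin mulr_ge0.
  - by move=> w _ k l kl; rewrite lee_fin ler_wpM2r//; exact: ndg.
have c3 : \int[P]_w (g m (Y w) * V w)%:E @[m --> \oo] --> \int[P]_w (G (Y w))%:E * c%:E.
  by rewrite (funext simple); apply: cvgeZr.
exact: (cvg_unique _ c2 c3).
Qed.

(** Induction on the number k of leading coordinates that carry general functions while the others
    carry indicators. For k = 0 this is independence itself; the step frees coordinate k through
    [ge0_integral_mul_indic], whose hypothesis is the induction hypothesis with an indicator at
    k. *)
Lemma independent_family_prod (n : nat) (Y : 'I_n -> Omega -> R) :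
  independent_family P Y -> (forall i, measurable_fun setT (Y i)) ->
  forall G : 'I_n -> R -> R, (forall i, measurable_fun setT (G i)) ->
    (forall i y, 0 <= G i y)%R -> (forall i, \int[P]_w (G i (Y i w))%:E < +oo) ->
    \int[P]_w (\prod_i G i (Y i w))%:E = \prod_i \int[P]_w (G i (Y i w))%:E.
Proof.
move=> indY mY; suff H (k : nat) : forall G : 'I_n -> R -> R,
    (forall i, measurable_fun setT (G i)) ->
    (forall i y, 0 <= G i y)%R -> (forall i, \int[P]_w (G i (Y i w))%:E < +oo) ->
    (forall i : 'I_n, (k <= i)%N -> exists2 B, measurable B & G i = \1_B) ->
    \int[P]_w (\prod_i G i (Y i w))%:E = \prod_i \int[P]_w (G i (Y i w))%:E.
  by move=> G mG G0 Gy; apply: (H n) => // i; rewrite leqNgt ltn_ord.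
elim: k => [|k IH] G mG G0 Gy hG.
  have /choice[B hB] i : exists B, measurable B /\ G i = \1_B.
    by have [B mB GB] := hG i (leq0n _); exists B.
  have mYB i : measurable (Y i @^-1` B i).
    by rewrite -[X in measurable X]setTI; apply: mY => //; exact: (hB i).1.
  have prodE w : (\prod_i G i (Y i w) = \1_(\bigcap_(i in [set` [set: 'I_n]%SET]) (Y i @^-1` B i)) w)%R.
    rewrite indicE; case: (boolP (w \in _)) => [|/negP wB].
      rewrite inE => wB; rewrite big1// => i _; rewrite (hB i).2 indicE mem_set//.
      by apply: wB; rewrite /= finset.in_setT.
    have [i wi] : exists i, ~ B i (Y i w).
      apply: contrapT => /forallNP h; apply: wB; rewrite inE => i _.
      by have := h i; rewrite notK.
    by rewrite (bigD1 i)//= (hB i).2 indicE memNset// mul0r.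
  under eq_integral do rewrite prodE.
  rewrite integral_indic ?setIT//; last first.
    by apply: fin_bigcap_measurable => // ; exact: finite_finset.
  apply: (eq_trans (indY [set: 'I_n]%SET B (fun i => (hB i).1))).
  rewrite (eq_bigl xpredT) => [|i]; last by rewrite finset.in_setT.
  apply: eq_bigr => i _; rewrite (hB i).2.
  by rewrite -[X in P X]setIT -integral_indic//; apply: eq_integral.
case: (ltnP k n) => kn; last first.
  by apply: IH => // i ki; have := ltn_ord i; rewrite ltnNge (leq_trans kn ki).
pose i0 := Ordinal kn.
pose V w := (\prod_(j | j != i0) G j (Y j w))%R.
have fin i : \int[P]_w (G i (Y i w))%:E \is a fin_num.
  by rewrite ge0_fin_numE// integral_ge0// => w _; rewrite lee_fin.
pose c := fine (\prod_(j | j != i0) \int[P]_w (G j (Y j w))%:E).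
have cE : c%:E = \prod_(j | j != i0) \int[P]_w (G j (Y j w))%:E.
  by rewrite fineK// prode_fin_num.
rewrite (bigD1 i0)//= -cE.
rewrite -(@ge0_integral_mul_indic (Y i0) V c) //.
- by apply: eq_integral => w _; rewrite (bigD1 i0).
- rewrite [V](_ : _ = fun w => \prod_j (if j != i0 then G j (Y j w) else 1))%R.
    by apply: measurable_prod => j _; case: (j != i0) => //; exact: measurableT_comp.
  by apply/funext => w; rewrite /V big_mkcond.
- by move=> w; rewrite prodr_ge0.
move=> B mB.
pose G' j := if j == i0 then \1_B else G j.
have G'i0 : G' i0 = \1_B by rewrite /G' eqxx.
have G'j j : j != i0 -> G' j = G j by rewrite /G' => /negPf ->.
have PB : \int[P]_w (\1_B (Y i0 w))%:E = P (Y i0 @^-1` B).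
  rewrite -[in RHS](setIT (_ @^-1` _)) -integral_indic//.
  by rewrite -[X in measurable X]setTI; exact: mY.
have : \int[P]_w (\prod_i G' i (Y i w))%:E = \prod_i \int[P]_w (G' i (Y i w))%:E.
  apply: IH.
  - by move=> i; rewrite /G'; case: ifPn => // _; exact: measurable_indic.
  - by move=> i y; rewrite /G'; case: ifPn => // _; rewrite indicE.
  - move=> i; have [->|/G'j ->//] := eqVneq i i0.
    rewrite G'i0 PB (le_lt_trans (probability_le1 _ _))// ?ltry//.
    by rewrite -[X in measurable X]setTI; exact: mY.
  - move=> i ki; have [->|ii0] := eqVneq i i0; first by exists B.
    rewrite G'j//; apply: hG; rewrite ltn_neqAle ki andbT.
    by apply: contra ii0 => /eqP e; exact/eqP/val_inj.
rewrite [RHS](bigD1 i0)//= G'i0 PB cE.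
under [X in _ * X]eq_bigr => j /G'j -> do [].
move=> <-; apply: eq_integral => w _; rewrite [in RHS](bigD1 i0)//= G'i0 /V.
by congr (_ * _)%:E; apply: eq_bigr => j /G'j ->.
Qed.

End product_expectation.

(* After division by W, AM-GM for x^p / W, W e^(-7p) and 1 with weights 1/p, 1/p
   and 1 - 2/p. *)
Lemma weighted_am_gm {R : realType} (x W p : R) : 0 <= x -> 0 <= W -> 2 <= p ->
  x * W <= expR 7 * (x `^ p / p + W ^+ 2 * expR (- (7 * p)) / p + (1 - 2 / p) * W).
Proof.
move=> x0 W0 p2; have p0 : 0 < p by lra.
have p2' : 0 <= 1 - 2 / p by rewrite subr_ge0 ler_pdivrMr// mul1r.
have rhs0 : 0 <= expR 7 * (x `^ p / p + W ^+ 2 * expR (- (7 * p)) / p + (1 - 2 / p) * W).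
  by rewrite mulr_ge0 ?expR_ge0// !addr_ge0 ?mulr_ge0 ?invr_ge0 ?powR_ge0 ?expR_ge0 ?sqr_ge0 ?(ltW p0).
have [x00|xn0] := eqVneq x 0; first by rewrite {1}x00 mul0r.
have [W00|Wn0] := eqVneq W 0; first by rewrite {1}W00 mulr0.
have xp : 0 < x by rewrite lt_neqAle eq_sym xn0.
have Wp : 0 < W by rewrite lt_neqAle eq_sym Wn0.
set a := p * ln x - ln W; set b := ln W - 7 * p; set c := ln x - 7.
have ea : x `^ p = W * expR a.
  rewrite /a expRD expRN lnK ?posrE// mulrC divfK// /powR (negPf xn0)//.
have eb : W ^+ 2 * expR (- (7 * p)) = W * expR b.
  by rewrite /b expRD lnK ?posrE// expr2 mulrA.
have ec : x * W = W * (expR 7 * expR c).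
  by rewrite -expRD /c addrC subrK lnK ?posrE// mulrC.
rewrite ea eb ec.
(* The tangent line of exp at c. With the weights 1/p, 1/p and 1 - 2/p the points a, b and 0 have
   mean c, because (a + b) / p = c, so the linear terms cancel. *)
have H z : expR c * (1 + (z - c)) <= expR z.
  have -> : expR z = expR c * expR (z - c) by rewrite -expRD addrC subrK.
  by rewrite ler_wpM2l ?expR_ge0// expR_ge1Dx.
have -> : expR 7 * (W * expR a / p + W * expR b / p + (1 - 2 / p) * W) =
   W * (expR 7 * (expR a / p + expR b / p + (1 - 2 / p))) by ring.
rewrite ler_wpM2l// ler_wpM2l ?expR_ge0//.
apply: (@le_trans _ _ (expR c * (1 + (a - c)) / p + expR c * (1 + (b - c)) / p
    + (1 - 2 / p) * (expR c * (1 + (0 - c))))).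
  have -> : expR c * (1 + (a - c)) / p + expR c * (1 + (b - c)) / p
    + (1 - 2 / p) * (expR c * (1 + (0 - c))) =
    expR c * (1 + ((a + b) / p - c)) by field; rewrite gt_eqF.
  have -> : (a + b) / p = c by rewrite /a /b /c; field; rewrite gt_eqF.
  by rewrite subrr addr0 mulr1.
have ip0 : 0 <= p^-1 by rewrite invr_ge0 ltW.
apply: lerD; first by rewrite lerD// ler_wpM2r.
by rewrite ler_piMr//; have := H 0; rewrite expR0.
Qed.

(** * Tilting one symmetric variable *)

Section symmetric.
Context d {Omega : measurableType d} {R : realType} (P : probability Omega R).
Context (Y : Omega -> R) (mY : measurable_fun setT Y) (symY : symmetric_rv P Y).
Local Open Scope ereal_scope.

Lemma measurable_preim (B : set R) : measurable B -> measurable (Y @^-1` B).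
Proof. by move=> mB; rewrite -[X in measurable X]setTI; exact: mY. Qed.

Lemma symmetric_rv_integral (g : R -> \bar R) : measurable_fun setT g ->
  (forall y, 0 <= g y) -> \int[P]_w g (Y w) = \int[P]_w g (- Y w)%R.
Proof.
move=> mg g0.
have mNY : measurable_fun setT (fun w => - Y w)%R by exact: measurableT_comp.
rewrite -(@ge0_integral_pushforward _ _ _ _ _ _ mY P setT g)//.
rewrite -(@ge0_integral_pushforward _ _ _ _ _ _ mNY P setT g)//.
apply: eq_measure_integral => A mA _; exact: symY.
Qed.

Lemma symmetric_rv_tail (t : R) : (0 < t)%R ->
  P [set w | t <= `|Y w|]%R = 2%:E * P [set w | t <= Y w]%R.
Proof.
move=> t0.
have -> : [set w | t <= `|Y w|]%R = Y @^-1` `[t, +oo[ `|` (fun w => - Y w)%R @^-1` `[t, +oo[.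
  by apply/seteqP; split => w/=; rewrite !in_itv/= !andbT ler_normr => /orP.
have -> : [set w | t <= Y w]%R = Y @^-1` `[t, +oo[.
  by apply/seteqP; split => w/=; rewrite in_itv/= andbT.
rewrite measureU; last 3 first.
- exact: measurable_preim.
- by rewrite -[X in measurable X]setTI; apply: measurableT_comp.
- by apply/seteqP; split => w//=; rewrite !in_itv/= !andbT => -[h1 h2]; lra.
rewrite -[X in _ + X](symY (measurable_itv `[t, +oo[)).
by rewrite mule_natl mule2n.
Qed.

(** From |Y| <= sum_k 1[k <= |Y|] and e^(-k) <= 2^(-k), a geometric series. *)
Lemma integral_norm_lty_of_tail :
  (forall k : nat, P [set w | k%:R <= `|Y w|]%R <= (expR (- k%:R))%:E) ->
  \int[P]_w (`|Y w|)%:E < +oo.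
Proof.
move=> tail.
have mA (k : nat) : measurable [set w | k%:R <= `|Y w|]%R.
  rewrite (_ : [set _ | _] = (fun w => `|Y w|)%R @^-1` `[k%:R, +oo[); last first.
    by apply/seteqP; split => w/=; rewrite in_itv/= andbT.
  rewrite -[X in measurable X]setTI.
  by apply: measurableT_comp => //; exact: normr_measurable.
apply: (@le_lt_trans _ _ (\int[P]_w \sum_(k <oo) (\1_[set w | k%:R <= `|Y w|]%R w)%:E)).
  apply: ge0_le_integral => //.
  - by apply/measurable_EFinP; exact: measurableT_comp.
  - apply: ge0_emeasurable_sum => // k _; apply/measurable_EFinP; exact: measurable_indic.
  move=> w _; set N := Num.truncn `|Y w|.
  have /andP[N1 N2] := truncn_itv (normr_ge0 (Y w)).
  apply: (@le_trans _ _ (\sum_(0 <= k < N.+1) (\1_[set w | k%:R <= `|Y w|]%R w)%:E)).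
    rewrite (eq_big_nat _ _ (F2 := fun=> 1)).
      by rewrite sumEFin big_const_nat iter_addr subn0 addr0 lee_fin ltW.
    move=> k /andP[_]; rewrite ltnS => kN; rewrite indicE mem_set//=.
    by apply: le_trans N1; rewrite ler_nat.
  exact: nneseries_lim_ge.
rewrite integral_nneseries//; last first.
  by move=> k; apply/measurable_EFinP; exact: measurable_indic.
apply: (@le_lt_trans _ _ (\sum_(k <oo) (2 / (2 ^ (k + 1))%:R)%:E)); last first.
  by have /cvg_lim -> // := @cvg_geometric_eseries_half R 2%R 0; exact: ltry.
apply: lee_nneseries => k _; first by rewrite integral_ge0.
rewrite integral_indic// setIT; apply: le_trans (tail k) _; rewrite lee_fin.
rewrite -[(- _)%R]mulrN1 expRM_natl addn1 expnS natrM invfM mulrA divff// mul1r.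
rewrite natrX -exprVn; apply: lerXn2r; rewrite ?nnegrE ?expR_ge0 ?invr_ge0//.
by rewrite expRN lef_pV2 ?posrE ?expR_gt0//; have := expR_ge1Dx (1 : R).
Qed.


Context (F : R -> R) (smallF : forall x, (`|x| <= 1)%R -> F x = (x ^+ 2)%R)
  (largeF : forall x, (1 <= x -> x <= F x)%R)
  (tailF : forall t, (1 <= t)%R -> P [set w | t <= `|Y w|]%R = (expR (- F t))%:E).

Lemma tail_mean_lty : \int[P]_w (`|Y w|)%:E < +oo.
Proof.
apply: integral_norm_lty_of_tail => -[|k].
  rewrite oppr0 expR0; apply: probability_le1.
  rewrite (_ : [set _ | _] = setT)//.
  by apply/seteqP; split => w //= _.
have k1 : (1 <= k.+1%:R :> R)%R by rewrite ler1n.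
by rewrite tailF// lee_fin ler_expR lerN2 largeF.
Qed.

(* Under the density G(Y) the mean of e Y is at least t; its positive and negative
   parts are kept apart so that only integrals of nonnegative functions occur. *)
Lemma tilt (e t : R) : (`|e| = 1)%R -> (0 <= t)%R -> exists G : R -> R, exists m : R,
  [/\ measurable_fun setT G, (forall y, 0 <= G y)%R,
    \int[P]_w (G (Y w))%:E = 1,
    \int[P]_w (G (Y w) ^+ 2)%:E <= (expR (7 * F t))%:E &
    [/\ (0 <= m)%R, \int[P]_w (G (Y w) * Num.max (- (e * Y w)) 0)%:E = m%:E,
     (m + t)%:E <= \int[P]_w (G (Y w) * Num.max (e * Y w) 0)%:E &
     \int[P]_w (G (Y w) * Num.max (e * Y w) 0)%:E < +oo]].
Proof.
move=> e1 t0.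
pose T := Num.max t 1%R; pose s := Num.min t 1%R.
have T1 : (1 <= T)%R by rewrite /T le_max lexx orbT.
have T0 : (0 < T)%R by rewrite (lt_le_trans _ T1).
have s0 : (0 <= s)%R by rewrite /s le_min t0 ler01.
have s1 : (s <= 1)%R by rewrite /s ge_min lexx orbT.
have sT : (s * T = t)%R.
  by rewrite /s /T; case: (leP t 1%R) => _; rewrite ?mulr1 ?mul1r.
(* By symmetry P(e Y >= T) = e^(-F T) / 2 = 1 / l, so l 1_B is a probability density; G mixes it,
   with weight s, with the constant density 1. *)
pose l := (2 * expR (F T))%R.
have l0 : (0 <= l)%R by rewrite mulr_ge0 ?expR_ge0.
pose B := [set y : R | T <= e * y]%R.
have mB : measurable B.
  rewrite (_ : B = (fun y => e * y)%R @^-1` `[T, +oo[); last first.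
    by apply/seteqP; split => w/=; rewrite /B/= in_itv/= andbT.
  by rewrite -[X in measurable X]setTI; apply: mulrl_measurable.
pose G y := (1 - s + s * l * \1_B y)%R.
have G0 y : (0 <= G y)%R.
  by rewrite addr_ge0 ?subr_ge0// mulr_ge0// ?mulr_ge0// indicE.
have mG : measurable_fun setT G.
  apply: measurable_funD => //; apply: measurable_funM => //.
have mYB : measurable (Y @^-1` B) by exact: measurable_preim.
have PB : P (Y @^-1` B) = (l^-1)%:E.
  have := symmetric_rv_tail T0; rewrite tailF// => h.
  have -> : P (Y @^-1` B) = P (Y @^-1` `[T, +oo[).
    have [e0|e0] := ger0P e; rewrite ?(ger0_norm e0) ?(ltr0_norm e0) in e1.
      by congr (P _); apply/seteqP; split => w; rewrite /B/= in_itv/= andbT e1 mul1r.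
    rewrite [RHS]symY//; congr (P _); apply/seteqP; split => w; rewrite /B/= in_itv/= andbT;
      by rewrite -[e]opprK e1 mulN1r.
  have mT : measurable (Y @^-1` `[T, +oo[) by exact: measurable_preim.
  have hT : [set w | T <= Y w]%R = Y @^-1` `[T, +oo[.
    by apply/seteqP; split => w/=; rewrite in_itv/= andbT.
  move: h; rewrite hT -(fineK (fin_num_measure P _ mT)) -EFinM => -[hh].
  congr EFin; rewrite /l -[LHS](mulKf (_ : 2 != 0 :> R)%R)// -hh expRN invfM; ring.
have ln0 : (l != 0)%R by rewrite mulf_neq0// gt_eqF ?expR_gt0.
have intB (c : R) : (0 <= c)%R -> \int[P]_w (c * \1_B (Y w))%:E = (c / l)%:E.
  move=> c0.
  under eq_integral do rewrite EFinM.
  rewrite ge0_integralZl_EFin//.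
  - rewrite EFinM -PB; congr (_ * _).
    by rewrite -[in RHS](setIT (_ @^-1` _)) -integral_indic.
  - by apply/measurable_EFinP; apply: measurableT_comp.
have mY1 : measurable_fun setT (fun w => \1_B (Y w) : R) by exact: measurableT_comp.
have affine (a b : R) : (0 <= a)%R -> (0 <= b)%R ->
    \int[P]_w (a + b * \1_B (Y w))%:E = (a + b / l)%:E.
  move=> a0 b0; under eq_integral do rewrite EFinD.
  rewrite ge0_integralD//; last 2 first.
  - by move=> w _; rewrite lee_fin mulr_ge0// indicE.
  - by apply/measurable_EFinP; apply: measurable_funM.
  rewrite integral_cst// intB// EFinD; congr (_ + _).
  by rewrite -[RHS]mule1; congr (_ * _); exact: probability_setT.
have meY : measurable_fun setT (fun w => e * Y w)%R by exact: measurable_funM.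
have mpos : measurable_fun setT (fun w => Num.max (e * Y w)%R 0%R).
  exact: measurable_maxr.
have mneg : measurable_fun setT (fun w => Num.max (- (e * Y w))%R 0%R).
  by apply: measurable_maxr => //; apply: measurableT_comp.
have poslty : \int[P]_w (Num.max (e * Y w) 0)%:E < +oo.
  apply: le_lt_trans tail_mean_lty; apply: ge0_le_integral => //.
  - by move=> w _; rewrite lee_fin le_max lexx orbT.
  - exact/measurable_EFinP.
  - by apply/measurable_EFinP; apply: measurableT_comp.
  - move=> w _; rewrite lee_fin ge_max normr_ge0 andbT.
    by rewrite (le_trans (ler_norm _))// normrM e1 mul1r.
have symm : \int[P]_w (Num.max (- (e * Y w)) 0)%:E = \int[P]_w (Num.max (e * Y w) 0)%:E.
  rewrite [RHS](symmetric_rv_integral (g := fun y => (Num.max (e * y) 0)%:E)).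
  - by apply: eq_integral => w _; rewrite mulrN.
  - apply/measurable_EFinP; apply: measurable_maxr => //; exact: mulrl_measurable.
  - by move=> y; rewrite lee_fin le_max lexx orbT.
pose m0 := fine (\int[P]_w (Num.max (e * Y w) 0)%:E).
have m0E : m0%:E = \int[P]_w (Num.max (e * Y w) 0)%:E.
  rewrite fineK// ge0_fin_numE// integral_ge0// => w _.
  by rewrite lee_fin le_max lexx orbT.
have m00 : (0 <= m0)%R.
  rewrite fine_ge0// integral_ge0// => w _.
  by rewrite lee_fin le_max lexx orbT.
(* The negative part of e Y vanishes on B, so only the untilted share 1 - s contributes to m. *)
exists G, ((1 - s) * m0)%R; split => //.
- by rewrite affine ?subr_ge0 ?mulr_ge0// mulfK// subrK.
- have -> : \int[P]_w (G (Y w) ^+ 2)%:E =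
      \int[P]_w ((1 - s) ^+ 2 + (2 * (1 - s) * s * l + s ^+ 2 * l ^+ 2) * \1_B (Y w))%:E.
    apply: eq_integral => w _; congr EFin; rewrite /G indicE.
    by case: (_ \in _); rewrite /=; ring.
  have s1' : (0 <= 1 - s)%R by rewrite subr_ge0.
  rewrite affine ?sqr_ge0 ?addr_ge0 ?mulr_ge0 ?sqr_ge0//.
  have -> : ((1 - s) ^+ 2 + (2 * (1 - s) * s * l + s ^+ 2 * l ^+ 2) / l =
      1 + s ^+ 2 * (l - 1))%R by field.
  rewrite lee_fin; have e2 : (2 <= expR 1 :> R)%R by have := expR_ge1Dx (1 : R); lra.
  (* Origin of the constant 7. For t <= 1 the second moment is 1 + t^2 (2 e - 1), and 2 e - 1 <= 7
     follows from e <= 4; for t > 1 it is 2 exp(F t), and 2 <= exp(6 F t). *)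
  have [t1|t1] := leP t 1%R.
    have -> : s = t by rewrite /s min_l.
    have -> : l = (2 * expR 1)%R by rewrite /l /T max_r// smallF ?normr1// expr1n.
    rewrite smallF ?ger0_norm//; apply: le_trans (expR_ge1Dx _) _; rewrite ler_expR mulrC.
    rewrite ler_wpM2r ?sqr_ge0//.
    suff : (expR 1 <= 4 :> R)%R by lra.
    have h2 : (expR (- (1 / 2)) >= 1 / 2 :> R)%R.
      by apply: le_trans (expR_ge1Dx _); lra.
    have h3 : (expR (- (1 / 2)) ^+ 2 * expR 1 = 1 :> R)%R.
      by rewrite expr2 -!expRD (_ : _ + _ = 0)%R ?expR0//; field.
    have h4 : (1 / 4 <= expR (- (1 / 2)) ^+ 2 :> R)%R.
      by rewrite expr2; have := ler_pM _ _ h2 h2; lra.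
    have := ler_wpM2r (expR_ge0 1) h4; rewrite h3; lra.
  have -> : s = 1%R by rewrite /s min_r// ltW.
  have -> : l = (2 * expR (F t))%R by rewrite /l /T max_l// ltW.
  rewrite expr1n mul1r addrC subrK (_ : 7 * F t = 6 * F t + F t)%R; last by ring.
  rewrite expRD ler_wpM2r ?expR_ge0// (le_trans e2)// ler_expR.
  have := largeF (ltW t1); lra.
have s1' : (0 <= 1 - s)%R by rewrite subr_ge0.
have max0 (x : R) : (0 <= Num.max x 0)%R by rewrite le_max lexx orbT.
split.
- by rewrite mulr_ge0.
- rewrite EFinM m0E -symm -ge0_integralZl_EFin//; last 2 first.
  + by move=> w _; rewrite lee_fin.
  + exact/measurable_EFinP.
  apply: eq_integral => w _; rewrite -EFinM; congr EFin.
  rewrite /G indicE; case: (boolP (_ \in _)) => [|_]; last by rewrite mulr0 addr0.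
  rewrite inE /B/= => Bw; rewrite max_r ?mulr0// oppr_le0.
  by rewrite (le_trans (ltW T0)).
(* On B the variable e Y is at least T, so the tilted share contributes at least s l T P(B) = s T =
   t. *)
- apply: (@le_trans _ _ (\int[P]_w ((1 - s) * Num.max (e * Y w) 0 + (s * l * T) * \1_B (Y w))%:E)).
    under eq_integral do rewrite EFinD.
    rewrite ge0_integralD//; last 4 first.
    + by move=> w _; rewrite lee_fin mulr_ge0.
    + by apply/measurable_EFinP; exact: measurable_funM.
    + by move=> w _; rewrite lee_fin !mulr_ge0// ?(ltW T0)// indicE.
    + by apply/measurable_EFinP; exact: measurable_funM.
    rewrite intB ?mulr_ge0// ?(ltW T0)//.
    under eq_integral do rewrite EFinM.
    rewrite ge0_integralZl_EFin//; last 2 first.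
    + by move=> w _; rewrite lee_fin.
    + exact/measurable_EFinP.
    rewrite -m0E -EFinM EFinD (_ : (s * l * T / l = t)%R)//.
    by rewrite -sT; field.
  apply: ge0_le_integral => //.
  + by move=> w _; rewrite lee_fin addr_ge0 ?mulr_ge0// ?(ltW T0)// indicE.
  + apply/measurable_EFinP; apply: measurable_funD; exact: measurable_funM.
  + by apply/measurable_EFinP; apply: measurable_funM => //; exact: measurableT_comp.
  move=> w _; rewrite lee_fin /G [in leRHS]mulrDl lerD2l -!mulrA ler_wpM2l// ler_wpM2l//.
  rewrite indicE; case: (boolP (_ \in _)) => [|_]; last by rewrite mulr0 mul0r.
  rewrite inE /B => Be; rewrite mulr1 mul1r ler_wpM2l ?expR_ge0//.
  by rewrite le_max Be.
apply: (@le_lt_trans _ _ (\int[P]_w ((1 - s + s * l) * Num.max (e * Y w) 0)%:E)).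
  apply: ge0_le_integral => //.
  + by move=> w _; rewrite lee_fin mulr_ge0.
  + by apply/measurable_EFinP; apply: measurable_funM => //; exact: measurableT_comp.
  + by apply/measurable_EFinP; exact: measurable_funM.
  move=> w _; have i1 : (\1_B (Y w) <= 1 :> R)%R by rewrite indicE; case: (Y w \in B).
  by rewrite lee_fin ler_wpM2r// /G lerD2l ler_piMr ?mulr_ge0.
under eq_integral do rewrite EFinM.
rewrite ge0_integralZl_EFin//; [|by move=> w _; rewrite lee_fin|exact/measurable_EFinP|by rewrite addr_ge0 ?mulr_ge0].
by rewrite -m0E -EFinM ltry.
Qed.

End symmetric.

(** * Moments of linear forms under a product of tilts *)

Section dual_moment_bound.
Context d {Omega : measurableType d} {R : realType} (P : probability Omega R).
Context (F : R -> R) (smallF : forall x, `|x| <= 1 -> F x = x ^+ 2)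
  (largeF : forall x, 1 <= x -> x <= F x).
Context (n : nat) (Y : 'I_n -> Omega -> R) (mY : forall i, measurable_fun setT (Y i))
  (indY : independent_family P Y) (symY : forall i, symmetric_rv P (Y i))
  (tailF : forall i t, 1 <= t -> P [set w | t <= `|Y i w|] = (expR (- F t))%:E).

Lemma dual_moment_bound (x t : 'I_n -> R) (p : R) : 2 <= p ->
  (\int[P]_w (`|\sum_i x i * Y i w| `^ p)%:E <= 1)%E ->
  (forall i, 0 <= t i) -> \sum_i F (t i) <= p ->
  \sum_i `|x i| * t i <= expR 7.
Proof.
move=> p2 Sp t0 Fp; have p0 : 0 < p by lra.
(* Each variable is tilted in the direction of the sign of its coefficient, so that all the shifts
   add up to sum |x_i| t_i. *)
pose e i : R := if 0 <= x i then 1 else -1.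
have e1 i : `|e i| = 1 by rewrite /e; case: ifP; rewrite ?normrN normr1.
have ex i : x i = `|x i| * e i.
  by rewrite /e; case: ger0P => _; rewrite ?mulr1 ?mulrN1 ?opprK.
have /choice[G /choice[m Gm]] i := tilt (mY i) (symY i) smallF largeF (tailF i) (e1 i) (t0 i).
have mG i : measurable_fun setT (G i) by case: (Gm i).
have G0 i y : 0 <= G i y by case: (Gm i).
pose W w := \prod_i G i (Y i w).
pose S w := \sum_i x i * Y i w.
have W0 w : 0 <= W w by rewrite prodr_ge0.
have mS : measurable_fun setT S.
  by apply: measurable_sum => i; exact: measurable_funM.
have mW : measurable_fun setT W.
  by apply: measurable_prod => i _; exact: measurableT_comp.
have max0 (y : R) : 0 <= Num.max y 0 by rewrite le_max lexx orbT.
have EW : (\int[P]_w (W w)%:E = 1)%E.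
  rewrite independent_family_prod//; first by rewrite big1// => i _; case: (Gm i).
  by move=> i; case: (Gm i) => _ _ -> _ _; exact: ltry.
have EW2 : (\int[P]_w (W w ^+ 2)%:E <= (expR (7 * p))%:E)%E.
  have -> : (fun w => (W w ^+ 2)%:E) = (fun w => (\prod_i (G i (Y i w) ^+ 2))%:E).
    by apply/funext => w; rewrite /W -prodrXl.
  rewrite (independent_family_prod indY mY (G := fun i y => G i y ^+ 2)).
  - have h i : (0 <= \int[P]_w (G i (Y i w) ^+ 2)%:E)%E.
      by rewrite integral_ge0// => w _; rewrite lee_fin sqr_ge0.
    suff H : ((0 <= \prod_i \int[P]_w (G i (Y i w) ^+ 2)%:E) /\
        (\prod_i \int[P]_w (G i (Y i w) ^+ 2)%:E <= (expR (\sum_i 7 * F (t i)))%:E))%E.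
      apply: (le_trans H.2); rewrite lee_fin ler_expR -mulr_sumr ler_wpM2l//.
    elim/big_ind2 : _ => [|a b a' b' [? ?] [? ?]|i _].
    + by rewrite expR0.
    + by rewrite expRD EFinM mule_ge0// lee_pmul.
    + by split => //; case: (Gm i).
  - by move=> i; exact: measurable_funX.
  - by move=> i y; exact: sqr_ge0.
  - by move=> i; case: (Gm i) => _ _ _ + _; move=> /le_lt_trans; apply; exact: ltry.
(* The function g is merged into the i-th density; all the other factors integrate to 1. *)
have EWi i (g : R -> R) : measurable_fun setT g -> (forall y, 0 <= g y) ->
    (\int[P]_w (G i (Y i w) * g (Y i w))%:E < +oo)%E ->
    (\int[P]_w (W w * g (Y i w))%:E = \int[P]_w (G i (Y i w) * g (Y i w))%:E)%E.
  move=> mg g0 gy.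
  pose G' j y := if j == i then G i y * g y else G j y.
  have -> : (fun w => (W w * g (Y i w))%:E) = (fun w => (\prod_j G' j (Y j w))%:E).
    apply/funext => w; congr EFin; rewrite /W (bigD1 i)//= [in RHS](bigD1 i)//= {1}/G' eqxx.
    rewrite mulrAC; congr (_ * _); apply: eq_bigr => j /negPf ji.
    by rewrite /G' ji.
  rewrite independent_family_prod//.
  - rewrite (bigD1 i)//= /G' eqxx big1 ?mule1// => j /negPf ->.
    by case: (Gm j).
  - move=> j; rewrite /G'; case: eqP => // _; exact: measurable_funM.
  - by move=> j y; rewrite /G'; case: eqP => // _; rewrite mulr_ge0.
  - move=> j; rewrite /G'; case: eqP => [->//|_].
    by case: (Gm j) => _ _ -> _ _; exact: ltry.
pose pos i (y : R) := Num.max (e i * y) 0.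
pose neg i (y : R) := Num.max (- (e i * y)) 0.
have pos0 i y : 0 <= pos i y := max0 _.
have neg0 i y : 0 <= neg i y := max0 _.
have mpos i : measurable_fun setT (pos i).
  by apply: measurable_maxr => //; exact: mulrl_measurable.
have mneg i : measurable_fun setT (neg i).
  apply: measurable_maxr => //; apply: measurableT_comp => //; exact: mulrl_measurable.
have EN i : (\int[P]_w (W w * neg i (Y i w))%:E = (m i)%:E)%E.
  case: (Gm i) => _ _ _ _ [_ h _ _].
  have h' : (\int[P]_w (G i (Y i w) * neg i (Y i w))%:E = (m i)%:E)%E := h.
  by rewrite EWi// h' ltry.
have EP i : ((m i + t i)%:E <= \int[P]_w (W w * pos i (Y i w))%:E)%E.
  case: (Gm i) => _ _ _ _ [_ _ h h2].
  by rewrite EWi.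
(* By E |S|^p <= 1, E W^2 <= e^(7p) and E W = 1, the three terms of [weighted_am_gm] integrate to at
   most their weights 1/p, 1/p and 1 - 2/p, which add up to 1. *)
have ES : (\int[P]_w (W w * `|S w|)%:E <= (expR 7)%:E)%E.
  pose a1 := expR 7 / p; pose a2 := expR 7 * expR (- (7 * p)) / p.
  pose a3 := expR 7 * (1 - 2 / p).
  have p2' : 0 <= 1 - 2 / p by rewrite subr_ge0 ler_pdivrMr// mul1r.
  have a10 : 0 <= a1 by rewrite divr_ge0 ?expR_ge0// ltW.
  have a20 : 0 <= a2 by rewrite !mulr_ge0 ?invr_ge0 ?expR_ge0// ltW.
  have a30 : 0 <= a3 by rewrite mulr_ge0 ?expR_ge0.
  have mSp : measurable_fun setT (fun w => `|S w| `^ p).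
    by apply: measurableT_comp (measurable_powR p) _; exact: measurableT_comp.
  apply: (@le_trans _ _ (\int[P]_w (a1%:E * (`|S w| `^ p)%:E +
      (a2%:E * (W w ^+ 2)%:E + a3%:E * (W w)%:E)))%E).
    apply: ge0_le_integral => //.
    - by move=> w _; rewrite lee_fin mulr_ge0.
    - by apply/measurable_EFinP; apply: measurable_funM => //; exact: measurableT_comp.
    - apply: emeasurable_funD; first by apply: measurable_funeM; exact/measurable_EFinP.
      apply: emeasurable_funD; apply: measurable_funeM; apply/measurable_EFinP => //.
      exact: measurable_funX.
    move=> w _; rewrite -!EFinM -!EFinD lee_fin mulrC.
    apply: le_trans (weighted_am_gm (normr_ge0 _) (W0 w) p2) _.
    by rewrite le_eqVlt; apply/orP; left; apply/eqP; rewrite /a1 /a2 /a3; ring.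
  rewrite ge0_integralD//; last 4 first.
  - by move=> w _; rewrite mule_ge0 ?lee_fin ?powR_ge0.
  - by apply: measurable_funeM; exact/measurable_EFinP.
  - by move=> w _; rewrite -!EFinM -EFinD lee_fin addr_ge0// mulr_ge0// sqr_ge0.
  - apply: emeasurable_funD; apply: measurable_funeM; apply/measurable_EFinP => //.
    exact: measurable_funX.
  rewrite ge0_integralD//; last 4 first.
  - by move=> w _; rewrite mule_ge0 ?lee_fin ?sqr_ge0.
  - by apply: measurable_funeM; apply/measurable_EFinP; exact: measurable_funX.
  - by move=> w _; rewrite mule_ge0 ?lee_fin.
  - by apply: measurable_funeM; exact/measurable_EFinP.
  have Zl (g : Omega -> R) a : measurable_fun setT g -> (forall w, 0 <= g w) -> 0 <= a ->
      (\int[P]_w (a%:E * (g w)%:E) = a%:E * \int[P]_w (g w)%:E)%E.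
    move=> mg g0 a0; rewrite ge0_integralZl_EFin//.
      by move=> w _; rewrite lee_fin.
    exact/measurable_EFinP.
  have Sp0 w : 0 <= `|S w| `^ p by exact: powR_ge0.
  have W20 w : 0 <= W w ^+ 2 by exact: sqr_ge0.
  have mW2 : measurable_fun setT (fun w => W w ^+ 2) by exact: measurable_funX.
  rewrite (Zl _ _ mSp Sp0 a10) (Zl _ _ mW2 W20 a20) (Zl _ _ mW W0 a30).
  rewrite EW mule1.
  apply: (@le_trans _ _ (a1%:E * 1 + (a2%:E * (expR (7 * p))%:E + a3%:E))%E).
    by rewrite leeD// ?lee_wpmul2l// leeD2r// lee_wpmul2l.
  rewrite mule1 -EFinM -!EFinD lee_fin le_eqVlt; apply/orP; left; apply/eqP.
  by rewrite /a1 /a2 /a3 expRN; field; rewrite gt_eqF//= gt_eqF ?expR_gt0.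
have mWg i g : measurable_fun setT g -> measurable_fun setT (fun w => (W w * g (Y i w))%:E).
  by move=> mg; apply/measurable_EFinP; apply: measurable_funM => //; exact: measurableT_comp.
have sumI (g : 'I_n -> R -> R) : (forall i, measurable_fun setT (g i)) ->
    (forall i y, 0 <= g i y) ->
    (\int[P]_w (W w * \sum_i `|x i| * g i (Y i w))%:E =
     \sum_i `|x i|%:E * \int[P]_w (W w * g i (Y i w))%:E)%E.
  move=> mg g0.
  have -> : (fun w => (W w * \sum_i `|x i| * g i (Y i w))%:E) =
      (fun w => \sum_i (`|x i|%:E * (W w * g i (Y i w))%:E))%E.
    apply/funext => w; rewrite mulr_sumr -sumEFin; apply: eq_bigr => i _.
    by rewrite -EFinM; congr EFin; ring.
  rewrite ge0_integral_sum//.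
  - apply: eq_bigr => i _; rewrite ge0_integralZl_EFin//; last exact: mWg.
    by move=> w _; rewrite lee_fin mulr_ge0.
  - by move=> i; apply: measurable_funeM; exact: mWg.
  - by move=> i w _; rewrite mule_ge0 ?lee_fin// mulr_ge0.
(* S is the difference of the two sums with [pos] and [neg]; the negative one is moved to the right
   so that every integrand is nonnegative. The means m_i then occur on both sides and cancel,
   leaving sum |x_i| t_i <= e^7. *)
have key : (\int[P]_w (W w * \sum_i `|x i| * pos i (Y i w))%:E <=
    \int[P]_w ((W w * `|S w|)%:E + (W w * \sum_i `|x i| * neg i (Y i w))%:E))%E.
  apply: ge0_le_integral => //.
  - by move=> w _; rewrite lee_fin mulr_ge0// sumr_ge0// => i _; rewrite mulr_ge0.
  - apply/measurable_EFinP; apply: measurable_funM => //; apply: measurable_sum => i.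
    by apply: measurable_funM => //; exact: measurableT_comp.
  - apply: emeasurable_funD; apply/measurable_EFinP; apply: measurable_funM => //.
      exact: measurableT_comp.
    apply: measurable_sum => i.
    by apply: measurable_funM => //; exact: measurableT_comp.
  move=> w _; rewrite -EFinD lee_fin -mulrDr ler_wpM2l//.
  rewrite -lerBlDr -sumrB; apply: le_trans (ler_norm _).
  rewrite /S le_eqVlt; apply/orP; left; apply/eqP; apply: eq_bigr => i _.
  rewrite [in RHS]ex -mulrBr -mulrA; congr (_ * _); rewrite /pos /neg.
  by case: (leP (e i * Y i w) 0) => h; case: (leP (- (e i * Y i w)) 0) => h'; lra.
rewrite ge0_integralD// in key; last 4 first.
- by move=> w _; rewrite lee_fin mulr_ge0.
- by apply/measurable_EFinP; apply: measurable_funM => //; exact: measurableT_comp.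
- by move=> w _; rewrite lee_fin mulr_ge0// sumr_ge0// => i _; rewrite mulr_ge0.
- apply/measurable_EFinP; apply: measurable_funM => //; apply: measurable_sum => i.
  by apply: measurable_funM => //; exact: measurableT_comp.
rewrite !sumI// in key.
rewrite -lee_fin.
have key2 : ((\sum_i `|x i| * (m i + t i))%:E <= (expR 7)%:E + (\sum_i `|x i| * m i)%:E)%E.
  apply: le_trans (_ : _ <= \sum_i `|x i|%:E * \int[P]_w (W w * pos i (Y i w))%:E)%E _.
    by rewrite -sumEFin; apply: lee_sum => i _; rewrite EFinM lee_wpmul2l ?lee_fin.
  apply: le_trans key _; apply: leeD => //.
  by rewrite -sumEFin; apply: lee_sum => i _; rewrite EN EFinM.
move: key2; rewrite -EFinD lee_fin => key2.
move: key2; under eq_bigr do rewrite mulrDr.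
rewrite big_split/= lee_fin => h; lra.
Qed.

End dual_moment_bound.

(** * Entropy and the Poincare inequality *)

Section bounded_measurable.
Context d {T : measurableType d} {R : realType}.

(** A class stable under the algebraic operations and integrable for any probability: real-valued
    integrals are linear and monotone on it without further side conditions. *)
Definition bounded_measurable (f : T -> R) :=
  measurable_fun setT f /\ exists M, forall x, `|f x| <= M.

Lemma bounded_measurable_cst c : bounded_measurable (fun=> c).
Proof. by split; [exact: measurable_cst|exists `|c|]. Qed.

Lemma bounded_measurableD f g : bounded_measurable f -> bounded_measurable g ->
  bounded_measurable (fun x => f x + g x).
Proof.
move=> [mf [M fM]] [mg [N gN]]; split; first exact: measurable_funD.
by exists (M + N) => x; rewrite (le_trans (ler_normD _ _))// lerD.
Qed.

Lemma bounded_measurableM f g : bounded_measurable f -> bounded_measurable g ->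
  bounded_measurable (fun x => f x * g x).
Proof.
move=> [mf [M fM]] [mg [N gN]]; split; first exact: measurable_funM.
by exists (M * N) => x; rewrite normrM ler_pM.
Qed.

Lemma bounded_measurableZ c f : bounded_measurable f ->
  bounded_measurable (fun x => c * f x).
Proof. by apply: bounded_measurableM; exact: bounded_measurable_cst. Qed.

Lemma bounded_measurableX f n : bounded_measurable f ->
  bounded_measurable (fun x => f x ^+ n).
Proof.
move=> [mf [M fM]]; split; first exact: measurable_funX.
by exists (M ^+ n) => x; rewrite normrX lerXn2r// ?nnegrE// (le_trans _ (fM x)).
Qed.

Context (mu : probability T R).

Lemma bounded_measurable_integrable f : bounded_measurable f ->
  mu.-integrable setT (EFin \o f).
Proof.
move=> [mf [M fM]]; apply: measurable_bounded_integrable => //.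
  by rewrite (le_lt_trans (probability_le1 _ _))// ltry.
exists M; split; first exact: num_real.
by move=> N MN x _; exact: le_trans (fM x) (ltW MN).
Qed.

Lemma bounded_measurable_RintegralE f : bounded_measurable f ->
  (\int[mu]_x f x)%R%:E = (\int[mu]_x (f x)%:E)%E.
Proof.
by move=> /bounded_measurable_integrable fi; rewrite /Rintegral fineK// integrable_fin_num.
Qed.

Lemma Rintegral_probability_cst (c : R) : \int[mu]_(x in setT) c = c.
Proof.
rewrite Rintegral_cst//; have -> : fine (mu setT) = 1 by rewrite probability_setT.
by rewrite mulr1.
Qed.

Lemma bounded_measurable_RintegralD f g : bounded_measurable f -> bounded_measurable g ->
  \int[mu]_x (f x + g x) = \int[mu]_x f x + \int[mu]_x g x.
Proof.
by move=> bf bg; rewrite RintegralD//; exact: bounded_measurable_integrable.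
Qed.

Lemma bounded_measurable_RintegralZ c f : bounded_measurable f ->
  \int[mu]_x (c * f x) = c * \int[mu]_x f x.
Proof. by move=> bf; rewrite RintegralZl//; exact: bounded_measurable_integrable. Qed.

Lemma bounded_measurable_le_Rintegral f g : bounded_measurable f -> bounded_measurable g ->
  (forall x, f x <= g x) -> \int[mu]_x f x <= \int[mu]_x g x.
Proof.
by move=> bf bg fg; apply: le_Rintegral => //; exact: bounded_measurable_integrable.
Qed.

Lemma Rintegral_ge_cst c f : bounded_measurable f -> (forall x, c <= f x) ->
  c <= \int[mu]_x f x.
Proof.
move=> bf cf; rewrite -[leLHS]Rintegral_probability_cst.
apply: bounded_measurable_le_Rintegral => //; exact: bounded_measurable_cst.
Qed.

Lemma Rintegral_sqr_gt0 c f : 0 < c -> (forall x, c <= f x) -> bounded_measurable f ->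
  0 < \int[mu]_x (f x ^+ 2).
Proof.
move=> c0 cf bf; apply: (@lt_le_trans _ _ (c ^+ 2)); first by rewrite exprn_gt0.
apply: Rintegral_ge_cst => [|x]; first exact: bounded_measurableX.
by rewrite ler_pXn2r// ?nnegrE ?(le_trans _ (cf x)) ?ltW.
Qed.

(* The tangent line of ln at a / (u b) is what makes both sides match. *)
Lemma entropy_sqr_ge (u : T -> R) (c : R) : 0 < c -> (forall x, c <= u x) ->
  bounded_measurable u ->
  (((\int[mu]_x (u x ^+ 2)) * ln ((\int[mu]_x (u x ^+ 2)) / (\int[mu]_x u x) ^+ 2))%R%:E
    <= entropy mu (fun x => u x ^+ 2)%R)%E.
Proof.
move=> c0 cu bu.
have u0 x : 0 < u x by exact: lt_le_trans (cu x).
set a := \int[mu]_x (u x ^+ 2); set b := \int[mu]_x u x.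
have bu2 := bounded_measurableX 2 bu.
have a0 : 0 < a by exact: Rintegral_sqr_gt0 c0 cu bu.
have b0 : 0 < b by apply: (lt_le_trans c0); exact: Rintegral_ge_cst.
have bln : bounded_measurable (fun x => u x ^+ 2 * ln (u x ^+ 2)).
  apply: bounded_measurableM => //; case: bu2 => mu2 [M hM]; split.
    by apply: measurableT_comp => //; exact: measurable_ln.
  exists (`|ln (c ^+ 2)| + `|ln (M)|) => x.
  have c2 : 0 < c ^+ 2 by rewrite exprn_gt0.
  have l1 : ln (c ^+ 2) <= ln (u x ^+ 2).
    by rewrite ler_ln ?posrE ?exprn_gt0// ler_pXn2r// ?nnegrE ltW.
  have M0 : 0 < M by apply: lt_le_trans (hM x); rewrite normr_gt0 sqrf_eq0 gt_eqF.
  have l2 : ln (u x ^+ 2) <= ln M.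
    by rewrite ler_ln ?posrE ?exprn_gt0// (le_trans (ler_norm _)).
  have n1 := ler_norm (ln M); have n2 := ler_norm (- ln (c ^+ 2)).
  rewrite normrN in n2; have n3 := normr_ge0 (ln M); have n4 := normr_ge0 (ln (c ^+ 2)).
  by rewrite ler_norml; apply/andP; split; lra.
rewrite /entropy -!bounded_measurable_RintegralE// -/a lne_EFin// -EFinM -EFinB lee_fin.
(* Pointwise this is 1 + ln z <= z at z = a / (b u), multiplied by 2 u^2. After integration the last
   two terms cancel and 2 a ln(a / b) remains. *)
have key : \int[mu]_x (2 * ln (a / b) * u x ^+ 2 + (2 * u x ^+ 2 + (- (2 * a / b)) * u x)) <=
    \int[mu]_x (u x ^+ 2 * ln (u x ^+ 2)).
  apply: bounded_measurable_le_Rintegral => //.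
    apply: bounded_measurableD; first exact: bounded_measurableZ.
    by apply: bounded_measurableD; exact: bounded_measurableZ.
  move=> x; have ab0 : 0 < a / b / u x by rewrite !divr_gt0.
  have := expR_ge1Dx (ln (a / b / u x)); rewrite lnK ?posrE//.
  rewrite ln_div ?posrE ?divr_gt0// lnXn// => h.
  have -> : u x ^+ 2 * (ln (u x) *+ 2) = 2 * u x ^+ 2 * ln (u x) by ring.
  have h2 := ler_wpM2l (ltW (exprn_gt0 2 (u0 x))) h.
  have e : u x ^+ 2 * (a / b / u x) = a / b * u x by field; rewrite !gt_eqF.
  rewrite e in h2; rewrite -[2 * a / b]mulrA; move: h2; move: (ln (a / b)) => L.
  move: (ln (u x)) => l; set q := a / b * u x.
  have -> : - (2 * (a / b)) * u x = - 2 * q by rewrite /q; ring.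
  lra.
rewrite bounded_measurable_RintegralD in key; last 2 first.
- exact: bounded_measurableZ.
- by apply: bounded_measurableD; exact: bounded_measurableZ.
rewrite bounded_measurable_RintegralD in key; last 2 first.
- exact: bounded_measurableZ.
- exact: bounded_measurableZ.
rewrite !bounded_measurable_RintegralZ// -/a -/b in key.
have e : 2 * a / b * b = 2 * a by field; rewrite gt_eqF.
rewrite mulNr e in key.
rewrite !ln_div ?posrE ?exprn_gt0// in key *; rewrite lnXn// mulr2n.
move: key; set I := \int[mu]_x _; set la := ln a; set lb := ln b => key.
by have -> : a * (la - (lb + lb)) = 2 * (la - lb) * a + (2 * a - 2 * a) - a * la; [ring|lra].
Qed.

(** From ln z >= 1 - 1/z at z = a / b^2 in the preceding lower bound. *)
Lemma variance_le_entropy (u : T -> R) (c : R) : 0 < c -> (forall x, c <= u x) ->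
  bounded_measurable u ->
  ((\int[mu]_x (u x ^+ 2) - (\int[mu]_x u x) ^+ 2)%R%:E <= entropy mu (fun x => u x ^+ 2)%R)%E.
Proof.
move=> c0 cu bu; apply: le_trans (entropy_sqr_ge c0 cu bu); rewrite lee_fin.
set a := \int[mu]_x (u x ^+ 2); set b := \int[mu]_x u x.
have a0 : 0 < a by exact: Rintegral_sqr_gt0 c0 cu bu.
have b0 : 0 < b by apply: (lt_le_trans c0); exact: Rintegral_ge_cst.
have q0 : 0 < b ^+ 2 / a by rewrite divr_gt0// exprn_gt0.
have := expR_ge1Dx (ln (b ^+ 2 / a)); rewrite lnK ?posrE// => h.
have := ler_wpM2l (ltW a0) h.
have -> : ln (a / b ^+ 2) = - ln (b ^+ 2 / a) by rewrite -lnV ?posrE// invf_div.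
have -> : a * (b ^+ 2 / a) = b ^+ 2 by field; rewrite gt_eqF.
by rewrite mulrDr mulr1; lra.
Qed.

Lemma moment_le_of_entropy (u : T -> R) (c k : R) : 0 < c -> (forall x, c <= u x) ->
  bounded_measurable u ->
  (entropy mu (fun x => u x ^+ 2)%R <= (k * \int[mu]_x (u x ^+ 2))%R%:E)%E ->
  \int[mu]_x (u x ^+ 2) <= (\int[mu]_x u x) ^+ 2 * expR k.
Proof.
move=> c0 cu bu; move/(le_trans (entropy_sqr_ge c0 cu bu)); rewrite lee_fin.
set a := \int[mu]_x (u x ^+ 2); set b := \int[mu]_x u x.
have a0 : 0 < a by exact: Rintegral_sqr_gt0 c0 cu bu.
have b0 : 0 < b by apply: (lt_le_trans c0); exact: Rintegral_ge_cst.
rewrite mulrC ler_pM2r// -ler_expR lnK ?posrE ?divr_gt0 ?exprn_gt0// ler_pdivrMr ?exprn_gt0//.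
by rewrite mulrC.
Qed.

End bounded_measurable.

(** A supremum of functions affine in y is lower semicontinuous, whatever F. *)
Lemma legendre_measurable (R : realType) (F : R -> R) :
  measurable_fun setT (legendre (fun x => (F x)%:E)).
Proof.
apply: lower_semicontinuous_measurable; apply/lower_semicontinuousP => a.
have -> : [set y | (a%:E < legendre (fun x => (F x)%:E) y)%E] =
    \bigcup_x [set y | a < x * y - F x].
  apply/seteqP; split => [y /ereal_sup_gt[_ [x _ <-] h]|y [x _ h]].
    by exists x => //; rewrite -EFinB lte_fin in h.
  by apply: lt_le_trans (legendre_ubound F x y); rewrite lte_fin.
apply: bigcup_open => x _.
have cf : continuous (fun y : R => x * y - F x).
  move=> y; apply: cvgB; last exact: cvg_cst.
  by apply: cvgM; [exact: cvg_cst|exact: cvg_id].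
apply: (@open_comp _ _ (fun y => x * y - F x) [set z | a < z]) => [y _|]; first exact: cf.
exact: open_gt.
Qed.

(** * Cutoff functions on R^n *)

Section cutoff.
Context {R : realType} {n : nat} (eta : R).
Implicit Types x : 'rV[R]_n.

(** The norm of ['rV[R]_n] is the maximum norm; the squared Euclidean norm is smooth, hence suited
    to a differentiable cutoff. *)
Definition sqr_norm x := \sum_i x 0 i ^+ 2.

(* The square makes the cutoff continuously differentiable. *)
Definition cutoff x := Num.max 0 (1 - eta ^+ 2 * sqr_norm x) ^+ 2.

Lemma locally_lipschitz_sqr_norm : locally_lipschitz sqr_norm.
Proof.
apply: locally_lipschitz_sum => i.
have -> : (fun x : 'rV[R]_n => x 0 i ^+ 2) = (fun x => x 0 i * x 0 i).
  by apply/funext => x; rewrite expr2.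
by apply: locally_lipschitzM; exact: locally_lipschitz_coord.
Qed.

Lemma sqr_norm_ge0 x : 0 <= sqr_norm x.
Proof. by apply: sumr_ge0 => i _; exact: sqr_ge0. Qed.

Lemma sqr_norm_delta (h : R) x i :
  sqr_norm (h *: delta_mx 0 i + x) = sqr_norm x + (2 * h * x 0 i + h ^+ 2).
Proof.
rewrite /sqr_norm (bigD1 i)//= [in RHS](bigD1 i)//= !mxE !eqxx/= mulr1.
rewrite (eq_bigr (fun j => x 0 j ^+ 2)) => [|j /negPf ji]; first by ring.
by rewrite !mxE ji andbF mulr0 add0r.
Qed.

(** The derivative 2 max(0, w) is 2-Lipschitz, so the first-order Taylor remainder is at most
    h^2. *)
Lemma sqr_pos_part_taylor (w h : R) :
  `|Num.max 0 (w + h) ^+ 2 - Num.max 0 w ^+ 2 - 2 * Num.max 0 w * h| <= h ^+ 2.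
Proof.
by rewrite ler_norml; case: (leP 0 w) => hw; case: (leP 0 (w + h)) => hh; apply/andP; split; nra.
Qed.

Lemma cutoff_ge0 x : 0 <= cutoff x.
Proof. exact: sqr_ge0. Qed.

Lemma cutoff_le1 x : cutoff x <= 1.
Proof.
have := mulr_ge0 (sqr_ge0 eta) (sqr_norm_ge0 x); rewrite /cutoff => h.
by case: (leP 0 (1 - eta ^+ 2 * sqr_norm x)) => hh; nra.
Qed.

Lemma locally_lipschitz_cutoff : locally_lipschitz cutoff.
Proof.
pose phi (y : R) : R := Num.max 0 (1 - eta ^+ 2 * y) ^+ 2.
pose dphi (y : R) : R := - (eta ^+ 2) * (2 * Num.max 0 (1 - eta ^+ 2 * y)).
apply: (@locally_lipschitz_comp _ _ phi dphi sqr_norm); last exact: locally_lipschitz_sqr_norm.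
  move=> y; apply: (@is_derive_quadratic _ _ _ _ _ _ ((eta ^+ 2) ^+ 2)) => h _.
  have := sqr_pos_part_taylor (1 - eta ^+ 2 * y) (- (eta ^+ 2 * h)).
  rewrite sqrrN exprMn; congr (`|_| <= _); rewrite /phi /dphi /GRing.scale/= mulr1.
  have -> : 1 - eta ^+ 2 * (h + y) = 1 - eta ^+ 2 * y - eta ^+ 2 * h by ring.
  by ring.
move=> y; apply: cvgM; first exact: cvg_cst.
apply: cvgM; first exact: cvg_cst.
apply: (@continuous_max _ _ (fun=> 0) (fun y => 1 - eta ^+ 2 * y)); first exact: cvg_cst.
apply: cvgB; first exact: cvg_cst.
by apply: cvgM; [exact: cvg_cst|exact: cvg_id].
Qed.

Lemma is_derive_cutoff x i : is_derive x (delta_mx 0 i : 'rV[R]_n) cutoff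
  (- (4 * eta ^+ 2 * x 0 i * Num.max 0 (1 - eta ^+ 2 * sqr_norm x))).
Proof.
set w := 1 - eta ^+ 2 * sqr_norm x; set M := Num.max 0 w.
have M0 : 0 <= M by rewrite /M le_max lexx.
apply: (@is_derive_quadratic _ _ _ _ _ _
  ((eta ^+ 2) ^+ 2 * (2 * `|x 0 i| + 1) ^+ 2 + 2 * M * eta ^+ 2)) => h h1.
(* The increment of w when x moves by h along the i-th axis. *)
pose dl : R := - (eta ^+ 2 * (2 * h * x 0 i + h ^+ 2)).
have := sqr_pos_part_taylor w dl; rewrite -/M => H.
have -> : cutoff (h *: delta_mx 0 i + x) = Num.max 0 (w + dl) ^+ 2.
  by rewrite /cutoff sqr_norm_delta /w /dl; congr (Num.max _ _ ^+ _); ring.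
rewrite /cutoff -/w -/M.
have -> : Num.max 0 (w + dl) ^+ 2 - M ^+ 2 - h * - (4 * eta ^+ 2 * x 0 i * M) =
   (Num.max 0 (w + dl) ^+ 2 - M ^+ 2 - 2 * M * dl) + - (2 * M * eta ^+ 2 * h ^+ 2).
  by rewrite /dl; ring.
apply: le_trans (ler_normD _ _) _; rewrite [leRHS]mulrDl; apply: lerD.
  apply: le_trans H _; rewrite /dl sqrrN exprMn -[leRHS]mulrA ler_wpM2l ?sqr_ge0//.
  have -> : 2 * h * x 0 i + h ^+ 2 = (2 * x 0 i + h) * h by ring.
  rewrite exprMn ler_wpM2r ?sqr_ge0// -[leLHS]real_normK ?num_real//.
  rewrite ler_pXn2r ?nnegrE ?addr_ge0 ?mulr_ge0//.
  by rewrite (le_trans (ler_normD _ _))// lerD// normrM ger0_norm.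
by rewrite normrN ger0_norm// mulr_ge0 ?sqr_ge0// mulr_ge0 ?sqr_ge0// mulr_ge0.
Qed.

(** Where the maximum is positive, |eta x_i| <= 1 absorbs one factor eta; hence the gradient of the
    cutoff tends to 0 uniformly as eta does. *)
Lemma derive_cutoff_le x i : 0 <= eta ->
  `|4 * eta ^+ 2 * x 0 i * Num.max 0 (1 - eta ^+ 2 * sqr_norm x)| <= 4 * eta.
Proof.
move=> eta0; case: (leP 0 (1 - eta ^+ 2 * sqr_norm x)) => h; last first.
  by rewrite mulr0 normr0 mulr_ge0.
have xN : x 0 i ^+ 2 <= sqr_norm x.
  rewrite /sqr_norm (bigD1 i)//= lerDl; apply: sumr_ge0 => j _; exact: sqr_ge0.
have e1 : `|eta * x 0 i| <= 1.
  rewrite -(@ler_pXn2r _ 2) ?nnegrE// expr1n real_normK ?num_real// exprMn.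
  have := ler_wpM2l (sqr_ge0 eta) xN; lra.
have w1 : `|1 - eta ^+ 2 * sqr_norm x| <= 1.
  rewrite ger0_norm// gerBl mulr_ge0 ?sqr_ge0 ?sqr_norm_ge0//.
have -> : 4 * eta ^+ 2 * x 0 i * (1 - eta ^+ 2 * sqr_norm x) =
   4 * eta * ((eta * x 0 i) * (1 - eta ^+ 2 * sqr_norm x)) by ring.
rewrite normrM [X in X * _]ger0_norm ?mulr_ge0// ler_piMr ?mulr_ge0//.
by rewrite normrM mulr_ile1.
Qed.

Lemma sqr_norm_compact : 0 < eta -> compact [set x | eta ^+ 2 * sqr_norm x <= 1].
Proof.
move=> eta0; apply: bounded_closed_compact.
  exists eta^-1; split; first exact: num_real.
  move=> M hM x /= hx.
  have M0 : 0 <= M by rewrite (le_trans _ (ltW hM))// invr_ge0 ltW.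
  rewrite [leLHS]/Num.norm/= mx_normrE; apply: bigmax_le => // -[i j] _ /=.
  rewrite ord1; apply: le_trans (ltW hM).
  have xN : x 0 j ^+ 2 <= sqr_norm x.
    rewrite /sqr_norm (bigD1 j)//= lerDl; apply: sumr_ge0 => k _; exact: sqr_ge0.
  rewrite -(@ler_pXn2r _ 2) ?nnegrE ?invr_ge0 ?(ltW eta0)// real_normK ?num_real//.
  rewrite (le_trans xN)// exprVn -[leRHS]mulr1 ler_pdivlMl ?exprn_gt0//.
apply: (@closed_comp _ _ (fun x => eta ^+ 2 * sqr_norm x) [set y | y <= 1]); last exact: closed_le.
move=> x _; apply: (@cvgM _ _ (nbhs (x : 'rV[R]_n)) _ (fun=> eta ^+ 2)); first exact: cvg_cst.
exact: (locally_lipschitz_continuous locally_lipschitz_sqr_norm).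
Qed.

End cutoff.

(** * Poincare inequality by linearisation and cutoff *)

Section poincare.
Context {R : realType} {n : nat} (F : R -> R)
  (smallF : forall x, `|x| <= 1 -> F x = x ^+ 2)
  (largeF : forall x, 1 <= `|x| -> `|x| <= F x)
  (D : R) (D0 : 0 < D) (mu : probability 'rV[R]_n R)
  (muLSI : mLSI (@sum_conjugate R n (fun x => (F x)%:E)) D mu).
Implicit Types G : 'rV[R]_n -> R.

Lemma bounded_lipschitz_bounded_measurable G : locally_lipschitz G ->
  (exists M, forall x, `|G x| <= M) -> bounded_measurable G.
Proof.
by move=> lG bG; split => //; apply: continuous_measurable; exact: locally_lipschitz_continuous.
Qed.

Lemma gradient_measurable G i : locally_lipschitz G ->
  measurable_fun setT (fun x => gradient G x 0 i).
Proof.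
move=> lG; have -> : (fun x => gradient G x 0 i) = (fun x => 'D_(delta_mx 0 i) G x).
  by apply/funext => x; rewrite mxE.
by apply: derive_measurable; exact: locally_lipschitz_continuous.
Qed.

Lemma gradient_comp (phi : R -> R) (d : R) G x : is_derive (G x) 1 phi d ->
  locally_lipschitz G -> gradient (phi \o G) x = d *: gradient G x.
Proof.
by move=> dphi lG; apply/rowP => i; rewrite !mxE (derive_comp_locally_lipschitz _ dphi).
Qed.

Lemma sum_conjugate_measurable (g : 'rV[R]_n -> 'rV[R]_n) :
  (forall i, measurable_fun setT (fun x => g x 0 i)) ->
  measurable_fun setT (fun x => sum_conjugate (fun x => (F x)%:E) (g x)).
Proof.
move=> mg; apply: emeasurable_sum => i.
by apply: measurableT_comp; [exact: legendre_measurable|exact: mg].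
Qed.

(* For e small the logarithmic gradient of 1 + e G has coordinates in [-1, 1],
   where L y <= y^2 / 4, and the entropy dominates the variance. *)
Lemma poincare_bounded_gradient G (M k : R) : locally_lipschitz G ->
  (forall x, `|G x| <= M) -> (forall x i, `|gradient G x 0 i| <= k) ->
  \int[mu]_x (G x ^+ 2) - (\int[mu]_x G x) ^+ 2 <=
  D / 4 * \int[mu]_x (\sum_i gradient G x 0 i ^+ 2).
Proof.
(* With this e both |e G| and the coordinates of e grad G are at most 1/2, so u >= 1/2 and the
   logarithmic gradient of u has coordinates of size at most 2 * 1/2 = 1. *)
move=> lG GM Gk; pose e : R := (2 * (`|M| + `|k| + 1))^-1.
have s0 : 0 < `|M| + `|k| + 1 by rewrite ltr_wpDl// addr_ge0.
have e0 : 0 < e by rewrite invr_gt0 mulr_gt0.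
have eM : e * `|M| <= 1 / 2.
  rewrite /e invfM -mulrA div1r ler_piMr ?invr_ge0// ler_pdivrMl// mulr1.
  by rewrite -addrA lerDl addr_ge0.
have ek : e * `|k| <= 1 / 2.
  rewrite /e invfM -mulrA div1r ler_piMr ?invr_ge0// ler_pdivrMl// mulr1.
  by rewrite addrAC lerDr addr_ge0.
pose u x := 1 + e * G x.
have eG x : `|e * G x| <= 1 / 2.
  rewrite normrM gtr0_norm//; apply: le_trans eM.
  by rewrite ler_wpM2l ?(ltW e0)// (le_trans (GM x))// ler_norm.
have u1 x : 1 / 2 <= u x by have := eG x; rewrite ler_norml => /andP[h _]; rewrite /u; lra.
have u2 x : `|u x| <= 3 / 2.
  by rewrite (le_trans (ler_normD _ _))// normr1; have := eG x; lra.
have dphi (y : R) : is_derive y 1 (fun z : R => 1 + e * z) e.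
  apply: (@is_derive_quadratic _ _ _ _ _ _ 0) => h _.
  rewrite mul0r /GRing.scale/= (_ : _ - _ = 0) ?normr0//; ring.
have lu : locally_lipschitz u.
  by apply: (locally_lipschitz_comp dphi) => // y; exact: cvg_cst.
have gu x : gradient u x = e *: gradient G x.
  by rewrite -(gradient_comp (dphi (G x)) lG).
have bG : bounded_measurable G.
  by apply: bounded_lipschitz_bounded_measurable => //; exists M.
have bu : bounded_measurable u.
  by apply: bounded_lipschitz_bounded_measurable => //; exists (3 / 2).
have bgr i : bounded_measurable (fun x => gradient G x 0 i).
  by split; [exact: gradient_measurable|exists k].
have bS : bounded_measurable (fun x => \sum_i gradient G x 0 i ^+ 2).
  split; first by apply: measurable_sum => i; case: (bounded_measurableX 2 (bgr i)).
  exists (\sum_(i < n) k ^+ 2) => x.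
  rewrite ger0_norm; last by apply: sumr_ge0 => i _; exact: sqr_ge0.
  apply: ler_sum => i _; rewrite -[leLHS]real_normK ?num_real//.
  by rewrite ler_pXn2r// ?nnegrE// (le_trans _ (Gk x i)).
have half0 : 0 < 1 / 2 :> R by lra.
have main : (entropy mu (fun x => u x ^+ 2)%R <=
    (D * (e ^+ 2 / 4 * \int[mu]_x (\sum_i gradient G x 0 i ^+ 2)))%R%:E)%E.
  apply: (le_trans (muLSI _ _ _)) => //.
  - by move=> x; rewrite (lt_le_trans half0).
  - exists (3 / 2); split; first exact: num_real.
    by move=> N hN x _ /=; exact: le_trans (u2 x) (ltW hN).
  rewrite EFinM lee_wpmul2l ?lee_fin ?(ltW D0)//.
  rewrite -bounded_measurable_RintegralZ// bounded_measurable_RintegralE; last exact: bounded_measurableZ.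
  have u0 x : 0 < u x by exact: lt_le_trans (u1 x).
  apply: ge0_le_integral => //.
  - move=> x _; rewrite mule_ge0 ?lee_fin ?sqr_ge0// sume_ge0// => i _; exact: legendre_ge0.
  - apply: emeasurable_funM; last first.
      by apply/measurable_EFinP; case: (bounded_measurableX 2 bu).
    apply: sum_conjugate_measurable => i.
    have -> : (fun x => ((u x)^-1 *: gradient u x) 0 i) = (fun x => u x `^ (-1) * gradient u x 0 i).
      by apply/funext => x; rewrite mxE powR_inv1// ltW.
    apply: measurable_funM; last exact: gradient_measurable.
    by apply: measurableT_comp (measurable_powR _) _; case: bu.
  - by apply/measurable_EFinP; case: (bounded_measurableZ (e ^+ 2 / 4) bS).
  move=> x _.
  have -> : (e ^+ 2 / 4 * \sum_i gradient G x 0 i ^+ 2)%:E =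
     ((\sum_i (((u x)^-1 * (e * gradient G x 0 i)) ^+ 2 / 4)%:E) * (u x ^+ 2)%:E)%E.
    rewrite sumEFin -EFinM; congr EFin; rewrite mulr_sumr mulr_suml.
    by apply: eq_bigr => i _; field; rewrite gt_eqF.
  rewrite lee_wpmul2r ?lee_fin ?sqr_ge0//; apply: lee_sum => i _.
  rewrite gu !mxE; apply: legendre_small => //.
  have ui : (u x)^-1 <= 2.
    rewrite -[2]invrK lef_pV2 ?posrE ?invr_gt0//; have := u1 x; lra.
  rewrite !normrM (gtr0_norm e0) gtr0_norm ?invr_gt0//.
  have h : e * `|'D_(delta_mx 0 i) G x| <= 1 / 2.
    apply: le_trans ek; rewrite ler_wpM2l ?(ltW e0)//.
    by have := Gk x i; rewrite mxE => /le_trans; apply; exact: ler_norm.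
  apply: le_trans (ler_pM _ _ ui h) _ => //; [by rewrite invr_ge0 ltW|by rewrite mulr_ge0 ?(ltW e0)|lra].
have := le_trans (variance_le_entropy mu half0 u1 bu) main; rewrite lee_fin.
have bG2 := bounded_measurableX 2 bG.
have -> : \int[mu]_x u x = 1 + e * \int[mu]_x G x.
  rewrite bounded_measurable_RintegralD ?Rintegral_probability_cst ?bounded_measurable_RintegralZ//.
  - exact: bounded_measurable_cst.
  - exact: bounded_measurableZ.
have -> : \int[mu]_x (u x ^+ 2) = 1 + (2 * e * \int[mu]_x G x + e ^+ 2 * \int[mu]_x (G x ^+ 2)).
  have -> : (fun x => u x ^+ 2) = (fun x => 1 + (2 * e * G x + e ^+ 2 * G x ^+ 2)).
    by apply/funext => x; rewrite /u; ring.
  rewrite bounded_measurable_RintegralD ?Rintegral_probability_cst//; last 2 first.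
  - exact: bounded_measurable_cst.
  - by apply: bounded_measurableD; exact: bounded_measurableZ.
  rewrite bounded_measurable_RintegralD; last 2 first.
  - exact: bounded_measurableZ.
  - exact: bounded_measurableZ.
  by rewrite !bounded_measurable_RintegralZ.
set b := \int[mu]_x G x; set a := \int[mu]_x (G x ^+ 2); set S := \int[mu]_x _ => h.
have e20 : 0 < e ^+ 2 by rewrite exprn_gt0.
(* The terms of order 0 and 1 in e cancel in the variance of 1 + e G, so both sides are multiples of
   e^2. *)
rewrite -(ler_pM2l e20).
have -> : e ^+ 2 * (D / 4 * S) = D * (e ^+ 2 / 4 * S) by ring.
by apply: le_trans h; rewrite le_eqVlt; apply/orP; left; apply/eqP; ring.
Qed.

End poincare.

Section poincare_limit.
Context {R : realType} {n : nat} (F : R -> R)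
  (smallF : forall x, `|x| <= 1 -> F x = x ^+ 2)
  (largeF : forall x, 1 <= `|x| -> `|x| <= F x)
  (D : R) (D0 : 0 < D) (mu : probability 'rV[R]_n R)
  (muLSI : mLSI (@sum_conjugate R n (fun x => (F x)%:E)) D mu).
Implicit Types G : 'rV[R]_n -> R.

Lemma gradient_cutoff_le G (eta : R) x i : locally_lipschitz G -> 0 <= eta ->
  `|gradient (fun y => G y * cutoff eta y) x 0 i| <=
  cutoff eta x * `|gradient G x 0 i| + `|G x| * (4 * eta).
Proof.
move=> lG eta0; rewrite !mxE.
have := derive_mul_le (is_derive_cutoff eta x i) (locally_lipschitz_continuous lG).
move=> /le_trans; apply; rewrite ger0_norm ?cutoff_ge0// lerD2l normrM normrN.
by rewrite ler_wpM2l// derive_cutoff_le.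
Qed.

(** The gradient of G is bounded on the compact ball carrying the cutoff; elsewhere only the term
    with the gradient of the cutoff remains. This brings bounded G within reach of
    [poincare_bounded_gradient]. *)
Lemma gradient_cutoff_bounded G (eta M : R) : locally_lipschitz G ->
  (forall x, `|G x| <= M) -> 0 < eta ->
  exists k : R, forall x i, `|gradient (fun y => G y * cutoff eta y) x 0 i| <= k.
Proof.
move=> lG GM eta0.
have M0 : 0 <= M by apply: le_trans (GM 0).
have /choice[k hk] (i : 'I_n) := derive_bounded_on_compact (delta_mx 0 i) lG
  (@sqr_norm_compact R n _ eta0).
exists (\sum_i `|k i| + M * (4 * eta)) => x i.
apply: le_trans (gradient_cutoff_le x i lG (ltW eta0)) _; apply: lerD; last first.
  by rewrite ler_wpM2r// mulr_ge0// ltW.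
have [h|h] := leP (eta ^+ 2 * sqr_norm x) 1; last first.
  have -> : cutoff eta x = 0 by rewrite /cutoff max_l ?expr0n// subr_le0 ltW.
  by rewrite mul0r; apply: sumr_ge0.
apply: (@le_trans _ _ `|k i|); last by rewrite (bigD1 i)//= lerDl; apply: sumr_ge0.
rewrite -[leRHS]mul1r ler_pM ?cutoff_ge0 ?cutoff_le1// mxE.
by apply: le_trans (hk i x h) _; exact: ler_norm.
Qed.

Lemma cutoff_cvg (x : 'rV[R]_n) : cutoff k.+1%:R^-1 x @[k --> \oo] --> (1 : R).
Proof.
have h : k.+1%:R^-1 @[k --> \oo] --> (0 : R) by exact: cvg_harmonic.
have l : 1 - k.+1%:R^-1 * k.+1%:R^-1 * sqr_norm x @[k --> \oo] --> 1 - 0 * 0 * sqr_norm x.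
  by apply: cvgB; [exact: cvg_cst|apply: cvgM; [exact: cvgM|exact: cvg_cst]].
rewrite !mul0r subr0 in l.
have c : continuous (fun w : R => Num.max 0 w ^+ 2).
  move=> w; apply: (@continuous_comp _ _ _ (fun w : R => Num.max 0 w) (fun y => y ^+ 2)).
    by apply: (@continuous_max _ _ (fun=> 0) (fun w => w)); [exact: cvg_cst|exact: cvg_id].
  exact: exprn_continuous.
have e1 : Num.max 0 1 ^+ 2 = 1 :> R by rewrite max_r// expr1n.
by rewrite -[X in _ --> X]e1; exact: (cvg_comp _ _ l (c 1)).
Qed.

(** Applied to G times a cutoff, the inequality for bounded gradients loses a factor 2 through (x +
    y)^2 <= 2 x^2 + 2 y^2, whence D / 2 in place of D / 4. The error from the gradient of the cutoff
    is at most 32 n M^2 eta^2 and vanishes in the limit. *)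
Lemma poincare G (M : R) : locally_lipschitz G -> (forall x, `|G x| <= M) ->
  ((\int[mu]_x (G x ^+ 2) - (\int[mu]_x G x) ^+ 2)%R%:E <=
  (D / 2)%:E * \int[mu]_x (\sum_i gradient G x 0 i ^+ 2)%R%:E)%E.
Proof.
move=> lG GM.
have M0 : 0 <= M by apply: le_trans (GM 0).
have bG : bounded_measurable G.
  by apply: bounded_lipschitz_bounded_measurable => //; exists M.
have S0 : (0 <= \int[mu]_x (\sum_i gradient G x 0 i ^+ 2)%R%:E)%E.
  by apply: integral_ge0 => x _; rewrite lee_fin; apply: sumr_ge0 => i _; exact: sqr_ge0.
have mS : measurable_fun setT (fun x => \sum_i gradient G x 0 i ^+ 2).
  by apply: measurable_sum => i; apply: measurable_funX; exact: gradient_measurable.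
have D20 : 0 < D / 2 by rewrite divr_gt0.
have [Sy|Sfin] := eqVneq (\int[mu]_x (\sum_i gradient G x 0 i ^+ 2)%R%:E)%E +oo%E.
  by rewrite Sy gt0_muley ?leey// lte_fin.
set S := (\int[mu]_x (\sum_i gradient G x 0 i ^+ 2)%R%:E)%E in S0 Sfin *.
have SE : S = (fine S)%:E by rewrite fineK// ge0_fin_numE// lt_neqAle Sfin leey.
rewrite SE -EFinM lee_fin.
pose eta k : R := k.+1%:R^-1.
have eta0 k : 0 < eta k by rewrite invr_gt0.
pose Gk k x := G x * cutoff (eta k) x.
have lGk k : locally_lipschitz (Gk k).
  by apply: locally_lipschitzM => //; exact: locally_lipschitz_cutoff.
have GkG k x : `|Gk k x| <= `|G x|.
  by rewrite normrM [X in _ * X]ger0_norm ?cutoff_ge0// ler_piMr ?cutoff_le1.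
have GkM k x : `|Gk k x| <= M by apply: le_trans (GkG k x) _.
have bGk k : bounded_measurable (Gk k).
  by apply: bounded_lipschitz_bounded_measurable => //; exists M.
have cvgGk x : Gk k x @[k --> \oo] --> G x.
  by rewrite -[X in _ --> X]mulr1; apply: cvgM; [exact: cvg_cst|exact: cutoff_cvg].
have step k : \int[mu]_x (Gk k x ^+ 2) - (\int[mu]_x Gk k x) ^+ 2 <=
    D / 4 * (2 * fine S + 32 * n%:R * M ^+ 2 * (eta k * eta k)).
  have [l hl] := gradient_cutoff_bounded lG GM (eta0 k).
  apply: le_trans (poincare_bounded_gradient smallF largeF D0 muLSI (lGk k) (GkM k) hl) _.
  rewrite ler_wpM2l ?divr_ge0 ?(ltW D0)//.
  have bgr i : bounded_measurable (fun x => gradient (Gk k) x 0 i).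
    by split; [exact: gradient_measurable|exists l].
  have bS : bounded_measurable (fun x => \sum_i gradient (Gk k) x 0 i ^+ 2).
    split; first by apply: measurable_sum => i; case: (bounded_measurableX 2 (bgr i)).
    exists (\sum_(i < n) l ^+ 2) => x.
    rewrite ger0_norm; last by apply: sumr_ge0 => i _; exact: sqr_ge0.
    apply: ler_sum => i _; rewrite -[leLHS]real_normK ?num_real//.
    by rewrite ler_pXn2r// ?nnegrE// (le_trans _ (hl x i)).
  rewrite -lee_fin bounded_measurable_RintegralE// EFinD EFinM -SE.
  set c := 32 * n%:R * M ^+ 2 * (eta k * eta k).
  have c0 : 0 <= c by rewrite !mulr_ge0 ?(ltW (eta0 k))// sqr_ge0.
  have -> : c%:E = (\int[mu]_x (cst c%:E x))%E.
    by rewrite integral_cst// -[LHS]mule1; congr (_ * _)%E; rewrite -(@probability_setT _ _ _ mu).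
  rewrite -ge0_integralZl_EFin//; last 2 first.
  - by move=> x _; rewrite lee_fin; apply: sumr_ge0 => i _; exact: sqr_ge0.
  - exact/measurable_EFinP.
  rewrite -ge0_integralD//; last 2 first.
  - by move=> x _; rewrite mule_ge0// lee_fin; apply: sumr_ge0 => i _; exact: sqr_ge0.
  - by apply: measurable_funeM; exact/measurable_EFinP.
  apply: ge0_le_integral => //.
  - by move=> x _; rewrite lee_fin; apply: sumr_ge0 => i _; exact: sqr_ge0.
  - by apply/measurable_EFinP; case: bS.
  - by apply: emeasurable_funD => //; apply: measurable_funeM; exact/measurable_EFinP.
  move=> x _ /=; rewrite -EFinM -EFinD lee_fin.
  have -> : c = \sum_(i < n) (32 * M ^+ 2 * (eta k * eta k)).
    by rewrite sumr_const card_ord /c -mulr_natr; ring.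
  rewrite mulr_sumr -big_split/=; apply: ler_sum => i _.
  have h := gradient_cutoff_le x i lG (ltW (eta0 k)).
  have h2 : `|gradient (Gk k) x 0 i| <= `|gradient G x 0 i| + M * (4 * eta k).
    apply: le_trans h _; apply: lerD.
      by rewrite ler_piMl// cutoff_le1.
    by rewrite ler_wpM2r// mulr_ge0// ltW.
  rewrite -[leLHS]real_normK ?num_real// -[gradient G x 0 i ^+ 2]real_normK ?num_real//.
  have e0 := ltW (eta0 k).
  have h3 : `|gradient (Gk k) x 0 i| ^+ 2 <= (`|gradient G x 0 i| + M * (4 * eta k)) ^+ 2.
    by rewrite ler_pXn2r// nnegrE addr_ge0// mulr_ge0// mulr_ge0.
  apply: le_trans h3 _.
  have := sqr_ge0 (`|gradient G x 0 i| - M * (4 * eta k)).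
  move: (`|gradient G x 0 i|) (eta k) => y z; nra.
have mGk k : measurable_fun setT (EFin \o Gk k).
  by apply/measurable_EFinP; case: (bGk k).
have cvgI (H : nat -> 'rV[R]_n -> R) (H0 : 'rV[R]_n -> R) (N : R) :
    (forall k, bounded_measurable (H k)) -> bounded_measurable H0 ->
    (forall k x, `|H k x| <= N) -> (forall x, H k x @[k --> \oo] --> H0 x) ->
    \int[mu]_x H k x @[k --> \oo] --> \int[mu]_x H0 x.
  move=> bH bH0 HN HH0.
  have [|||||_ _ h] := @dominated_convergence _ _ _ mu setT measurableT
    (fun k x => (H k x)%:E) (fun x => (H0 x)%:E) (cst N%:E).
  - by move=> k; apply/measurable_EFinP; case: (bH k).
  - by apply/measurable_EFinP; case: bH0.
  - by apply: aeW => x _ A hA; exact: (HH0 x _ hA).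
  - exact: (bounded_measurable_integrable mu (bounded_measurable_cst N)).
  - by apply: aeW => x k _; rewrite lee_fin.
  have := h; under eq_fun do rewrite -bounded_measurable_RintegralE//.
  by rewrite -bounded_measurable_RintegralE// => /fine_cvgP[_].
have c1 := cvgI _ _ _ bGk bG GkM cvgGk.
have c2 : \int[mu]_x (Gk k x ^+ 2) @[k --> \oo] --> \int[mu]_x (G x ^+ 2).
  apply: (cvgI _ _ (M ^+ 2)) => [k||k x|x].
  - exact: bounded_measurableX.
  - exact: bounded_measurableX.
  - by rewrite normrX ler_pXn2r// nnegrE.
  - by rewrite expr2; under eq_fun do rewrite expr2; apply: cvgM.
have c3 : \int[mu]_x (Gk k x ^+ 2) - (\int[mu]_x Gk k x) ^+ 2 @[k --> \oo] -->
    \int[mu]_x (G x ^+ 2) - (\int[mu]_x G x) ^+ 2.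
  apply: cvgB => //; rewrite expr2; under eq_fun do rewrite expr2; exact: cvgM.
have he : eta k @[k --> \oo] --> (0 : R) by exact: cvg_harmonic.
have c4 : D / 4 * (2 * fine S + 32 * n%:R * M ^+ 2 * (eta k * eta k)) @[k --> \oo] -->
    D / 2 * fine S.
  have -> : D / 2 * fine S = D / 4 * (2 * fine S + 32 * n%:R * M ^+ 2 * (0 * 0)).
    by rewrite mul0r mulr0 addr0; field.
  apply: cvgM; first exact: cvg_cst.
  apply: cvgD; first exact: cvg_cst.
  by apply: cvgM; [exact: cvg_cst|apply: cvgM].
by apply: (ler_cvg_to c3 c4); exact: nearW.
Qed.

End poincare_limit.

(** * Moments of bounded functions *)

Section pointwise_powers.
Context {R : realType}.
Implicit Types A g r p q c d : R.

(** If r <= g the first factor is at most 1. Otherwise d may be raised to p, and (r/g)^p g^q = g^(q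
    - p) r^p is at most A^(q - p) r^p because q <= p and A <= g. *)
Lemma powR_div_mul_le A g r p q d : 0 < A -> A <= g -> 0 < r -> q <= p -> 0 <= d <= p ->
  (r / g) `^ d * g `^ q <= g `^ q + A `^ (q - p) * r `^ p.
Proof.
move=> A0 Ag r0 qp /andP[d0 dp]; have g0 : 0 < g by exact: lt_le_trans Ag.
have [rg|/ltW rg] := leP (r / g) 1.
  apply: (@le_trans _ _ (g `^ q)); last by rewrite lerDl mulr_ge0 ?powR_ge0.
  rewrite ler_piMl ?powR_ge0//.
  have -> : 1 = 1 `^ d :> R by rewrite powR1.
  by rewrite ge0_ler_powR ?nnegrE// divr_ge0// ltW.
apply: (@le_trans _ _ (A `^ (q - p) * r `^ p)); last by rewrite lerDr powR_ge0.
have rdg : (r / g) `^ d <= (r / g) `^ p by exact: ler_powR.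
apply: (@le_trans _ _ ((r / g) `^ p * g `^ q)); first by rewrite ler_wpM2r ?powR_ge0.
have -> : (r / g) `^ p * g `^ q = g `^ (q - p) * r `^ p.
  rewrite powRM ?invr_ge0 ?(ltW r0) ?(ltW g0)// -powR_inv1 ?(ltW g0)// -powRrM mulN1r.
  by rewrite powRD ?(gt_eqF g0) ?implybT//; ring.
rewrite ler_wpM2r ?powR_ge0//.
have -> : q - p = - (p - q) by ring.
rewrite !powRN lef_pV2 ?posrE ?powR_gt0//.
by rewrite ge0_ler_powR ?nnegrE ?subr_ge0 ?(ltW A0) ?(ltW g0).
Qed.

(** The same argument with the threshold delta for (r/g)^2: above it, (r/g)^2 <= delta^(1 - p/2)
    (r/g)^p since p >= 2. A small delta makes the first term absorbable. *)
Lemma sqr_div_mul_le A g r p q delta : 0 < A -> A <= g -> 0 < r -> q <= p -> 2 <= p ->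
  0 < delta ->
  (r / g) ^+ 2 * g `^ q <= delta * g `^ q + delta `^ (1 - p / 2) * (A `^ (q - p) * r `^ p).
Proof.
move=> A0 Ag r0 qp p2 delta0; have g0 : 0 < g by exact: lt_le_trans Ag.
have t0 : 0 <= A `^ (q - p) * r `^ p by rewrite mulr_ge0 ?powR_ge0.
have [h|/ltW h] := leP ((r / g) ^+ 2) delta.
  apply: (@le_trans _ _ (delta * g `^ q)); first by rewrite ler_wpM2r ?powR_ge0.
  by rewrite lerDl mulr_ge0 ?powR_ge0.
apply: (@le_trans _ _ (delta `^ (1 - p / 2) * (A `^ (q - p) * r `^ p))); last first.
  by rewrite lerDr mulr_ge0 ?powR_ge0// ltW.
have rg0 : 0 < r / g by rewrite divr_gt0.
have h1 : 1 <= (r / g) ^+ 2 / delta by rewrite ler_pdivlMr// mul1r.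
have h2 : (r / g) ^+ 2 <= delta `^ (1 - p / 2) * (r / g) `^ p.
  have -> : (r / g) ^+ 2 = delta * ((r / g) ^+ 2 / delta) by field; rewrite !gt_eqF.
  apply: (@le_trans _ _ (delta * ((r / g) ^+ 2 / delta) `^ (p / 2))).
    by rewrite ler_wpM2l ?(ltW delta0)//; apply: le1r_powR => //; lra.
  rewrite powRM ?sqr_ge0 ?invr_ge0 ?(ltW delta0)// -powR_mulrn ?(ltW rg0)// -powRrM.
  have -> : 2%:R * (p / 2) = p by field.
  have e1 : delta^-1 `^ (p / 2) = delta `^ (- (p / 2)).
    by rewrite -[delta^-1]powR_inv1 ?(ltW delta0)// -powRrM mulN1r.
  have e2 : delta `^ (1 - p / 2) = delta * delta `^ (- (p / 2)).
    by rewrite powRD ?(gt_eqF delta0) ?implybT// powRr1 ?(ltW delta0).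
  by rewrite e1 e2 le_eqVlt; apply/orP; left; apply/eqP; ring.
apply: le_trans (ler_wpM2r (powR_ge0 g q) h2) _.
rewrite -mulrA ler_wpM2l ?powR_ge0//.
have -> : (r / g) `^ p * g `^ q = g `^ (q - p) * r `^ p.
  rewrite powRM ?invr_ge0 ?(ltW r0) ?(ltW g0)// -powR_inv1 ?(ltW g0)// -powRrM mulN1r.
  by rewrite powRD ?(gt_eqF g0) ?implybT//; ring.
rewrite ler_wpM2r ?powR_ge0//.
have -> : q - p = - (p - q) by ring.
rewrite !powRN lef_pV2 ?posrE ?powR_gt0//.
by rewrite ge0_ler_powR ?nnegrE ?subr_ge0 ?(ltW A0) ?(ltW g0).
Qed.

Lemma is_derive_shifted_powR c A s (y : R) : 0 < A ->
  is_derive y 1 (fun z => ((z - c) ^+ 2 + A ^+ 2) `^ s)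
    (s * ((y - c) ^+ 2 + A ^+ 2) `^ (s - 1) * (2 * (y - c))).
Proof.
move=> A0.
have dW : is_derive y 1 (fun z => (z - c) ^+ 2 + A ^+ 2) (2 * (y - c)).
  apply: (@is_derive_quadratic _ _ _ _ _ _ 1) => h _.
  rewrite /GRing.scale/= mulr1 mul1r.
  have -> : (h + y - c) ^+ 2 + A ^+ 2 - ((y - c) ^+ 2 + A ^+ 2) - h * (2 * (y - c)) = h ^+ 2 by ring.
  by rewrite ger0_norm ?sqr_ge0.
have W0 : 0 < (y - c) ^+ 2 + A ^+ 2 by rewrite ltr_wpDl ?sqr_ge0// exprn_gt0.
pose W z : R := (z - c) ^+ 2 + A ^+ 2.
exact: (@is_derive1_comp _ (fun z => z `^ s) W y _ _ (is_derive1_powR s W0) dW).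
Qed.

Lemma continuous_shifted_powR c A s : 0 < A ->
  continuous (fun y => s * ((y - c) ^+ 2 + A ^+ 2) `^ (s - 1) * (2 * (y - c)) : R).
Proof.
move=> A0 y.
have cp : {for y, continuous (fun z : R => ((z - c) ^+ 2 + A ^+ 2) `^ (s - 1))}.
  apply/differentiable_continuous/derivable1_diffP.
  by have [] := is_derive_shifted_powR c (s - 1) y A0.
apply: cvgM.
  by apply: cvgM; [exact: cvg_cst|exact: cp].
by apply: cvgM; [exact: cvg_cst|apply: cvgB; [exact: cvg_id|exact: cvg_cst]].
Qed.

End pointwise_powers.

(** Halving q multiplies (q/p)^(a - 1) by theta, and squaring the bound for q / 2 restores the
    factor q. An exponent S therefore reproduces itself when S theta + k = S, that is for S = k / (1
    - theta), the sum of the geometric series. *)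
Lemma moment_iteration {R : realType} (m : R -> R) (a p B k : R) (theta := 2 `^ (- (a - 1))) :
  1 < a -> 0 < p -> 0 <= k -> (forall s, 0 <= s -> 0 <= m s) ->
  (forall q, 1 <= q <= 2 -> m (q / 2) <= B `^ q) ->
  (forall q, 2 <= q <= p -> m (q / 2) <= m (q / 4) ^+ 2 * expR (k * (q * (q / p) `^ (a - 1)))) ->
  forall q, 1 <= q <= p ->
    m (q / 2) <= B `^ q * expR (k / (1 - theta) * (q * (q / p) `^ (a - 1))).
Proof.
move=> a1 p0 k0 m0 low step q q1p.
have theta1 : theta < 1.
  have s0 : 0 < a - 1 by rewrite subr_gt0.
  rewrite /theta powRN invf_lt1 ?powR_gt0//.
  have e : 1 `^ (a - 1) = 1 :> R by rewrite powR1.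
  by rewrite -[X in X < _]e gt0_ltr_powR ?nnegrE ?ltr1n.
have S0 : 0 <= k / (1 - theta) by rewrite divr_ge0// subr_ge0 ltW.
set S := k / (1 - theta) in S0 *.
have SE : S * theta + k = S by rewrite /S; field; rewrite subr_eq0 gt_eqF.
(* Each halving lowers N by one, so the recursion ends at some q <= 2, where [low] applies. *)
clearbody S; have [N qN] : exists N, q <= 2 ^+ N.
  exists (Num.truncn q).+1; apply: (@le_trans _ _ (Num.truncn q).+1%:R).
    by apply: ltW; rewrite truncnS_gt.
  by rewrite -natrX ler_nat ltnW// ltn_expl.
elim: N q q1p qN => [|N IH] q /andP[q1 qp] qN.
  have -> : q = 1 by apply/eqP; rewrite eq_le q1 andbT; rewrite expr0 in qN.
  apply: le_trans (low 1 _) _; first by rewrite lexx ler1n.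
  by rewrite ler_peMr ?powR_ge0// -[leLHS]expR0 ler_expR !mulr_ge0 ?powR_ge0.
have q0 : 0 < q by exact: lt_le_trans q1.
have [q2|/ltW q2] := leP q 2.
  apply: le_trans (low q _) _; first by rewrite q1.
  by rewrite ler_peMr ?powR_ge0// -[leLHS]expR0 ler_expR !mulr_ge0 ?powR_ge0// ltW.
apply: le_trans (step q _) _; first by rewrite q2.
have h : m (q / 4) <= B `^ (q / 2) * expR (S * (q / 2 * (q / 2 / p) `^ (a - 1))).
  have -> : q / 4 = q / 2 / 2 by field.
  apply: IH; last by rewrite ler_pdivrMr// -exprSr.
  by rewrite ler_pdivlMr// mul1r q2/= (le_trans _ qp)// ler_pdivrMr// ler_peMr ?ler1n// ltW.
have e : (q / 2 / p) `^ (a - 1) = theta * (q / p) `^ (a - 1).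
  have -> : q / 2 / p = 2^-1 * (q / p) by field; rewrite gt_eqF.
  have i2 : 2^-1 = 2 `^ (- 1) :> R by rewrite powR_inv1.
  have qp0 : 0 <= q / p by rewrite divr_ge0// ltW.
  by rewrite powRM// [in LHS]i2 -powRrM mulN1r.
rewrite e in h; set t := (q / p) `^ (a - 1) in h *.
have q40 : 0 <= q / 4 by rewrite divr_ge0// ltW.
apply: (@le_trans _ _ ((B `^ (q / 2) * expR (S * (q / 2 * (theta * t)))) ^+ 2 * expR (k * (q * t)))).
  by rewrite ler_wpM2r ?expR_ge0// ler_pXn2r ?nnegrE ?m0// mulr_ge0 ?powR_ge0 ?expR_ge0.
rewrite exprMn -powR_mulrn ?powR_ge0// -powRrM divfK// -expRM_natl -[leLHS]mulrA -expRD.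
rewrite le_eqVlt; apply/orP; left; apply/eqP; congr (_ * expR _).
by rewrite -[in RHS]SE; field.
Qed.

Lemma powR_le_anti {R : realType} (x c d : R) : 0 < x <= 1 -> c <= d -> x `^ d <= x `^ c.
Proof.
move=> /andP[x0 x1] cd; have -> : d = c + (d - c) by ring.
rewrite powRD; last by rewrite (gt_eqF x0) implybT.
rewrite ler_piMr ?powR_ge0//.
have -> : 1 = 1 `^ (d - c) :> R by rewrite powR1.
by rewrite ge0_ler_powR ?nnegrE ?subr_ge0 ?(ltW x0).
Qed.

Section moment_constant.
Context {R : realType} (K a b D : R).

(** B dominates the factor of the gradient term, and its summand 1 keeps delta = (2 B)^-1 below 1.
    This delta is the threshold in [sqr_div_mul_le]; absorbing half of the left side doubles the
    rest. *)
Definition poincare_step_constant (B := D * b ^+ 2 * expR 7 ^+ 2 / 8 + 1) : R :=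
  2 + 4 * B * (2 * B)^-1 `^ (- (b / 2)).

(* The first summand accounts for the case b <= p, the second one for p <= b. *)
Definition step_exponent : R :=
  6 * D * (K ^+ 2 * expR 7) `^ b + b * ln poincare_step_constant.

(** The factor before the exponential bounds the moments at the bottom of the iteration; the
    exponential is the p-th root of what the iteration accumulates at q = p. *)
Definition moment_constant : R :=
  2 * Num.sqrt (D * expR 7 ^+ 2 + 1) * expR (step_exponent / (1 - 2 `^ (- (a - 1)))).

Lemma poincare_step_constant_ge1 : 0 < D -> 1 <= poincare_step_constant.
Proof.
move=> D0; apply: (@le_trans _ _ 2); first by rewrite ler1n.
rewrite lerDl mulr_ge0 ?powR_ge0// mulr_ge0// addr_ge0// divr_ge0// mulr_ge0 ?sqr_ge0//.
by rewrite mulr_ge0 ?sqr_ge0// ltW.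
Qed.

Lemma step_exponent_ge0 : 0 < D -> 0 <= b -> 0 <= step_exponent.
Proof.
move=> D0 b0; rewrite addr_ge0 ?mulr_ge0 ?powR_ge0 ?(ltW D0)//.
by apply: ln_ge0; exact: poincare_step_constant_ge1.
Qed.

Lemma moment_constant_gt0 : 0 < D -> 0 < moment_constant.
Proof.
move=> D0; rewrite !mulr_gt0 ?expR_gt0// sqrtr_gt0 ltr_wpDl// mulr_ge0 ?sqr_ge0//.
exact: ltW.
Qed.

End moment_constant.

(** * Comparison of consecutive moments *)

Section moment_step.
Context {R : realType} {n : nat} (F : R -> R) (K a b D p : R).
Context (K1 : 1 <= K) (a1 : 1 < a) (a2 : a <= 2) (b2 : 2 <= b) (D0 : 0 < D) (p2 : 2 <= p)
  (evenF : forall x, F `|x| = F x)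
  (smallF : forall x, `|x| <= 1 -> F x = x ^+ 2)
  (largeF : forall x, 1 <= `|x| -> `|x| <= F x)
  (growF : forall t u, 1 <= t ->
    K^-1 * t `^ conj_exponent b * F u <= F (t * u)
      <= K * t `^ conj_exponent a * F u).

Local Notation L := (legendre (fun x => (F x)%:E)).

Context (mu : probability 'rV[R]_n R)
  (muLSI : mLSI (@sum_conjugate R n (fun x => (F x)%:E)) D mu).

(* rho y stands for E |<y, Z>|^p; only these two consequences of the lower
   moment bound for <y, Z> matter. *)
Context (rho : 'rV[R]_n -> \bar R) (rho0 : forall y, (0 <= rho y)%E)
  (rho_sum : forall y (r : R), 0 < r -> (rho y <= (r `^ p)%:E)%E ->
    (\sum_i L (p / (expR 7 * K) * (r^-1 * y 0 i))%R <= p%:E)%E)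
  (rho_norm : forall y (r : R), 0 < r -> (rho y <= (r `^ p)%:E)%E ->
    \sum_i y 0 i ^+ 2 <= (expR 7 * r) ^+ 2).

Context (f : 'rV[R]_n -> R) (lf : locally_lipschitz f) (M : R) (fM : forall x, `|f x| <= M)
  (mrho : measurable_fun setT (fun x => rho (gradient f x)))
  (A : R) (A0 : 0 < A) (rhoA : (\int[mu]_x rho (gradient f x) <= (A `^ p)%:E)%E) (c : R).

Definition shifted_sqr x := (f x - c) ^+ 2 + A ^+ 2.
Local Notation w := shifted_sqr.

Let p0 : 0 < p. Proof. exact: lt_le_trans p2. Qed.
Let K0 : 0 < K. Proof. exact: lt_le_trans K1. Qed.

Lemma shifted_sqr_ge x : A ^+ 2 <= w x.
Proof. by rewrite lerDr sqr_ge0. Qed.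

Lemma shifted_sqr_gt0 x : 0 < w x.
Proof. by apply: lt_le_trans (shifted_sqr_ge x); rewrite exprn_gt0. Qed.

Lemma shifted_powR_ge s x : 0 <= s -> A `^ (2 * s) <= w x `^ s.
Proof.
move=> s0; rewrite powRrM powR_mulrn ?(ltW A0)//.
by rewrite ge0_ler_powR ?nnegrE ?sqr_ge0 ?shifted_sqr_ge// ltW ?shifted_sqr_gt0.
Qed.

Lemma locally_lipschitz_shifted_powR s : locally_lipschitz (fun x => w x `^ s).
Proof.
apply: (@locally_lipschitz_comp _ _ (fun z => ((z - c) ^+ 2 + A ^+ 2) `^ s)
  (fun y => s * ((y - c) ^+ 2 + A ^+ 2) `^ (s - 1) * (2 * (y - c))) f) => //.
  by move=> y; exact: is_derive_shifted_powR.
exact: continuous_shifted_powR.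
Qed.

Lemma gradient_shifted_powR s x : gradient (fun x => w x `^ s) x =
  (s * w x `^ (s - 1) * (2 * (f x - c))) *: gradient f x.
Proof. by rewrite -(gradient_comp (is_derive_shifted_powR c s (f x) A0) lf). Qed.

Lemma bounded_measurable_shifted_powR s : 0 <= s -> bounded_measurable (fun x => w x `^ s).
Proof.
move=> s0; apply: bounded_lipschitz_bounded_measurable.
  exact: locally_lipschitz_shifted_powR.
exists (((M + `|c|) ^+ 2 + A ^+ 2) `^ s) => x.
rewrite ger0_norm ?powR_ge0// ge0_ler_powR ?nnegrE ?addr_ge0 ?sqr_ge0//.
rewrite lerD2r -[leLHS]real_normK ?num_real//.
have h : `|f x - c| <= M + `|c| by rewrite (le_trans (ler_normB _ _))// lerD2r.
by rewrite ler_pXn2r ?nnegrE// (le_trans _ h).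
Qed.

Lemma shifted_powR_sqr s x : (w x `^ (s / 4)) ^+ 2 = w x `^ (s / 2).
Proof.
have e : s / 4 * 2%:R = s / 2 by field.
by rewrite -powR_mulrn ?powR_ge0// -powRrM e.
Qed.

(** The pointwise bound is used with r^p = rho(grad f x) + A^p, so that r >= A > 0. This r^p has
    integral at most 2 A^p, which is the factor 2. Where rho is infinite, so is the dominating
    function. *)
Lemma integral_powR_bound_cst (h : 'rV[R]_n -> \bar R) (c1 c2 q : R) :
  measurable_fun setT h -> (forall x, 0 <= h x)%E -> 0 <= c1 -> 0 < c2 -> 0 <= q ->
  (forall x r, A <= r -> (rho (gradient f x) <= (r `^ p)%:E)%E ->
    (h x <= (c1 * w x `^ (q / 2) + c2 * (A `^ (q - p) * r `^ p))%:E)%E) ->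
  (\int[mu]_x h x <= (c1 * \int[mu]_x (w x `^ (q / 2)) + 2 * c2 * A `^ q)%R%:E)%E.
Proof.
move=> mh h0 c10 c20 q0 hb.
have bw := bounded_measurable_shifted_powR (divr_ge0 q0 (ltW (ltr0n R 2)) : 0 <= q / 2).
have mw : measurable_fun setT (fun x => w x `^ (q / 2)) by case: bw.
set e := c2 * A `^ (q - p); have e0 : 0 < e by rewrite mulr_gt0 ?powR_gt0.
have Ap0 : 0 < A `^ p by rewrite powR_gt0.
apply: (@le_trans _ _ (\int[mu]_x (c1%:E * (w x `^ (q / 2))%:E +
    e%:E * (rho (gradient f x) + (A `^ p)%:E)))%E).
  apply: ge0_le_integral => //.
    apply: emeasurable_funD; first by apply: measurable_funeM; exact/measurable_EFinP.
    by apply: measurable_funeM; apply: emeasurable_funD.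
  move=> x _; have := rho0 (gradient f x); have := hb x.
  case: (rho (gradient f x)) => [s||]//= hx s0; last first.
    by rewrite addye// gt0_muley ?lte_fin// addey// leey.
  rewrite lee_fin in s0.
  have sA0 : 0 < s + A `^ p by rewrite ltr_wpDl.
  have rp : ((s + A `^ p) `^ p^-1) `^ p = s + A `^ p.
    by rewrite -powRrM mulVf ?gt_eqF// powRr1// ltW.
  have := hx ((s + A `^ p) `^ p^-1); rewrite rp lee_fin lerDl powR_ge0 => H.
  apply: le_trans (H _ isT) _.
    have {1}-> : A = (A `^ p) `^ p^-1 by rewrite -powRrM mulfV ?gt_eqF// powRr1// ltW.
    rewrite ge0_ler_powR ?nnegrE ?invr_ge0 ?(ltW p0) ?(ltW Ap0) ?(ltW sA0)//.
    by rewrite lerDr.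
  by rewrite lee_fin /e mulrA.
rewrite ge0_integralD//; last 4 first.
- by move=> x _; rewrite mule_ge0// lee_fin powR_ge0.
- by apply: measurable_funeM; exact/measurable_EFinP.
- by move=> x _; rewrite mule_ge0 ?lee_fin ?(ltW e0)// adde_ge0// lee_fin ltW.
- by apply: measurable_funeM; apply: emeasurable_funD.
rewrite ge0_integralZl_EFin//; last 2 first.
- by move=> x _; rewrite lee_fin powR_ge0.
- exact/measurable_EFinP.
rewrite ge0_integralZl_EFin ?(ltW e0)//; last 2 first.
- by move=> x _; rewrite adde_ge0// lee_fin ltW.
- exact: emeasurable_funD.
rewrite ge0_integralD//; last by move=> x _; rewrite lee_fin ltW.
rewrite -bounded_measurable_RintegralE//.
have -> : (\int[mu]_x (A `^ p)%:E = (A `^ p)%:E)%E.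
  by rewrite -bounded_measurable_RintegralE ?Rintegral_probability_cst//; exact: bounded_measurable_cst.
apply: (@le_trans _ _ (c1%:E * (\int[mu]_x (w x `^ (q / 2)))%R%:E +
    e%:E * ((A `^ p)%:E + (A `^ p)%:E))%E).
  by rewrite leeD2l// lee_wpmul2l ?lee_fin ?(ltW e0)// leeD2r.
rewrite lee_fin lerD2l.
have -> : e * (A `^ p + A `^ p) = 2 * c2 * (A `^ (q - p) * A `^ p) by rewrite /e; ring.
by rewrite -powRD ?(gt_eqF A0) ?implybT// subrK.
Qed.

(** Since A^q <= w^(q/2) everywhere, the constant term is absorbed into the integral. *)
Lemma integral_powR_bound (h : 'rV[R]_n -> \bar R) (c1 c2 q : R) :
  measurable_fun setT h -> (forall x, 0 <= h x)%E -> 0 <= c1 -> 0 < c2 -> 0 <= q ->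
  (forall x r, A <= r -> (rho (gradient f x) <= (r `^ p)%:E)%E ->
    (h x <= (c1 * w x `^ (q / 2) + c2 * (A `^ (q - p) * r `^ p))%:E)%E) ->
  (\int[mu]_x h x <= ((c1 + 2 * c2) * \int[mu]_x (w x `^ (q / 2)))%R%:E)%E.
Proof.
move=> mh h0 c10 c20 q0 hb.
apply: le_trans (integral_powR_bound_cst mh h0 c10 c20 q0 hb) _.
have q20 : 0 <= q / 2 by rewrite divr_ge0.
rewrite lee_fin [leRHS]mulrDl lerD2l ler_wpM2l ?mulr_ge0 ?(ltW c20)//.
apply: Rintegral_ge_cst => [|x]; first exact: bounded_measurable_shifted_powR.
have {1}-> : q = 2 * (q / 2) by field.
exact: shifted_powR_ge.
Qed.

Lemma shifted_powR_norm x s : w x `^ s = (w x `^ (1 / 2)) `^ (2 * s).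
Proof. by rewrite -powRrM; congr powR; field. Qed.

Lemma norm_shift_le x : `|f x - c| <= w x `^ (1 / 2).
Proof.
have -> : `|f x - c| = ((f x - c) ^+ 2) `^ (1 / 2).
  by rewrite -[(f x - c) ^+ 2]real_normK ?num_real// -powR_mulrn// -powRrM div1r mulfV// powRr1.
rewrite ge0_ler_powR ?nnegrE ?sqr_ge0 ?divr_ge0// ?(ltW (shifted_sqr_gt0 _))//.
by rewrite lerDl sqr_ge0.
Qed.

Lemma shifted_norm_ge x : A <= w x `^ (1 / 2).
Proof.
have {1}-> : A = A `^ (2 * (1 / 2)) by rewrite mulrCA mulfV// mulr1 powRr1// ltW.
by apply: shifted_powR_ge; rewrite divr_ge0.
Qed.

Lemma log_gradient_shifted x q : (w x `^ (q / 4))^-1 *: gradient (fun x => w x `^ (q / 4)) x =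
  (q / 2 * (f x - c) / w x) *: gradient f x.
Proof.
rewrite gradient_shifted_powR scalerA; congr (_ *: _).
have w0 := shifted_sqr_gt0 x.
have -> : w x `^ (q / 4) = w x * w x `^ (q / 4 - 1).
  have -> : w x `^ (q / 4) = w x `^ (1 + (q / 4 - 1)) by congr powR; ring.
  by rewrite [LHS]powRD ?(gt_eqF w0) ?implybT// powRr1// ltW.
by field; rewrite !gt_eqF ?powR_gt0.
Qed.

Lemma log_gradient_coef_le x q : 0 <= q ->
  `|q / 2 * (f x - c) / w x| <= q / 2 / w x `^ (1 / 2).
Proof.
move=> q0; have w0 := shifted_sqr_gt0 x.
have g0 : 0 < w x `^ (1 / 2) by rewrite powR_gt0.
have wE : w x = w x `^ (1 / 2) * w x `^ (1 / 2).
  by rewrite -powRD ?(gt_eqF w0) ?implybT// -splitr powRr1// ltW.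
have q20 : 0 <= q / 2 by rewrite divr_ge0.
rewrite normrM normrM normfV (gtr0_norm w0) (ger0_norm q20) -mulrA ler_wpM2l//.
rewrite ler_pdivrMr// {2}wE mulrA mulVf ?gt_eqF// [leRHS]mul1r.
exact: norm_shift_le.
Qed.

Lemma lsi_step q : b <= p -> 2 <= q -> q <= p ->
  \int[mu]_x (w x `^ (q / 2)) <= (\int[mu]_x (w x `^ (q / 4))) ^+ 2 *
    expR (6 * D * (K ^+ 2 * expR 7) `^ b * (q * (q / p) `^ (a - 1))).
Proof.
move=> bp q2 qp.
have q0 : 0 < q by exact: lt_le_trans q2.
have C11 : 1 <= K ^+ 2 * expR 7.
  by rewrite -[1]mulr1 ler_pM// ?exprn_ege1// -[leLHS]expR0 ler_expR.
set C1 := K ^+ 2 * expR 7 in C11 *.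
have C10 : 0 < C1 by exact: lt_le_trans C11.
have qp0 : 0 < q / p by rewrite divr_gt0.
have qp1 : q / p <= 1 by rewrite ler_pdivrMr// mul1r.
have q40 : 0 <= q / 4 by rewrite divr_ge0// ltW.
pose u x := w x `^ (q / 4).
have bu : bounded_measurable u by exact: bounded_measurable_shifted_powR.
have uA x : A `^ (2 * (q / 4)) <= u x by exact: shifted_powR_ge.
have uA0 : 0 < A `^ (2 * (q / 4)) by rewrite powR_gt0.
have u2E : (fun x => u x ^+ 2) = (fun x => w x `^ (q / 2)).
  by apply/funext => x; rewrite /u shifted_powR_sqr.
rewrite -u2E; apply: (moment_le_of_entropy uA0 uA bu).
(* The p is the bound for the sum of Legendre terms and the 2 counts the exponents a and b.
   Integration turns c2 into c2 + 2 c2, whence the 6 in the exponent. *)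
set c2 := 2 * p * (C1 `^ b * (q / p) `^ a).
have c20 : 0 < c2 by rewrite !mulr_gt0// powR_gt0.
have -> : 6 * D * C1 `^ b * (q * (q / p) `^ (a - 1)) * (\int[mu]_x u x ^+ 2) =
    D * ((c2 + 2 * c2) * \int[mu]_x (w x `^ (q / 2))).
  rewrite u2E /c2.
  have -> : (q / p) `^ a = q / p * (q / p) `^ (a - 1).
    have -> : (q / p) `^ a = (q / p) `^ (1 + (a - 1)) by congr powR; ring.
    by rewrite [LHS]powRD ?(gt_eqF qp0) ?implybT// powRr1// ltW.
  by field; rewrite gt_eqF.
rewrite EFinM.
apply: (le_trans (muLSI _ _ _)).
- by move=> x; exact: lt_le_trans (uA x).
- case: bu => _ [N uN]; exists N; split; first exact: num_real.
  by move=> N' NN' x _ /=; exact: le_trans (uN x) (ltW NN').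
- exact: locally_lipschitz_shifted_powR.
rewrite lee_wpmul2l ?lee_fin ?(ltW D0)//.
apply: integral_powR_bound => //; rewrite ?(ltW c20) ?(ltW q0)//.
- apply: emeasurable_funM; last first.
    by apply/measurable_EFinP; case: (bounded_measurableX 2 bu).
  apply: sum_conjugate_measurable => i.
  have -> : (fun x => ((u x)^-1 *: gradient u x) 0 i) = (fun x => u x `^ (-1) * gradient u x 0 i).
    by apply/funext => x; rewrite mxE powR_inv1// powR_ge0.
  apply: measurable_funM; last by apply: gradient_measurable; exact: locally_lipschitz_shifted_powR.
  by apply: measurableT_comp (measurable_powR _) _; case: bu.
- move=> x; rewrite mule_ge0 ?lee_fin ?sqr_ge0// sume_ge0// => i _; exact: legendre_ge0.
move=> x r Ar rr; have r0 : 0 < r by exact: lt_le_trans Ar.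
set y := gradient f x in rr *; set g := w x `^ (1 / 2).
have gA : A <= g by exact: shifted_norm_ge.
have g0 : 0 < g by exact: lt_le_trans gA.
have gq : w x `^ (q / 2) = g `^ q by rewrite shifted_powR_norm -/g; congr powR; field.
rewrite /u log_gradient_shifted shifted_powR_sqr gq -/y.
set s := q / 2 * (f x - c) / w x.
have sg : `|s| <= q / 2 / g by apply: log_gradient_coef_le; exact: ltW.
(* cc y is the normalised vector to which [rho_sum] applies. The dilation leading from it to s y has
   a factor of size at most t0, and K t0 = C1 (q/p) (r/g) / 2. *)
pose cc := p / (expR 7 * K) * r^-1.
have cc0 : 0 < cc by rewrite !mulr_gt0 ?invr_gt0 ?mulr_gt0 ?expR_gt0.
set t0 := q / 2 / g / cc.
set kap := (K * t0) `^ a + (K * t0) `^ b.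
have P1 : (sum_conjugate (fun x => (F x)%:E) (s *: y) <= kap%:E * p%:E)%E.
  apply: (@le_trans _ _ (\sum_i (kap%:E * L (p / (expR 7 * K) * (r^-1 * y 0 i))%R))%E).
    apply: lee_sum => i _; rewrite mxE.
    have -> : s * y 0 i = (s / cc) * (p / (expR 7 * K) * (r^-1 * y 0 i)).
      have -> : p / (expR 7 * K) * (r^-1 * y 0 i) = cc * y 0 i by rewrite /cc [LHS]mulrA.
      by rewrite [RHS]mulrA divfK// gt_eqF.
    have b1 : 1 < b by apply: lt_le_trans b2; rewrite ltr1n.
    apply: (legendre_scale K1 a1 b1 evenF smallF largeF growF).
    by rewrite normrM normfV (gtr0_norm cc0) ler_wpM2r// invr_ge0 ltW.
  rewrite -ge0_sume_distrr; last by move=> i _; exact: legendre_ge0.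
  by rewrite lee_wpmul2l ?lee_fin ?addr_ge0 ?powR_ge0// rho_sum.
have kapP : kap <= C1 `^ b * (q / p) `^ a * ((r / g) `^ a + (r / g) `^ b).
  have rg0 : 0 <= r / g by rewrite divr_ge0// ltW.
  have X0 : 0 <= C1 * (q / p) by apply: mulr_ge0; exact: ltW.
  have Y0 : 0 <= C1 * (q / p) * (r / g) by exact: mulr_ge0.
  have KT : K * t0 <= C1 * (q / p) * (r / g).
    have -> : K * t0 = C1 * (q / p) * (r / g) / 2.
      by rewrite /t0 /cc /C1; field; rewrite !gt_eqF ?expR_gt0.
    by rewrite ler_pdivrMr// ler_peMr// ler1n.
  have KT0 : 0 <= K * t0.
    rewrite mulr_ge0 ?(ltW K0)// /t0 !mulr_ge0 ?invr_ge0 ?(ltW g0) ?(ltW cc0) ?(ltW q0)//.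
  (* As C1 >= 1 its exponent may be raised to b, and as q/p <= 1 its exponent may be lowered to a;
     only r/g keeps d. *)
  have pw d : a <= d -> d <= b -> (K * t0) `^ d <= C1 `^ b * (q / p) `^ a * (r / g) `^ d.
    move=> ad db; have d0 : 0 <= d by apply: le_trans ad; apply: ltW; exact: lt_trans a1.
    apply: (@le_trans _ _ ((C1 * (q / p) * (r / g)) `^ d)).
      by rewrite ge0_ler_powR ?nnegrE.
    rewrite powRM// powRM ?(ltW C10) ?(ltW qp0)//.
    rewrite ler_wpM2r ?powR_ge0// ler_pM ?powR_ge0//.
      exact: ler_powR.
    by apply: powR_le_anti; rewrite ?qp0.
  by rewrite /kap mulrDr lerD// pw//; exact: le_trans b2.
apply: le_trans (lee_wpmul2r _ P1) _; first by rewrite lee_fin powR_ge0.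
rewrite -!EFinM lee_fin.
have X d : 0 <= d <= p -> (r / g) `^ d * g `^ q <= g `^ q + A `^ (q - p) * r `^ p.
  exact: powR_div_mul_le.
have ap : 0 <= a <= p by rewrite (ltW (lt_trans ltr01 a1)) (le_trans a2 p2).
have b0p : 0 <= b <= p by rewrite (le_trans _ b2).
have h : ((r / g) `^ a + (r / g) `^ b) * g `^ q <= 2 * (g `^ q + A `^ (q - p) * r `^ p).
  rewrite mulrDl [leRHS]mulr_natl mulr2n; apply: lerD; exact: X.
have := ler_wpM2r (powR_ge0 g q) kapP; rewrite -[leRHS]mulrA => h2.
have CQ0 : 0 <= C1 `^ b * (q / p) `^ a by rewrite mulr_ge0 ?powR_ge0.
have h3 := le_trans h2 (ler_wpM2l CQ0 h).
have := ler_wpM2l (ltW p0) h3; congr (_ <= _); first by ring.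
by rewrite /c2; ring.
Qed.

Lemma poincare_step q : p <= b -> 2 <= q -> q <= p ->
  \int[mu]_x (w x `^ (q / 2)) <=
  poincare_step_constant b D * (\int[mu]_x (w x `^ (q / 4))) ^+ 2.
Proof.
move=> pb q2 qp.
have q0 : 0 < q by exact: lt_le_trans q2.
have b0 : 0 < b by exact: lt_le_trans p0 pb.
(* The absorption step: z1 is at most half of E, and moving it to the left doubles the other
   terms. *)
have aux (E z1 z2 z3 z4 : R) : E - z4 <= z1 + 2 * z2 -> z1 <= 1 / 2 * E -> z2 <= z3 ->
    E <= 2 * z4 + 4 * z3 by lra.
rewrite /poincare_step_constant; set B := D * b ^+ 2 * expR 7 ^+ 2 / 8 + 1.
have B1 : 1 <= B by rewrite lerDr divr_ge0// !mulr_ge0 ?sqr_ge0// ltW.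
have B0 : 0 < B by exact: lt_le_trans B1.
set delta := (2 * B)^-1.
have delta0 : 0 < delta by rewrite invr_gt0 mulr_gt0.
have delta1 : delta <= 1 by rewrite invf_le1 ?mulr_gt0//; apply: le_trans B1 _; rewrite ler_peMl ?ler1n// ltW.
have q40 : 0 <= q / 4 by rewrite divr_ge0// ltW.
pose u x := w x `^ (q / 4).
have bu : bounded_measurable u by exact: bounded_measurable_shifted_powR.
have u2E : (fun x => u x ^+ 2) = (fun x => w x `^ (q / 2)).
  by apply/funext => x; rewrite /u shifted_powR_sqr.
have lu : locally_lipschitz u by exact: locally_lipschitz_shifted_powR.
have [_ [N uN]] := bu.
have := poincare smallF largeF D0 muLSI lu uN; rewrite u2E.
(* From |s| <= q / (2 g) <= b / (2 g) and |y| <= e^7 r one gets |s y|^2 <= c3 (r/g)^2. *)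
set c3 := b ^+ 2 * expR 7 ^+ 2 / 4.
have c30 : 0 < c3 by rewrite divr_gt0// mulr_gt0// exprn_gt0// expR_gt0.
set d1 := delta `^ (1 - p / 2); have d10 : 0 < d1 by rewrite powR_gt0.
have H : (\int[mu]_x (\sum_i gradient u x 0 i ^+ 2)%R%:E <=
    (c3 * delta * \int[mu]_x (w x `^ (q / 2)) + 2 * (c3 * d1) * A `^ q)%R%:E)%E.
  apply: integral_powR_bound_cst; rewrite ?(ltW q0)//.
  - apply/measurable_EFinP; apply: measurable_sum => i; apply: measurable_funX.
    exact: gradient_measurable.
  - by move=> x; rewrite lee_fin sumr_ge0// => i _; exact: sqr_ge0.
  - by rewrite mulr_ge0// ltW.
  - by rewrite mulr_gt0.
  move=> x r Ar rr; have r0 : 0 < r by exact: lt_le_trans Ar.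
  have := rho_norm r0 rr; have := sqr_div_mul_le A0 (shifted_norm_ge x) r0 qp p2 delta0.
  have := log_gradient_coef_le x (ltW q0); have := log_gradient_shifted x q.
  have -> : w x `^ (q / 2) = (w x `^ (1 / 2)) `^ q by rewrite shifted_powR_norm; congr powR; field.
  have ux0 : 0 < u x by rewrite powR_gt0 ?shifted_sqr_gt0.
  have u2g : u x ^+ 2 = (w x `^ (1 / 2)) `^ q.
    by rewrite /u shifted_powR_sqr shifted_powR_norm; congr powR; field.
  set g := w x `^ (1 / 2); have g0 : 0 < g by exact: lt_le_trans A0 (shifted_norm_ge x).
  set s := q / 2 * (f x - c) / w x; set y := gradient f x => ls sg h1 h2.
  rewrite lee_fin.
  have -> : \sum_i gradient u x 0 i ^+ 2 = s ^+ 2 * g `^ q * \sum_i y 0 i ^+ 2.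
    have -> : gradient u x = u x *: (s *: y) by rewrite -ls scalerA mulfV ?gt_eqF// scale1r.
    by rewrite mulr_sumr; apply: eq_bigr => i _; rewrite !mxE -u2g; ring.
  have s2 : s ^+ 2 <= (b / 2 / g) ^+ 2.
    rewrite -[leLHS]real_normK ?num_real// ler_pXn2r ?nnegrE// ?divr_ge0 ?(ltW b0) ?(ltW g0)//.
    by apply: le_trans sg _; rewrite !ler_pM2r ?invr_gt0//; exact: le_trans qp pb.
  have h3 : s ^+ 2 * g `^ q * (\sum_i y 0 i ^+ 2) <= (b / 2 / g) ^+ 2 * g `^ q * (expR 7 * r) ^+ 2.
    apply: ler_pM => //; first by rewrite mulr_ge0 ?sqr_ge0 ?powR_ge0.
      by rewrite sumr_ge0// => i _; exact: sqr_ge0.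
    by rewrite ler_wpM2r ?powR_ge0.
  apply: le_trans h3 _.
  have -> : (b / 2 / g) ^+ 2 * g `^ q * (expR 7 * r) ^+ 2 = c3 * ((r / g) ^+ 2 * g `^ q).
    by rewrite /c3; field; rewrite gt_eqF.
  apply: le_trans (ler_wpM2l (ltW c30) h1) _.
  by rewrite mulrDr !mulrA.
have D20 : (0 <= (D / 2)%:E)%E by rewrite lee_fin divr_ge0// ltW.
move=> /le_trans/(_ (lee_wpmul2l D20 H)).
rewrite -EFinM lee_fin; set E2 := \int[mu]_x (w x `^ (q / 2)); set E1 := \int[mu]_x (w x `^ (q / 4)).
have AE : A `^ q <= E1 ^+ 2.
  have -> : A `^ q = (A `^ (2 * (q / 4))) ^+ 2.
    by rewrite -powR_mulrn ?powR_ge0// -powRrM; congr powR; field.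
  have h1 : A `^ (2 * (q / 4)) <= E1 by apply: Rintegral_ge_cst => // x; exact: shifted_powR_ge.
  by rewrite ler_pXn2r// nnegrE ?powR_ge0// (le_trans _ h1) ?powR_ge0.
have E20 : 0 <= E2 by apply: Rintegral_ge0 => x _; exact: powR_ge0.
have cB : D / 2 * c3 <= B.
  have -> : D / 2 * c3 = D * b ^+ 2 * expR 7 ^+ 2 / 8 by rewrite /c3; field.
  by rewrite lerDl.
(* Removes p from the constant: delta <= 1 and 1 - p/2 >= - b/2. *)
have d1d : d1 <= delta `^ (- (b / 2)).
  apply: powR_le_anti; first by rewrite delta0.
  lra.
set d2 := delta `^ (- (b / 2)) in d1d *.
have Bd : B * delta = 1 / 2 by rewrite /delta; field; rewrite gt_eqF.
have t1 : D / 2 * c3 * (delta * E2) <= 1 / 2 * E2.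
  by rewrite -Bd -[leRHS]mulrA; apply: ler_wpM2r cB; rewrite mulr_ge0// ltW.
have t2 : D / 2 * c3 * (d1 * A `^ q) <= B * (d2 * E1 ^+ 2).
  have z0 : 0 <= D / 2 * c3 by apply: mulr_ge0; [exact: divr_ge0 (ltW D0) _|exact: ltW].
  apply: ler_pM z0 _ cB _; first by apply: mulr_ge0; [exact: ltW|exact: powR_ge0].
  by apply: ler_pM d1d AE; [exact: ltW|exact: powR_ge0].
have -> : D / 2 * (c3 * delta * E2 + 2 * (c3 * d1) * A `^ q) =
  D / 2 * c3 * (delta * E2) + 2 * (D / 2 * c3 * (d1 * A `^ q)) by ring.
have -> : (2 + 4 * B * d2) * E1 ^+ 2 = 2 * E1 ^+ 2 + 4 * (B * (d2 * E1 ^+ 2)) by ring.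
move=> h; exact: aux h t1 t2.
Qed.

Context (cE : c = \int[mu]_x f x).

Let bf : bounded_measurable f.
Proof. by apply: bounded_lipschitz_bounded_measurable => //; exists M. Qed.

(** As r >= A, r^2 <= A^(2 - p) r^p, so the squared gradient has integral at most 2 e^14 A^2 and the
    Poincare inequality bounds the variance by D e^14 A^2. *)
Lemma integral_shifted_sqr : \int[mu]_x w x <= (A * Num.sqrt (D * expR 7 ^+ 2 + 1)) ^+ 2.
Proof.
have E0 : 0 <= D * expR 7 ^+ 2 + 1 by rewrite addr_ge0// mulr_ge0 ?sqr_ge0// ltW.
rewrite exprMn sqr_sqrtr//.
have -> : \int[mu]_x w x = \int[mu]_x (f x ^+ 2) - (\int[mu]_x f x) ^+ 2 + A ^+ 2.
  have -> : w = (fun x => f x ^+ 2 + ((- 2 * c) * f x + (c ^+ 2 + A ^+ 2))).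
    by apply/funext => x; rewrite /w; ring.
  have bc z : bounded_measurable (fun _ : 'rV[R]_n => z) by exact: bounded_measurable_cst.
  have b1 := bounded_measurableZ (- 2 * c) bf.
  rewrite bounded_measurable_RintegralD; last 2 first.
  - exact: bounded_measurableX.
  - exact: bounded_measurableD.
  rewrite bounded_measurable_RintegralD// bounded_measurable_RintegralZ//.
  by rewrite Rintegral_probability_cst -cE; ring.
have [_ [N fN]] := bf.
have := poincare smallF largeF D0 muLSI lf fN => P1.
have H : (\int[mu]_x (\sum_i gradient f x 0 i ^+ 2)%R%:E <=
    (0 * \int[mu]_x (w x `^ (2 / 2)) + 2 * expR 7 ^+ 2 * A `^ 2)%R%:E)%E.
  apply: integral_powR_bound_cst => //; rewrite ?exprn_gt0 ?expR_gt0//.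
  - apply/measurable_EFinP; apply: measurable_sum => i; apply: measurable_funX.
    exact: gradient_measurable.
  - by move=> x; rewrite lee_fin sumr_ge0// => i _; exact: sqr_ge0.
  move=> x r Ar rr; have r0 : 0 < r by exact: lt_le_trans Ar.
  rewrite lee_fin mul0r add0r; apply: le_trans (rho_norm r0 rr) _.
  rewrite exprMn ler_wpM2l ?sqr_ge0//.
  have -> : A `^ (2 - p) * r `^ p = r ^+ 2 * (A `^ (2 - p) * r `^ (p - 2)).
    have -> : r `^ p = r `^ (2 + (p - 2)) by congr powR; ring.
    by rewrite [X in _ * X = _]powRD ?(gt_eqF r0) ?implybT// powR_mulrn ?(ltW r0)//; ring.
  rewrite ler_peMr ?sqr_ge0//.
  have e1 : A `^ (2 - p) * A `^ (p - 2) = 1.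
    rewrite -powRD ?(gt_eqF A0) ?implybT//.
    by rewrite addrA subrK subrr powRr0.
  by rewrite -[leLHS]e1 ler_wpM2l ?powR_ge0// ge0_ler_powR ?nnegrE ?subr_ge0 ?(ltW A0) ?(ltW r0).
have D20 : (0 <= (D / 2)%:E)%E by rewrite lee_fin divr_ge0// ltW.
have := le_trans P1 (lee_wpmul2l D20 H); rewrite -EFinM lee_fin mul0r add0r powR_mulrn ?(ltW A0)// => h.
apply: (le_trans (lerD h (lexx (A ^+ 2)))).
by rewrite le_eqVlt; apply/orP; left; apply/eqP; field.
Qed.

Lemma bounded_moment_bound :
  (\int[mu]_x (`|f x - c| `^ p)%:E <= ((moment_constant K a b D * A) `^ p)%:E)%E.
Proof.
set T := Num.sqrt (D * expR 7 ^+ 2 + 1).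
have T0 : 0 < T.
  by rewrite sqrtr_gt0 ltr_wpDl// mulr_ge0 ?sqr_ge0// ltW.
have AT0 : 0 < A * T by exact: mulr_gt0.
have b0 : 0 < b by exact: lt_le_trans b2.
have bw s : 0 <= s -> bounded_measurable (fun x => w x `^ s).
  exact: bounded_measurable_shifted_powR.
have m0 s : 0 <= s -> 0 <= \int[mu]_x (w x `^ s).
  by move=> s0; apply: Rintegral_ge0 => x _; exact: powR_ge0.
(* With z = w / (A T)^2 one has z^(q/2) <= z + 1 and E z <= 1, hence the bound 2 (A T)^q, at most (2
   A T)^q because q >= 1. *)
have low q : 1 <= q <= 2 -> \int[mu]_x (w x `^ (q / 2)) <= (2 * (A * T)) `^ q.
  move=> /andP[q1 q2]; have q0 : 0 < q by exact: lt_le_trans q1.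
  have q20 : 0 <= q / 2 by rewrite divr_ge0// ltW.
  have B2 : (A * T) `^ q = ((A * T) ^+ 2) `^ (q / 2).
    by rewrite -powR_mulrn ?(ltW AT0)// -powRrM mulrCA mulfV// mulr1.
  have bw1 : bounded_measurable w.
    have -> : w = (fun x => w x `^ 1) by apply/funext => x; rewrite powRr1// ltW ?shifted_sqr_gt0.
    exact: bw.
  apply: (@le_trans _ _ (\int[mu]_x ((A * T) `^ q * (((A * T) ^+ 2)^-1 * w x + 1)))).
    have bc z : bounded_measurable (fun _ : 'rV[R]_n => z) by exact: bounded_measurable_cst.
    apply: bounded_measurable_le_Rintegral => [||x].
    - exact: bw.
    - by apply: bounded_measurableZ; apply: bounded_measurableD => //; exact: bounded_measurableZ.
    have w0 := shifted_sqr_gt0 x; have AT20 : 0 < (A * T) ^+ 2 by rewrite exprn_gt0.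
    set v := (A * T) ^+ 2 in B2 AT20 *; rewrite B2.
    have -> : w x `^ (q / 2) = v `^ (q / 2) * (v^-1 * w x) `^ (q / 2).
      by rewrite -powRM ?(ltW AT20) ?mulr_ge0 ?invr_ge0 ?(ltW w0) ?(ltW AT20)// mulVKf ?gt_eqF.
    rewrite ler_wpM2l ?powR_ge0//.
    have z0 : 0 <= v^-1 * w x by rewrite mulr_ge0 ?invr_ge0 ?(ltW w0) ?(ltW AT20).
    have [z1|/ltW z1] := leP (v^-1 * w x) 1.
      apply: (@le_trans _ _ 1); last by rewrite lerDr.
      have e1 : 1 `^ (q / 2) = 1 :> R by rewrite powR1.
      by rewrite -[leRHS]e1 ge0_ler_powR// nnegrE.
    apply: (@le_trans _ _ (v^-1 * w x)); last by rewrite lerDl.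
    by rewrite -[leRHS]powRr1// ler_powR// ler_pdivrMr// mul1r.
  have bc z : bounded_measurable (fun _ : 'rV[R]_n => z) by exact: bounded_measurable_cst.
  rewrite bounded_measurable_RintegralZ; last first.
    by apply: bounded_measurableD => //; exact: bounded_measurableZ.
  rewrite bounded_measurable_RintegralD//; last exact: bounded_measurableZ.
  rewrite bounded_measurable_RintegralZ// Rintegral_probability_cst.
  rewrite [leRHS]powRM ?(ltW AT0)// [leRHS]mulrC ler_wpM2l ?powR_ge0//.
  apply: (@le_trans _ _ (2 `^ 1)); last by rewrite ler_powR// ler1n.
  have AT20 : 0 < (A * T) ^+ 2 by rewrite exprn_gt0.
  rewrite powRr1// -[leRHS]/(1 + 1) lerD2r mulrC ler_pdivrMr// mul1r.
  exact: integral_shifted_sqr.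
have k0 := step_exponent_ge0 K D0 (ltW b0).
have pc1 := poincare_step_constant_ge1 b D0.
have lnpc0 : 0 <= ln (poincare_step_constant b D) by exact: ln_ge0.
have step q : 2 <= q <= p -> \int[mu]_x (w x `^ (q / 2)) <= (\int[mu]_x (w x `^ (q / 4))) ^+ 2 *
    expR (step_exponent K b D * (q * (q / p) `^ (a - 1))).
  move=> /andP[q2 qp]; have q0 : 0 < q by exact: lt_le_trans q2.
  have t0 : 0 <= q * (q / p) `^ (a - 1) by rewrite mulr_ge0 ?powR_ge0// ltW.
  have [bp|/ltW pb] := leP b p.
    apply: le_trans (lsi_step bp q2 qp) _.
    rewrite ler_wpM2l ?sqr_ge0// ler_expR ler_wpM2r// lerDl mulr_ge0//.
    exact: ltW.
  apply: le_trans (poincare_step pb q2 qp) _.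
  rewrite mulrC ler_wpM2l ?sqr_ge0//.
  rewrite -[leLHS](@lnK R) ?posrE ?(lt_le_trans _ pc1)// ler_expR.
  (* Puts the constant of the Poincare step into exponential form: q (q/p)^(a - 1) >= q/p >= 1/b, by
     a - 1 <= 1 and p <= b. *)
  have h : b^-1 <= q * (q / p) `^ (a - 1).
    apply: (@le_trans _ _ (q / p)).
      rewrite ler_pdivlMr// mulrC ler_pdivrMr//.
      by apply: (@le_trans _ _ (1 * b)); [rewrite mul1r|rewrite ler_pM2r// (le_trans _ q2)// ler1n].
    have qp0 : 0 < q / p by exact: divr_gt0.
    have qp1 : q / p <= 1 by rewrite ler_pdivrMr// mul1r.
    apply: (@le_trans _ _ ((q / p) `^ (a - 1))).
      rewrite -[leLHS]powRr1 ?(ltW qp0)//; apply: powR_le_anti; first by rewrite qp0.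
      by rewrite lerBlDr.
    by rewrite ler_peMl ?powR_ge0// (le_trans _ q2)// ler1n.
  apply: (@le_trans _ _ (b * ln (poincare_step_constant b D) * (q * (q / p) `^ (a - 1)))).
    rewrite -[leLHS](mulfK (lt0r_neq0 b0)) [X in _ <= X * _]mulrC.
    by apply: ler_wpM2l h; rewrite mulr_ge0// ltW.
  rewrite ler_wpM2r// lerDr !mulr_ge0 ?powR_ge0//; exact: ltW.
have := moment_iteration a1 p0 k0 m0 low step.
move=> /(_ p); rewrite lexx andbT => /(_ (ltW (lt_le_trans (ltr1n R 2) p2))).
rewrite mulfV ?gt_eqF// powR1 mulr1; set S := step_exponent K b D / _ => h.
have p20 : 0 <= p / 2 by rewrite divr_ge0// ltW.
apply: (@le_trans _ _ (\int[mu]_x (w x `^ (p / 2))%:E)%E).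
  apply: ge0_le_integral => //.
  - apply/measurable_EFinP; apply: measurableT_comp (measurable_powR _) _.
    apply: measurableT_comp => //; apply: measurable_funB => //; first by case: bf.
  - by apply/measurable_EFinP; case: (bw _ p20).
  move=> x _; rewrite lee_fin shifted_powR_norm.
  have -> : 2 * (p / 2) = p by field.
  by rewrite ge0_ler_powR ?nnegrE ?powR_ge0 ?(ltW p0)// norm_shift_le.
rewrite -bounded_measurable_RintegralE; last exact: bw.
rewrite lee_fin (le_trans h)//.
have -> : moment_constant K a b D * A = 2 * (A * T) * expR S.
  by rewrite /moment_constant -/T -/S; ring.
by rewrite [leRHS]powRM ?expR_ge0 ?mulr_ge0 ?(ltW A0) ?(ltW T0)// -expRM.
Qed.
End moment_step.

(** * Independence and truncation *)

Section moment_seminorm.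
Context {d} {Omega : measurableType d} {R : realType} (P : probability Omega R)
  (n : nat) (Z : Omega -> 'rV[R]_n) (p : R).

Definition moment (y : 'rV[R]_n) : \bar R := (\int[P]_w (`|dotrV y (Z w)| `^ p)%:E)%E.

Lemma moment_ge0 y : (0 <= moment y)%E.
Proof. by apply: integral_ge0 => w _; rewrite lee_fin powR_ge0. Qed.

Context (mZ : forall i, measurable_fun setT (fun w => Z w 0 i)).

Lemma measurable_powR_dotrV d' (T : measurableType d') (h : T -> 'rV[R]_n) :
  (forall i, measurable_fun setT (fun x => h x 0 i)) ->
  measurable_fun setT (fun xw : T * Omega => (`|dotrV (h xw.1) (Z xw.2)| `^ p)%:E).
Proof.
move=> mh; apply/measurable_EFinP; apply: measurableT_comp (measurable_powR _) _.
apply: measurableT_comp => //; apply: measurable_sum => i; apply: measurable_funM.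
- exact: measurableT_comp (mh i) measurable_fst.
- exact: measurableT_comp (mZ i) measurable_snd.
Qed.

Lemma moment_measurable d' (T : measurableType d') (h : T -> 'rV[R]_n) :
  (forall i, measurable_fun setT (fun x => h x 0 i)) ->
  measurable_fun setT (fun x => moment (h x)).
Proof.
move=> mh; apply: (@measurable_fun_fubini_tonelli_F _ _ T Omega R P
  (fun xw : T * Omega => (`|dotrV (h xw.1) (Z xw.2)| `^ p)%:E)).
  exact: measurable_powR_dotrV.
by move=> ?; rewrite lee_fin powR_ge0.
Qed.

Lemma momentZ (r : R) y : moment (r *: y) = ((`|r| `^ p)%:E * moment y)%E.
Proof.
rewrite /moment -ge0_integralZl_EFin ?powR_ge0//.
- apply: eq_integral => w _; have -> : dotrV (r *: y) (Z w) = r * dotrV y (Z w).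
    by rewrite /dotrV mulr_sumr; apply: eq_bigr => i _; rewrite mxE mulrA.
  by rewrite normrM powRM.
- apply/measurable_EFinP; apply: measurableT_comp (measurable_powR _) _.
  apply: measurableT_comp => //; apply: measurable_sum => i.
  by apply: measurable_funM.
Qed.

Lemma moment_scale_le1 y r : 0 < r -> (moment y <= (r `^ p)%:E)%E ->
  (moment (r^-1 *: y) <= 1)%E.
Proof.
move=> r0 h; rewrite momentZ gtr0_norm ?invr_gt0//.
apply: (@le_trans _ _ ((r^-1 `^ p)%:E * (r `^ p)%:E)%E).
  by rewrite lee_wpmul2l// lee_fin powR_ge0.
by rewrite lee_fin -powRM ?invr_ge0 ?(ltW r0)// mulVf ?gt_eqF// powR1.
Qed.

Context (F : R -> R) (K b : R) (K1 : 1 <= K) (b1 : 1 < b) (p2 : 2 <= p)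
  (evenF : forall x, F `|x| = F x)
  (smallF : forall x, `|x| <= 1 -> F x = x ^+ 2)
  (largeF : forall x, 1 <= `|x| -> `|x| <= F x).
Context (indZ : independent_family P (fun i w => Z w 0 i))
  (symZ : forall i, symmetric_rv P (fun w => Z w 0 i))
  (tailF : forall i t, 1 <= t -> P [set w | t <= `|Z w 0 i|] = (expR (- F t))%:E).

Let p0 : 0 < p. Proof. exact: lt_le_trans p2. Qed.

Lemma moment_dual y r (t : 'I_n -> R) : 0 < r -> (moment y <= (r `^ p)%:E)%E ->
  (forall i, 0 <= t i) -> \sum_i F (t i) <= p ->
  \sum_i `|r^-1 * y 0 i| * t i <= expR 7.
Proof.
move=> r0 /(moment_scale_le1 r0) h t0 tp.
have lF x : 1 <= x -> x <= F x.
  by move=> x1; have := @largeF x; rewrite ger0_norm ?(le_trans _ x1)//; apply.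
apply: (dual_moment_bound smallF lF mZ indZ symZ tailF p2 _ t0 tp).
apply: le_trans h; rewrite le_eqVlt; apply/orP; left; apply/eqP.
by apply: eq_integral => w _; congr (`|_| `^ p)%:E; apply: eq_bigr => i _; rewrite mxE.
Qed.

(** The dual bound is tested with t = |y| / N, N being the Euclidean norm: these coordinates are at
    most 1, where F is the square, so sum F(t_i) = 1 <= p. *)
Lemma moment_sqr_norm_le y r : 0 < r -> (moment y <= (r `^ p)%:E)%E ->
  \sum_i y 0 i ^+ 2 <= (expR 7 * r) ^+ 2.
Proof.
move=> r0 h; set S := \sum_i _.
have S0 : 0 <= S by apply: sumr_ge0 => i _; exact: sqr_ge0.
have [S00|Sn0] := eqVneq S 0; first by rewrite S00 sqr_ge0.
set N := Num.sqrt S; have N0 : 0 < N by rewrite sqrtr_gt0 lt_neqAle eq_sym Sn0.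
have NS : N ^+ 2 = S by rewrite sqr_sqrtr.
pose t i := `|y 0 i| / N.
have t0 i : 0 <= t i by rewrite divr_ge0// ltW.
have t1 i : t i <= 1.
  rewrite ler_pdivrMr// mul1r -(@ler_pXn2r _ 2)// ?nnegrE ?(ltW N0)//.
  by rewrite NS real_normK ?num_real// /S (bigD1 i)//= lerDl sumr_ge0// => j _; exact: sqr_ge0.
have tE : \sum_i F (t i) = 1.
  rewrite (eq_bigr (fun i => y 0 i ^+ 2 / S)) -?mulr_suml ?mulfV// => i _.
  rewrite smallF ?ger0_norm//.
  by rewrite /t exprMn real_normK ?num_real// exprVn NS.
have := moment_dual r0 h t0; rewrite tE => /(_ (le_trans (ler1n _ 2) p2)).
have -> : \sum_i `|r^-1 * y 0 i| * t i = N / r.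
  rewrite (eq_bigr (fun i => y 0 i ^+ 2 / (N * r))) -?mulr_suml => [|i _].
    by rewrite -/S -NS; field; rewrite !gt_eqF.
  rewrite normrM (gtr0_norm (_ : 0 < r^-1)) ?invr_gt0// /t -[y 0 i ^+ 2]real_normK ?num_real//.
  by field; rewrite !gt_eqF.
rewrite ler_pdivrMr// => NE; rewrite -NS.
by rewrite ler_pXn2r// nnegrE ?(ltW N0)// mulr_ge0 ?expR_ge0 ?ltW.
Qed.

Lemma sum_legendre_moment_le a (growF : forall t u, 1 <= t ->
    K^-1 * t `^ conj_exponent b * F u <= F (t * u)
      <= K * t `^ conj_exponent a * F u) y r :
  0 < r -> (moment y <= (r `^ p)%:E)%E ->
  (\sum_i legendre (fun x => (F x)%:E) (p / (expR 7 * K) * (r^-1 * y 0 i))%R <= p%:E)%E.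
Proof.
move=> r0 h.
have H t : (forall i, 0 <= t i) -> \sum_i F (t i) <= p ->
    \sum_i `|(r^-1 *: y) 0 i| * t i <= expR 7.
  move=> t0 tp; apply: le_trans (moment_dual r0 h t0 tp).
  by rewrite le_eqVlt; apply/orP; left; apply/eqP; apply: eq_bigr => i _; rewrite mxE.
have := sum_legendre_le K1 b1 evenF smallF largeF growF p0 (expR_gt0 7) H.
apply: le_trans; rewrite le_eqVlt; apply/orP; left; apply/eqP.
by apply: eq_bigr => i _; rewrite mxE.
Qed.
End moment_seminorm.

(** Away from 0 the power is differentiable; at 0 it is dominated by |u| itself once |u| < 1, since
    p >= 1. *)
Lemma cvg_powR_norm {R : realType} (T : Type) (F : set_system T) {FF : Filter F}
    (u : T -> R) (z p : R) : 1 <= p ->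
  u t @[t --> F] --> z -> (`|u t| `^ p) @[t --> F] --> `|z| `^ p.
Proof.
move=> p1 uz; have p0 : 0 < p by exact: lt_le_trans p1.
have [z0|zn0] := eqVneq z 0; last first.
  have nz : 0 < `|z| by rewrite normr_gt0.
  apply: (@cvg_comp _ _ _ (fun t => `|u t|) (fun y => y `^ p) _ (nbhs `|z|)); first exact: cvg_norm.
  have cp : {for `|z|, continuous (fun y : R => y `^ p)}.
    apply/differentiable_continuous/derivable1_diffP.
    by have [] := is_derive1_powR p nz.
  exact: cp.
rewrite z0 normr0 powR0 ?gt_eqF//; apply/cvgrPdist_lt => e e0.
have d0 : 0 < Num.min e 1 by rewrite lt_min e0 ltr01.
move/cvgrPdist_lt : uz => /(_ _ d0); apply: filterS => t.
rewrite z0 !sub0r !normrN lt_min => /andP[ue u1].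
rewrite ger0_norm ?powR_ge0//; apply: le_lt_trans ue.
have [->|un0] := eqVneq `|u t| 0; first by rewrite powR0 ?gt_eqF.
rewrite -[leRHS]powRr1//.
have -> : p = 1 + (p - 1) by ring.
rewrite powRD ?un0 ?implybT// ler_piMr ?powR_ge0//.
have e1 : 1 `^ (p - 1) = 1 :> R by rewrite powR1.
by rewrite -[leRHS]e1 ge0_ler_powR ?subr_ge0 ?nnegrE// ltW.
Qed.

(** * Limits of central moments *)

Section limits_of_integrals.
Context d (T : measurableType d) {R : realType} (mu : probability T R).
Implicit Types (u : nat -> T -> R) (g : T -> R).

Lemma fatou_le u g (c : R) : (forall k, measurable_fun setT (u k)) ->
  (forall k x, 0 <= u k x) -> (forall x, u k x @[k --> \oo] --> g x) ->
  (forall k, (\int[mu]_x (u k x)%:E <= c%:E)%E) -> (\int[mu]_x (g x)%:E <= c%:E)%E.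
Proof.
move=> mu_ u0 ug uc.
have mE k : measurable_fun setT (EFin \o u k) by exact/measurable_EFinP.
have := @fatou _ T R mu setT measurableT (fun k => EFin \o u k) mE (fun k x _ => u0 k x).
rewrite (eq_integral (fun x => (g x)%:E)); last first.
  move=> x _; have h : (u k x)%:E @[k --> \oo] --> (g x)%:E.
    by apply: cvg_EFin; [exact: nearW|exact: ug].
  by have [] := cvg_limn_einf_sup h.
move=> /le_trans; apply; rewrite limn_einf_lim; apply: lime_le; first exact: is_cvg_einfs.
by apply: nearW => k; apply: le_trans (uc k); apply: ereal_inf_lbound; exists k => /=.
Qed.

Lemma integral_probability_cst (c : R) : (\int[mu]_x c%:E)%E = c%:E.
Proof.
rewrite -bounded_measurable_RintegralE ?Rintegral_probability_cst//.
exact: bounded_measurable_cst.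
Qed.

Lemma measurable_level_set g (m : R) : measurable_fun setT g ->
  measurable [set x | `|g x| <= m].
Proof.
move=> mg; have mn : measurable_fun setT (fun x => `|g x|) by exact: measurableT_comp.
have -> : [set x | `|g x| <= m] = setT `&` (fun x => `|g x|) @^-1` `]-oo, m].
  by apply/seteqP; split => x /=; rewrite in_itv; [|case].
exact: mn.
Qed.

Lemma exists_level_set g : measurable_fun setT g ->
  exists m : nat, ((2^-1)%:E <= mu [set x | (`|g x| <= m%:R)%R])%E.
Proof.
move=> mg; apply: contrapT => /forallNP H.
pose A (m : nat) := [set x | `|g x| <= m%:R].
have mA m : measurable (A m) by exact: measurable_level_set.
have UA : \bigcup_m A m = setT.
  apply/seteqP; split => // x _; exists (Num.truncn `|g x|).+1 => //=.
  by rewrite /A/= ltW// truncnS_gt.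
have := @nondecreasing_cvg_mu _ T R mu A mA _ _.
rewrite UA => /(_ measurableT) h.
have {}h : mu \o A @ \oo --> mu setT.
  apply: h => m1 m2 m12; apply/subsetPset => x /= /le_trans; apply.
  by rewrite ler_nat.
have : (mu setT <= (2^-1)%:E)%E.
  by apply: (cvge_to_le h); apply: nearW => m /=; have /negP := H m; rewrite -ltNge => /ltW.
by rewrite probability_setT lee_fin invf_ge1// lern1.
Qed.

(** The means c_k must first be bounded. On a set of mass at least 1/2 one has |g| <= m, hence |u_k|
    <= m and |c_k| - m <= |u_k - c_k|, whose integral is at most 1 + Q. Fatou's lemma then makes g
    integrable, dominated convergence gives convergence of the means, and Fatou's lemma again gives
    the moment bound. *)
Lemma central_moment_limit u g (p Q : R) : 1 <= p -> measurable_fun setT g ->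
  (forall k, bounded_measurable (u k)) -> (forall k x, `|u k x| <= `|g x|) ->
  (forall x, u k x @[k --> \oo] --> g x) ->
  (forall k, (\int[mu]_x (`|u k x - \int[mu]_y u k y| `^ p)%:E <= Q%:E)%E) ->
  mu.-integrable setT (EFin \o g) /\
  (\int[mu]_x (`|g x - \int[mu]_y g y| `^ p)%:E <= Q%:E)%E.
Proof.
move=> p1 mg bu ug cu uQ; have p0 : 0 < p by exact: lt_le_trans p1.
pose c k := \int[mu]_y u k y.
have mcu k : measurable_fun setT (fun x => u k x - c k).
  by apply: measurable_funB => //; case: (bu k).
have mpu k : measurable_fun setT (fun x => `|u k x - c k| `^ p).
  apply: measurableT_comp (measurable_powR _) _.
  exact: measurableT_comp.
have dev k : (\int[mu]_x `|u k x - c k|%:E <= (1 + Q)%:E)%E.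
  apply: (@le_trans _ _ (\int[mu]_x (1 + (`|u k x - c k| `^ p)%:E))%E).
    apply: ge0_le_integral => //.
    - by apply/measurable_EFinP; exact: measurableT_comp.
    - by apply: emeasurable_funD => //; exact/measurable_EFinP.
    move=> x _; rewrite lee_fin; set z := `|_|.
    have [z1|/ltW z1] := leP z 1; first by rewrite (le_trans z1)// lerDl powR_ge0.
    rewrite -[leLHS]powRr1 ?(le_trans _ z1)//.
    by apply: (@le_trans _ _ (z `^ p)); [exact: ler_powR|rewrite lerDr].
  rewrite ge0_integralD//; last exact/measurable_EFinP.
  by rewrite (integral_probability_cst 1) EFinD leeD2l.
have [m mh] := exists_level_set mg.
pose A := [set x | `|g x| <= m%:R].
have mA : measurable A by exact: measurable_level_set.
have cb k : `|c k| <= m%:R + 2 * (1 + Q).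
  have Q0 : 0 <= 1 + Q.
    by have := dev k; rewrite -lee_fin; apply: le_trans; exact: integral_ge0.
  rewrite -lerBlDl; have [cm|/ltW cm] := leP (`|c k| - m%:R) 0.
    by apply: le_trans cm _; rewrite mulr_ge0.
  rewrite mulrC -ler_pdivrMr// -lee_fin; apply: le_trans (dev k).
  apply: (@le_trans _ _ (\int[mu]_x ((`|c k| - m%:R)%:E * (\1_A x)%:E))%E).
    rewrite ge0_integralZl_EFin//; last exact/measurable_EFinP.
    rewrite integral_indic// setIT EFinM lee_wpmul2l//.
  apply: ge0_le_integral => //.
  - by move=> x _; rewrite mule_ge0// lee_fin.
  - by apply: measurable_funeM; exact/measurable_EFinP.
  - by apply/measurable_EFinP; exact: measurableT_comp.
  move=> x _; rewrite lee_fin indicE; have [/set_mem xA|] := boolP (x \in A); last first.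
    by rewrite mulr0.
  rewrite mulr1 lerBlDr; apply: (@le_trans _ _ (`|u k x - c k| + `|u k x|)).
    by rewrite distrC; have := ler_normD (c k - u k x) (u k x); rewrite subrK.
  by rewrite lerD2l (le_trans (ug k x)).
have ig : mu.-integrable setT (EFin \o g).
  apply/integrableP; split; first exact/measurable_EFinP.
  apply: (@le_lt_trans _ _ (m%:R + 2 * (1 + Q) + (1 + Q))%:E); last exact: ltry.
  apply: (@fatou_le (fun k x => `|u k x|) (fun x => `|g x|)) => // [k|x|k].
  - by apply: measurableT_comp => //; case: (bu k).
  - exact: cvg_norm.
  apply: (@le_trans _ _ (\int[mu]_x (`|c k|%:E + `|u k x - c k|%:E))%E).
    apply: ge0_le_integral => //.
    - by apply/measurable_EFinP; apply: measurableT_comp => //; case: (bu k).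
    - by apply: emeasurable_funD => //; apply/measurable_EFinP; exact: measurableT_comp.
    by move=> x _; rewrite lee_fin -[X in `|X| <= _](subrKC (c k)) ler_normD.
  rewrite ge0_integralD//; last by apply/measurable_EFinP; exact: measurableT_comp.
  rewrite integral_probability_cst [leRHS]EFinD.
  by apply: leeD; rewrite ?lee_fin.
split=> //.
have cc : c k @[k --> \oo] --> \int[mu]_y g y.
  have h := @dominated_cvg _ _ _ mu setT measurableT (fun k x => (u k x)%:E) (EFin \o g)
    (fun x => `|g x|%:E) _ _ _ _ _.
  have {}h : (\int[mu]_x (u k x)%:E)%E @[k --> \oo] --> (\int[mu]_x (g x)%:E)%E.
    apply: h => //.
    - by move=> k; apply/measurable_EFinP; case: (bu k).
    - by move=> x _; apply: cvg_EFin; [exact: nearW|exact: cu].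
    - exact: integrable_abse ig.
    - by move=> k x _; rewrite lee_fin.
  rewrite -(fineK (integrable_fin_num measurableT ig)) in h.
  by move/fine_cvgP : h => [].
apply: (@fatou_le (fun k x => `|u k x - c k| `^ p)) => // x.
by apply: cvg_powR_norm => //; apply: cvgB.
Qed.

End limits_of_integrals.

(** * Smooth truncation of values *)

Section soft_truncation.
Context {R : realType}.
Implicit Types e y : R.

(** Smoothness makes the chain rule exact at every point, and the derivative is at most 1 in size,
    so composing f with it does not increase the moments of the gradient. *)
Definition soft_trunc e y : R := y / (1 + (e * y) ^+ 2).

Definition soft_trunc_deriv e y : R := (1 - (e * y) ^+ 2) / (1 + (e * y) ^+ 2) ^+ 2.

Lemma soft_trunc_denom_ge1 e y : 1 <= 1 + (e * y) ^+ 2.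
Proof. by rewrite lerDl sqr_ge0. Qed.

Lemma soft_trunc_denom_gt0 e y : 0 < 1 + (e * y) ^+ 2.
Proof. exact: lt_le_trans ltr01 (soft_trunc_denom_ge1 e y). Qed.

Lemma norm_soft_trunc_le e y : `|soft_trunc e y| <= `|y|.
Proof.
rewrite normrM normfV (gtr0_norm (soft_trunc_denom_gt0 e y)).
by rewrite ler_pdivrMr ?soft_trunc_denom_gt0// ler_peMr// soft_trunc_denom_ge1.
Qed.

Lemma norm_soft_trunc_bound e y : 0 < e -> `|soft_trunc e y| <= e^-1.
Proof.
move=> e0; rewrite normrM normfV (gtr0_norm (soft_trunc_denom_gt0 e y)).
rewrite ler_pdivrMr ?soft_trunc_denom_gt0// ler_pdivlMl//.
have -> : (e * y) ^+ 2 = (e * `|y|) ^+ 2 by rewrite !exprMn real_normK ?num_real.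
set z := e * `|y|; have := sqr_ge0 (z - 1); nra.
Qed.

Lemma norm_soft_trunc_deriv_le1 e y : `|soft_trunc_deriv e y| <= 1.
Proof.
have s0 := soft_trunc_denom_gt0 e y; have s1 := soft_trunc_denom_ge1 e y.
rewrite normrM normfV (gtr0_norm (exprn_gt0 _ s0)) ler_pdivrMr ?exprn_gt0// mul1r.
rewrite lerDl in s1; set z := (e * y) ^+ 2 in s1 *.
by rewrite ler_norml; apply/andP; split; nra.
Qed.

Lemma is_derive_soft_trunc e y : is_derive y 1 (soft_trunc e) (soft_trunc_deriv e y).
Proof.
have s0 := soft_trunc_denom_gt0 e y.
have dN : is_derive y 1 (fun z : R => 1 + (e * z) ^+ 2) (2 * e ^+ 2 * y).
  apply: (@is_derive_quadratic _ _ _ _ _ _ (e ^+ 2)) => h _.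
  rewrite /GRing.scale/= mulr1.
  have -> : 1 + (e * (h + y)) ^+ 2 - (1 + (e * y) ^+ 2) - h * (2 * e ^+ 2 * y) = e ^+ 2 * h ^+ 2 by ring.
  by rewrite ger0_norm// mulr_ge0 ?sqr_ge0.
have dV := @is_deriveV R (fun z => 1 + (e * z) ^+ 2) y _ 1 (lt0r_neq0 s0) dN.
have := is_deriveM (is_derive_id y 1) dV.
have -> : id y *: (- (1 + (e * y) ^+ 2) ^- 2 *: (2 * e ^+ 2 * y)) + (1 + (e * y) ^+ 2)^-1 *: 1 =
    soft_trunc_deriv e y.
  by rewrite /soft_trunc_deriv /GRing.scale/=; field; rewrite gt_eqF.
by [].
Qed.

Lemma continuous_soft_trunc_deriv e : continuous (soft_trunc_deriv e).
Proof.
move=> y; have s0 := soft_trunc_denom_gt0 e y.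
have c : (e * z) ^+ 2 @[z --> y] --> (e * y) ^+ 2.
  by apply: (@continuous_comp _ _ _ ( *%R e) (fun z => z ^+ 2));
    [apply: cvgM; [exact: cvg_cst|exact: cvg_id]|exact: exprn_continuous].
apply: cvgM; first by apply: cvgB => //; exact: cvg_cst.
apply: cvgV; first by rewrite expf_neq0// gt_eqF.
rewrite expr2; under eq_fun do rewrite expr2.
by apply: cvgM; (apply: cvgD; first exact: cvg_cst).
Qed.

Lemma cvg_soft_trunc y : soft_trunc k.+1%:R^-1 y @[k --> \oo] --> y.
Proof.
have h : k.+1%:R^-1 @[k --> \oo] --> (0 : R) by exact: cvg_harmonic.
have hy : k.+1%:R^-1 * y @[k --> \oo] --> 0 * y by apply: cvgM => //; exact: cvg_cst.
have l : y / (1 + (k.+1%:R^-1 * y) * (k.+1%:R^-1 * y)) @[k --> \oo] --> y / (1 + (0 * y) * (0 * y)).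
  apply: cvgM; first exact: cvg_cst.
  apply: cvgV; first by rewrite !mul0r addr0 oner_neq0.
  by apply: cvgD; [exact: cvg_cst|exact: cvgM].
rewrite !mul0r addr0 divr1 in l.
by under eq_fun do rewrite /soft_trunc expr2.
Qed.

End soft_truncation.

Section moment_bound.
Context {R : realType} {n : nat} (F : R -> R) (K a b D p : R).
Context (K1 : 1 <= K) (a1 : 1 < a) (a2 : a <= 2) (b2 : 2 <= b) (D0 : 0 < D) (p2 : 2 <= p)
  (evenF : forall x, F `|x| = F x)
  (smallF : forall x, `|x| <= 1 -> F x = x ^+ 2)
  (largeF : forall x, 1 <= `|x| -> `|x| <= F x)
  (growF : forall t u, 1 <= t ->
    K^-1 * t `^ conj_exponent b * F u <= F (t * u)
      <= K * t `^ conj_exponent a * F u).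

Context (mu : probability 'rV[R]_n R)
  (muLSI : mLSI (@sum_conjugate R n (fun x => (F x)%:E)) D mu).

Context d {Omega : measurableType d} (P : probability Omega R) (Z : Omega -> 'rV[R]_n)
  (mZ : forall i, measurable_fun setT (fun w => Z w 0 i))
  (indZ : independent_family P (fun i w => Z w 0 i))
  (symZ : forall i, symmetric_rv P (fun w => Z w 0 i))
  (tailF : forall i t, 1 <= t -> P [set w | t <= `|Z w 0 i|] = (expR (- F t))%:E).

Local Notation rho := (moment P Z p).

Lemma moment_bound f A : locally_lipschitz f -> 0 < A ->
  (\int[mu]_x rho (gradient f x) <= (A `^ p)%:E)%E ->
  mu.-integrable setT (EFin \o f) /\
  (\int[mu]_x (`|f x - \int[mu]_y f y| `^ p)%:E <= ((moment_constant K a b D * A) `^ p)%:E)%E.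
Proof.
move=> lf A0 fA.
pose e k : R := k.+1%:R^-1; have e0 k : 0 < e k by rewrite invr_gt0.
pose u k : 'rV[R]_n -> R := soft_trunc (e k) \o f.
have lu k : locally_lipschitz (u k).
  apply: locally_lipschitz_comp lf; first exact: is_derive_soft_trunc.
  exact: continuous_soft_trunc_deriv.
have uM k x : `|u k x| <= (e k)^-1 by exact: norm_soft_trunc_bound.
have mrho g : locally_lipschitz g -> measurable_fun setT (fun x => rho (gradient g x)).
  by move=> lg; apply: moment_measurable => // i; exact: gradient_measurable.
have b1 : 1 < b by apply: lt_le_trans b2; rewrite ltr1n.
have p1 : 1 <= p by apply: le_trans p2; rewrite ler1n.
apply: (@central_moment_limit _ _ _ _ u) => //.
- apply: continuous_measurable; exact: locally_lipschitz_continuous.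
- by move=> k; apply: bounded_lipschitz_bounded_measurable => //; exists (e k)^-1.
- by move=> k x; exact: norm_soft_trunc_le.
- by move=> x; exact: cvg_soft_trunc.
move=> k.
have rho0 y : (0 <= rho y)%E by exact: moment_ge0.
have rho_sum y r := @sum_legendre_moment_le _ _ _ _ _ _ _ mZ F K b K1 b1 p2 evenF smallF largeF indZ symZ
  tailF a growF y r.
have rho_norm y r := @moment_sqr_norm_le _ _ _ _ _ _ _ mZ F p2 smallF largeF indZ symZ tailF y r.
suff uA : (\int[mu]_x rho (gradient (u k) x) <= (A `^ p)%:E)%E.
  exact: (bounded_moment_bound K1 a1 a2 b2 D0 p2 evenF smallF largeF growF muLSI rho0
    rho_sum rho_norm (lu k) (uM k) (mrho _ (lu k)) A0 uA erefl).
apply: (le_trans _ fA).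
apply: (@ge0_le_integral _ _ _ mu setT measurableT (fun x => rho (gradient (u k) x))
  (fun x => rho (gradient f x)) (fun x _ => rho0 _) (mrho _ (lu k)) (mrho _ lf)).
move=> x _; rewrite (gradient_comp (is_derive_soft_trunc (e k) (f x)) lf).
rewrite momentZ//; apply: (@le_trans _ _ (1%:E * rho (gradient f x))%E); last by rewrite mul1e.
rewrite lee_wpmul2r ?moment_ge0// lee_fin.
have e1 : 1 `^ p = 1 :> R by rewrite powR1.
rewrite -[leRHS]e1 ge0_ler_powR ?nnegrE ?norm_soft_trunc_deriv_le1//.
exact: le_trans p1.
Qed.

End moment_bound.

(** * Real-valued form of the Young function *)

Section tilde_real.
Context {R : realType} (K alpha beta : R) (Phi : R -> \bar R).
Context (Phi_ge0 : forall x : R, 0 <= x -> (0 <= Phi x)%E)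
  (Phi_convex : convex_on_nneg Phi) (Phi0 : Phi 0 = 0%E) (Phi1 : Phi 1 = 1%E)
  (growth : growth_condition K alpha beta (tilde Phi)).
Implicit Types x t u : R.

Definition fine_tilde x : R := fine (tilde Phi x).

Lemma fine_tilde_norm x : fine_tilde `|x| = fine_tilde x.
Proof. by rewrite /fine_tilde /tilde normr_id. Qed.

Lemma fine_tilde_small x : `|x| <= 1 -> fine_tilde x = x ^+ 2.
Proof. by move=> x1; rewrite /fine_tilde /tilde x1/= real_normK ?num_real. Qed.

(** Finiteness beyond 1 comes from the upper growth bound at u = 1, where the modified function
    equals 1. *)
Lemma tildeE x : tilde Phi x = (fine_tilde x)%:E.
Proof.
rewrite /fine_tilde /tilde; case: ifPn => // x1.
have x1' : 1 <= `|x| by rewrite ltW// ltNge.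
have := growth x1' ltr01; rewrite mulr1 /tilde normr_id normr1 lexx expr1n.
rewrite (negPf x1) inve1 mule1 => /andP[_ h].
have := Phi_ge0 (normr_ge0 x); case: (Phi `|x|) h => //=.
Qed.

Lemma Phi_ge1E t : 1 <= t -> Phi t = (fine_tilde t)%:E.
Proof.
move=> t1; have t0 : 0 <= t by exact: le_trans t1.
have [->|tn1] := eqVneq t 1; first by rewrite Phi1 fine_tilde_small ?normr1// expr1n.
by rewrite -tildeE /tilde ger0_norm// leNgt lt_neqAle eq_sym tn1 t1.
Qed.

(** Convexity on [0, t] at the point 1 = t^-1 t gives 1 = Phi(1) <= Phi(t) / t. *)
Lemma fine_tilde_large x : 1 <= `|x| -> `|x| <= fine_tilde x.
Proof.
move=> x1; rewrite -fine_tilde_norm; set t := `|x| in x1 *.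
have t0 : 0 < t by exact: lt_le_trans x1.
have i01 : 0 <= t^-1 <= 1 by rewrite invr_ge0 ltW//= invf_le1.
have := Phi_convex (ltW t0) (lexx 0) i01.
rewrite mulr0 addr0 mulVf ?gt_eqF// Phi1 Phi0 mule0 adde0 Phi_ge1E// -EFinM lee_fin.
by rewrite ler_pdivlMl// mulr1.
Qed.

Lemma fine_tilde_gt0 x : x != 0 -> 0 < fine_tilde x.
Proof.
move=> x0; have [x1|/ltW x1] := leP `|x| 1.
  by rewrite fine_tilde_small// lt_neqAle eq_sym sqrf_eq0 x0 sqr_ge0.
by apply: lt_le_trans (fine_tilde_large x1); exact: lt_le_trans x1.
Qed.

Lemma fine_tilde_growth t u : 1 <= t ->
  K^-1 * t `^ conj_exponent beta * fine_tilde u <= fine_tilde (t * u)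
    <= K * t `^ conj_exponent alpha * fine_tilde u.
Proof.
move=> t1; have [->|u0] := eqVneq u 0.
  by rewrite mulr0 fine_tilde_small ?normr0// expr0n/= !mulr0 lexx.
have nu : 0 < `|u| by rewrite normr_gt0.
have := growth t1 nu; rewrite !tildeE.
have -> : fine_tilde (t * `|u|) = fine_tilde (t * u).
  by rewrite -[RHS]fine_tilde_norm normrM (ger0_norm (le_trans ler01 t1)).
rewrite fine_tilde_norm; have F0 := fine_tilde_gt0 u0.
rewrite inver gt_eqF// -EFinM !lee_fin => /andP[h1 h2].
by rewrite -ler_pdivlMr// h1 -ler_pdivrMr.
Qed.

End tilde_real.

(** * From random vectors to their laws *)

Section independent_pair_integral.
Context d d1 d2 {Omega : measurableType d} {T1 : measurableType d1} {T2 : measurableType d2}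
  {R : realType} (P : probability Omega R) (X : {RV P >-> T1}) (Z : {RV P >-> T2})
  (indXZ : independent_pair P X Z).

Let XZ w := (X w, Z w).

Let mXZ : measurable_fun setT XZ.
Proof. by apply: measurable_fun_pair; exact: measurable_funPT. Qed.

Let XZ_mixin := isMeasurableFun.Build _ _ _ _ _ mXZ.
Let XZ_mfun : {mfun Omega >-> (T1 * T2)%type} := HB.pack XZ XZ_mixin.

(** Independence says that the law of the pair agrees with the product of the two laws on
    rectangles, hence everywhere; Tonelli's theorem does the rest. *)
Lemma independent_pair_integral (G : T1 * T2 -> \bar R) :
  measurable_fun setT G -> (forall y, 0 <= G y)%E ->
  (\int[P]_w G (X w, Z w) = \int[distribution P X]_x \int[P]_w G (x, Z w))%E.
Proof.
move=> mG G0; rewrite -(@ge0_integral_distribution _ _ _ _ _ P XZ_mfun)//.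
transitivity (\int[(distribution P X \x distribution P Z)%E]_y G y)%E.
  apply: eq_measure_integral => A mA _; apply/esym.
  apply: product_measure_unique => // B C mB mC; exact: indXZ.
rewrite fubini_tonelli1//; apply: eq_integral => x _.
rewrite /fubini_F ge0_integral_distribution//.
exact: measurableT_comp.
Qed.

End independent_pair_integral.

Lemma coord_rV_measurable {R : realType} {n : nat} (i : 'I_n) :
  measurable_fun setT (fun x : 'rV[R]_n => x 0 i).
Proof.
apply: continuous_measurable; apply: locally_lipschitz_continuous.
exact: locally_lipschitz_coord.
Qed.

Lemma integral_dotrV_gradient {R : realType} {n : nat} d {Omega : measurableType d}
    (P : probability Omega R) (X Z : {RV P >-> 'rV[R]_n}) (mu : probability 'rV[R]_n R)
    (f : 'rV[R]_n -> R) (p : R) :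
  (forall A, measurable A -> distribution P X A = mu A) -> independent_pair P X Z ->
  locally_lipschitz f ->
  (\int[mu]_x moment P Z p (gradient f x) =
   \int[P]_w (`|dotrV (gradient f (X w)) (Z w)| `^ p)%:E)%E.
Proof.
move=> Xmu indXZ lf.
have mgi i : measurable_fun setT (fun x => gradient f x 0 i) by exact: gradient_measurable.
have mG : measurable_fun setT (fun y : 'rV[R]_n * 'rV[R]_n =>
    (`|dotrV (gradient f y.1) y.2| `^ p)%:E).
  apply/measurable_EFinP; apply: measurableT_comp (measurable_powR _) _.
  apply: measurableT_comp => //; apply: measurable_sum => i; apply: measurable_funM.
  - exact: measurableT_comp (mgi i) measurable_fst.
  - exact: measurableT_comp (coord_rV_measurable i) measurable_snd.
have := @independent_pair_integral _ _ _ _ _ _ _ P X Z indXZ _ mG.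
move=> /(_ (fun y => _)) ->; last first.
  by move=> y; rewrite lee_fin powR_ge0.
by apply: eq_measure_integral => A mA _; apply/esym; exact: Xmu.
Qed.

Lemma Lnorm_EFin d (T : measurableType d) (R : realType) (P : probability T R) (h : T -> R) (p : R) :
  ('N[P]_(p%:E)[(fun w => (h w)%:E)] = (\int[P]_w (`|h w| `^ p)%:E) `^ p^-1)%E.
Proof. by rewrite unlock. Qed.

Section transfer.
Context {R : realType} {n : nat} d {Omega : measurableType d} (P : probability Omega R)
  (X : {RV P >-> 'rV[R]_n}) (mu : probability 'rV[R]_n R)
  (Xmu : forall A, measurable A -> distribution P X A = mu A).

Lemma ge0_integral_law (g : 'rV[R]_n -> \bar R) : measurable_fun setT g ->
  (forall x, 0 <= g x)%E -> (\int[P]_w g (X w) = \int[mu]_x g x)%E.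
Proof.
move=> mg g0; rewrite -[LHS]/(\int[P]_w (g \o X) w)%E -ge0_integral_distribution//.
by apply: eq_measure_integral => A mA _; exact: Xmu.
Qed.

Lemma expectation_law (f : 'rV[R]_n -> R) : measurable_fun setT f ->
  mu.-integrable setT (EFin \o f) -> fine 'E_P[f \o X] = \int[mu]_x f x.
Proof.
move=> mf fi; have mE : measurable_fun setT (EFin \o f) by exact/measurable_EFinP.
have iX : P.-integrable setT ((EFin \o f) \o X).
  apply/integrableP; split; first exact: measurableT_comp.
  case/integrableP : fi => _; apply: le_lt_trans.
  rewrite -(ge0_integral_law (g := fun x => `|(EFin \o f) x|%E))//.
  exact: measurableT_comp.
rewrite unlock /Rintegral; congr fine.
rewrite -[LHS]/(\int[P]_w ((EFin \o f) \o X) w)%E -integral_distribution//.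
by apply: eq_measure_integral => A mA _; exact: Xmu.
Qed.

End transfer.

Theorem corollary3p12 (R : realType) (K alpha beta D : R)
    (hK : 1 <= K) (halpha : 1 < alpha <= 2) (hbeta : 2 <= beta) (hD : 0 < D) :
  exists C : R, 0 < C /\
  forall (n : nat) (Phi : R -> \bar R),
    (forall x : R, 0 <= x -> (0 <= Phi x)%E) ->
    convex_on_nneg Phi ->
    nondecreasing_on_nneg Phi ->
    Phi 0 = 0%E ->
    Phi 1 = 1%E ->
    growth_condition K alpha beta (tilde Phi) ->
  forall mu : probability 'rV[R]_n R,
    mu `<< @lebesgue_rV R n ->
    mLSI (@sum_conjugate R n (tilde Phi)) D mu ->
  forall (d : measure_display) (Omega : measurableType d)
      (P : probability Omega R) (X Z : {RV P >-> 'rV[R]_n}),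
    (forall A : set 'rV[R]_n, measurable A -> distribution P X A = mu A) ->
    independent_pair P X Z ->
    independent_family P (fun i w => Z w 0 i) ->
    identically_distributed P (fun (i : 'I_n) w => Z w 0 i) ->
    (forall i : 'I_n, symmetric_rv P (fun w => Z w 0 i)) ->
    (forall (i : 'I_n) (t : R), 0 <= t ->
      P [set w | t <= `|Z w 0 i|] = expeR (- Phi t)%E) ->
  forall f : 'rV[R]_n -> R, locally_lipschitz f ->
  forall p : R, 2 <= p ->
    ('N[P]_(p%:E)[(fun w => (f (X w) - fine 'E_P[f \o X])%:E)] <=
     C%:E * 'N[P]_(p%:E)[(fun w => (dotrV (gradient f (X w)) (Z w))%:E)])%E.
Proof.
have [a1 a2] := andP halpha.
have C0 : 0 < moment_constant K alpha beta D by exact: moment_constant_gt0.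
exists (moment_constant K alpha beta D); split=> //.
move=> n Phi Phi_ge0 Phi_convex _ Phi0 Phi1 growth mu _ muLSI d Omega P X Z Xmu indXZ indZ _
  symZ tailZ f lf p p2.
set C := moment_constant K alpha beta D in C0 *.
have p0 : 0 < p by exact: lt_le_trans p2.
pose F := fine_tilde Phi.
have tE : tilde Phi = (fun x => (F x)%:E).
  by apply/funext => x; exact: (tildeE Phi_ge0 growth).
rewrite tE in muLSI.
have mZ i : measurable_fun setT (fun w => Z w 0 i).
  exact: measurableT_comp (coord_rV_measurable i) _.
have tailF i t : 1 <= t -> P [set w | t <= `|Z w 0 i|] = (expR (- F t))%:E.
  by move=> t1; rewrite tailZ ?(le_trans ler01)// (Phi_ge1E Phi_ge0 Phi1 growth).
have bound := moment_bound hK a1 a2 hbeta hD p2 (@fine_tilde_norm _ Phi) (@fine_tilde_small _ Phi)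
  (fine_tilde_large Phi_ge0 Phi_convex Phi0 Phi1 growth)
  (fine_tilde_growth Phi_ge0 Phi_convex Phi0 Phi1 growth) muLSI mZ indZ symZ tailF lf.
rewrite !Lnorm_EFin -(integral_dotrV_gradient _ Xmu indXZ lf).
have mf : measurable_fun setT f.
  by apply: continuous_measurable; exact: locally_lipschitz_continuous.
set I := (\int[mu]_x _)%E in bound *.
have I0 : (0 <= I)%E by apply: integral_ge0 => x _; exact: moment_ge0.
(* If the moment of the gradient is infinite, so is the right-hand side, because 1/p and C are
   positive. *)
case: I I0 bound => [s s0 bound|_ _|//]; last first.
  by rewrite poweRyr ?invr_neq0 ?gt_eqF// gt0_muley ?lte_fin// leey.
rewrite lee_fin in s0; rewrite poweR_EFin.
apply/lee_addgt0Pr => e e0.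
(* [moment_bound] needs A > 0, while s may vanish. The excess e / C costs exactly e after
   multiplication by C. *)
pose A := s `^ p^-1 + e / C.
have A0 : 0 < A by rewrite ltr_wpDl ?powR_ge0// divr_gt0.
have sA : (s%:E <= (A `^ p)%:E)%E.
  have {1}-> : s = (s `^ p^-1) `^ p by rewrite -powRrM mulVf ?gt_eqF// powRr1.
  by rewrite lee_fin ge0_ler_powR ?nnegrE ?powR_ge0 ?(ltW p0) ?(ltW A0)// lerDl divr_ge0 ?ltW.
have [fi fb] := bound _ A0 sA.
(* The integrability in [fi] makes [fine] return the genuine mean of f(X) and not a default
   value. *)
rewrite (expectation_law Xmu mf fi).
have mg : measurable_fun setT (fun x => (`|f x - \int[mu]_y f y| `^ p)%:E).
  apply/measurable_EFinP; apply: measurableT_comp (measurable_powR _) _.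
  by apply: measurableT_comp => //; apply: measurable_funB.
rewrite (ge0_integral_law Xmu mg) => [|x]; last by rewrite lee_fin powR_ge0.
have CA0 : 0 <= C * A by rewrite mulr_ge0// ltW.
apply: (@le_trans _ _ (((C * A) `^ p)%:E `^ p^-1)%E).
  apply: gt0_ler_poweR fb; first by rewrite invr_ge0 ltW.
  - by rewrite in_itv/= leey andbT integral_ge0// => x _; rewrite lee_fin powR_ge0.
  - by rewrite in_itv/= leey andbT lee_fin powR_ge0.
rewrite poweR_EFin -powRrM mulfV ?gt_eqF// powRr1//.
by rewrite lee_fin /A mulrDr mulrCA mulfV ?gt_eqF// mulr1.
Qed.
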